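(* Suppose $G$ is a compactly generated locally compact Abelian group. Let $\Omega\subseteq G$ be a symmetric subset ($\Omega=-\Omega$) with $0\in\operatorname{int}\Omega$, and let $\rho,\sigma\in X'=M(G;\mathbb{R})$, where $X=C^{\infty,1}(G;\mathbb{R})$, $\sigma$ is strictly positive definite and $\rho$ is even. Write $\Omega^c:=G\setminus\Omega$. Let \[ \mathcal{F}_G^\sigma(\Omega):=\{ f\in C^{\infty,1}(G;\mathbb{R}) : f \text{ positive definite},\ f|_{\Omega^c}\le 0,\ \langle f,\sigma\rangle=1\}, \] and, for $\Theta\subseteq G$, let $\mathcal{M}_G(\Theta)$ be the set of all $\mu\in M(G;\mathbb{R})$ of the form $\mu=\nu-\kappa$ with $\nu,\kappa\in M(G;\mathbb{R})$, $\kappa\ge 0$, $\operatorname{supp}(\kappa)\subseteq\overline{\Theta}$, and $\nu$ of positive type. Consider the linear programming ''primal'' extremal problem \[ \alpha_\sigma^\rho(\Omega):=\inf\{\langle f,\rho\rangle : f\in\mathcal{F}_G^\sigma(\Omega)\}. \] Then its linear programming dual problem is \[ \omega_\sigma^\rho(\overline{\Omega^c}):=\sup\{ s\in\mathbb{R} : \rho-s\sigma\in\mathcal{M}_G(\Omega^c)\}, \] and there is no duality gap between the two problems, i.e. $\alpha_\sigma^\rho(\Omega)=\omega_\sigma^\rho(\overline{\Omega^c})$.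
   Context: Locally compact Abelian groups are Hausdorff and written additively with neutral element $0$. Fix a discrete subgroup $L\cong\mathbb{Z}^d$ of $G$ with $G/L$ compact and a relatively compact Borel set $B\subseteq G$ with $\overline{B}=-\overline{B}$ and boundary of Haar measure zero, such that every $g\in G$ is uniquely $g=\ell+b$ with $\ell\in L$, $b\in B$ (such a choice exists). Put $\|f\|_X:=\sum_{\ell\in L}\|f|_{B+\ell}\|_\infty$ and $X=C^{\infty,1}(G;\mathbb{R}):=\{f\in C(G;\mathbb{R}):\|f\|_X<\infty\}$, a Banach space (set and topology do not depend on the choice of $L,B$). A (real) Radon measure is an element of the dual of $C_c(G;\mathbb{R})$ with its inductive limit topology; it is written $\psi=\psi^+-\psi^-$ with its (minimal) positive and negative parts $\psi^\pm$, which are identified with positive Radon–Borel measures, and $|\psi|=\psi^++\psi^-$. $\psi$ is translation bounded if for some compact neighborhood $K$ of $0$ one has $\sup_{x\in G}|\psi|(K+x)<\infty$. $M(G;\mathbb{R})$ is the space of real translation bounded Radon measures; it is identified with the topological dual $X'$ via $\langle f,\psi\rangle=\int_G f\,d\psi^+-\int_G f\,d\psi^-$, extended complex-linearly to complex-valued functions. A function $f:G\to\mathbb{C}$ is positive definite if $\sum_{k,l=1}^n c_k\overline{c_l}f(x_k-x_l)\ge0$ for all $n$, $c_k\in\mathbb{C}$, $x_k\in G$. A measure $\mu\in M(G;\mathbb{R})$ is of positive type (positive definite) if $\langle u\star\widetilde u,\mu\rangle\ge0$ for all $u\in C_c(G;\mathbb{C})$, where $\widetilde u(x)=\overline{u(-x)}$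 and $\star$ is convolution with respect to Haar measure. $\mu$ is even if $\langle f(-\,\cdot),\mu\rangle=\langle f,\mu\rangle$ for all $f\in C_c(G;\mathbb{R})$. $\sigma\in M(G;\mathbb{R})$ is strictly positive definite if it is of positive type and $\langle f,\sigma\rangle>0$ for every nonzero positive definite $f\in X$. Conventions: $\inf\emptyset=\infty$, $\sup\emptyset=-\infty$. *)

(* Defs.v *)
From HB Require Import structures.
From mathcomp Require Import all_boot all_order all_algebra.
From mathcomp Require Import complex.
From mathcomp Require Import all_classical all_reals all_analysis.
Set Implicit Arguments.
Unset Strict Implicit.
Unset Printing Implicit Defensive.
Import Order.TTheory GRing.Theory Num.Theory numFieldNormedType.Exports.
Local Open Scope classical_set_scope.
Local Open Scope ring_scope.

(* MathComp-Analysis requires measurable types to be pointed; [pt G] is [G]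
   pointed at its neutral element. *)
Definition pt (G : topologicalZmodType) : Type := G.
HB.instance Definition _ (G : topologicalZmodType) := Choice.on (pt G).
HB.instance Definition _ (G : topologicalZmodType) :=
  isPointed.Build (pt G) (0 : G).

(* [G] with its Borel sigma-algebra. *)
Notation borelType G := (g_sigma_algebraType (@open G : set (set (pt G)))).
Notation borel_measure R G := {measure set (borelType G) -> \bar R}.

Section Groups.
Variable G : topologicalZmodType.

Definition lca_group : Prop := hausdorff_space G /\ locally_compact [set: G].

Definition is_subgroup (H : set G) : Prop :=
  H 0 /\ forall x y, H x -> H y -> H (x - y).

Definition compactly_generated : Prop :=
  exists2 K : set G, compact K &
    forall H : set G, is_subgroup H -> K `<=` H -> H = setT.

Definition coset (L : set G) (x : G) : set G := [set x + l | l in L].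

Definition same_coset (L : set G) (x y : G) : bool :=
  `[< coset L x = coset L y >].

Lemma same_coset_equiv (L : set G) : equiv_class_of (same_coset L).
Proof.
split=> [x|x y|y x z]; rewrite /same_coset.
- exact/asboolP.
- by apply/asbool_equiv_eq; split.
- by move=> /asboolP xy /asboolP yz; apply/asboolP; rewrite xy.
Qed.

Canonical coset_equiv (L : set G) := EquivRelPack (same_coset_equiv L).

(* [G / L] with the quotient topology. *)
Definition quotient_group (L : set G) :=
  quotient_topology {eq_quot (coset_equiv L)}%qT.

Definition is_lattice (d : nat) (L : set G) : Prop :=
  [/\ exists2 phi : {additive 'rV[int]_d -> G},
        injective phi & range phi = L,
      L `<=` isolated L &
      compact [set: quotient_group L]].

End Groups.

Section Measures.
Variables (R : realType) (G : topologicalZmodType).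
Implicit Types (m lambda : borel_measure R G) (f g : G -> R) (L B : set G).

Definition radon m : Prop :=
  [/\ forall K : set G, compact K -> (m K < +oo)%E,
      forall A : set (borelType G), measurable A ->
        m A = ereal_inf [set m U | U in [set U : set G | open U /\ A `<=` U]] &
      forall U : set G, open U ->
        m U = ereal_sup [set m K | K in [set K : set G | compact K /\ K `<=` U]]].

Definition is_haar lambda : Prop :=
  [/\ radon lambda,
      forall (x : G) (A : set (borelType G)), measurable A ->
        lambda [set x + y | y in A] = lambda A &
      lambda setT != 0%E].

Definition is_fundamental_domain lambda L B : Prop :=
  [/\ measurable (B : set (borelType G)),
      precompact B,
      closure B = [set - b | b in closure B],
      lambda (closure B `\` B°) = 0%E &
      forall g : G, exists! lb : G * G,
        [/\ L lb.1, B lb.2 & g = lb.1 + lb.2]].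

(* The Wiener-type norm of [C^{oo,1}(G; R)]. *)
Definition normX L B f : \bar R :=
  \esum_(l in L) ereal_sup [set `|f (b + l)|%:E | b in B].

Definition spaceX L B : set (G -> R) :=
  [set f | continuous f /\ (normX L B f < +oo)%E].

(* [C_c(G; K)], used for [K = R] and [K = R[i]]. *)
Definition fsupp (K : numFieldType) (f : G -> K) : set G :=
  closure [set x | f x != 0].

Definition Cc (K : numFieldType) : set (G -> K) :=
  [set f | continuous f /\ compact (fsupp f)].

Arguments Cc K : clear implicits.

Definition sup_norm f : \bar R := ereal_sup [set `|f x|%:E | x in setT].

(* Elements of the dual of [C_c(G; R)]; only the values on [C_c(G; R)] matter.
   A linear form is continuous for the inductive limit topology iff its
   restriction to each [C_K], K compact, is bounded for the sup norm. *)
Definition radon_functional (psi : (G -> R) -> R) : Prop :=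
  (forall a f g, Cc R f -> Cc R g ->
     psi (fun x => a * f x + g x) = a * psi f + psi g) /\
  (forall K : set G, compact K -> exists C : R, forall f,
     Cc R f -> fsupp f `<=` K -> (`|psi f|%:E <= C%:E * sup_norm f)%E).

Definition decomposes (psi : (G -> R) -> R) (p n : borel_measure R G) : Prop :=
  [/\ radon p, radon n &
      forall f, Cc R f -> psi f = \int[p]_x f x - \int[n]_x f x].

(* [p] and [n] are the positive and negative parts of [psi]: they decompose
   [psi] and are the least positive Radon measures doing so. *)
Definition minimal_parts (psi : (G -> R) -> R) (p n : borel_measure R G) :
    Prop :=
  decomposes psi p n /\
  forall p' n' : borel_measure R G, decomposes psi p' n' ->
    forall f, Cc R f -> (forall x, 0 <= f x) ->
      \int[p]_x f x <= \int[p']_x f x /\ \int[n]_x f x <= \int[n']_x f x.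

(* A real Radon measure, bundled with the positive Borel measures identified
   with its positive and negative parts by the Riesz representation theorem. *)
Record radonMeasure := RadonMeasure {
  rm_fun :> (G -> R) -> R;
  rm_pos : borel_measure R G;
  rm_neg : borel_measure R G;
  rm_radon : radon_functional rm_fun;
  rm_parts : minimal_parts rm_fun rm_pos rm_neg }.

Implicit Types psi mu nu kappa rho sigma : radonMeasure.

Definition total_variation psi (A : set G) : \bar R :=
  (rm_pos psi A + rm_neg psi A)%E.

Definition translation_bounded psi : Prop :=
  exists K : set G, [/\ compact K, nbhs (0 : G) K &
    (ereal_sup [set total_variation psi [set (y + x)%R | y in K] | x in setT]
       < +oo)%E].

(* [M(G; R)] *)
Definition tb_measures : set radonMeasure := [set psi | translation_bounded psi].

Definition rm_support psi : set G :=
  [set x | forall U : set G, open_nbhs x U -> total_variation psi U != 0%E].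

Definition rm_nonneg psi : Prop :=
  forall f, Cc R f -> (forall x, 0 <= f x) -> 0 <= psi f.

Definition pairing f psi : R :=
  \int[rm_pos psi]_x f x - \int[rm_neg psi]_x f x.

Definition cpairing (u : G -> R[i]) psi : R[i] :=
  Complex (pairing (fun x => complex.Re (u x)) psi)
          (pairing (fun x => complex.Im (u x)) psi).

Definition rm_even psi : Prop :=
  forall f, Cc R f -> pairing (fun x => f (- x)) psi = pairing f psi.

Definition cintegral m (u : G -> R[i]) : R[i] :=
  Complex (\int[m]_x complex.Re (u x)) (\int[m]_x complex.Im (u x)).

Definition convolution lambda (u v : G -> R[i]) (x : G) : R[i] :=
  cintegral lambda (fun y => u y * v (x - y)).

Definition tilde (u : G -> R[i]) (x : G) : R[i] := (u (- x))^*.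

Definition positive_definite (f : G -> R[i]) : Prop :=
  forall (n : nat) (c : 'I_n -> R[i]) (x : 'I_n -> G),
    0 <= \sum_(k < n) \sum_(l < n) c k * (c l)^* * f (x k - x l).

Definition rpositive_definite f : Prop :=
  positive_definite (fun x => Complex (f x) 0).

Definition positive_type lambda psi : Prop :=
  forall u : G -> R[i], Cc (R[i] : numFieldType) u ->
    0 <= cpairing (convolution lambda u (tilde u)) psi.

Definition strictly_positive_definite lambda L B psi : Prop :=
  positive_type lambda psi /\
  forall f, spaceX L B f -> rpositive_definite f -> f <> (fun=> 0) ->
    0 < pairing f psi.

Definition primal_cone L B (Omega : set G) : set (G -> R) :=
  [set f | [/\ spaceX L B f, rpositive_definite f &
               forall x, (~` Omega) x -> f x <= 0]].

(* [F_G^sigma(Omega)] *)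
Definition primal_feasible L B sigma (Omega : set G) : set (G -> R) :=
  [set f | primal_cone L B Omega f /\ pairing f sigma = 1].

Definition alpha L B rho sigma (Omega : set G) : \bar R :=
  ereal_inf [set (pairing f rho)%:E | f in primal_feasible L B sigma Omega].

(* [M_G(Theta)] *)
Definition MG lambda (Theta : set G) : set radonMeasure :=
  [set mu | tb_measures mu /\ exists nu kappa,
    [/\ tb_measures nu /\ tb_measures kappa,
        forall f, Cc R f -> mu f = nu f - kappa f,
        rm_nonneg kappa,
        rm_support kappa `<=` closure Theta &
        positive_type lambda nu]].

(* The [s] for which the measure [rho - s sigma] belongs to [D]. *)
Definition multipliers (D : set radonMeasure) rho sigma : set R :=
  [set s | exists2 mu, D mu &
    forall f, Cc R f -> mu f = rho f - s * sigma f].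

Definition omega lambda rho sigma (Theta : set G) : \bar R :=
  ereal_sup [set s%:E | s in multipliers (MG lambda Theta) rho sigma].

Definition dual_cone (C : set (G -> R)) : set radonMeasure :=
  [set mu | tb_measures mu /\ forall f, C f -> 0 <= pairing f mu].

(* Feasible set of the conic LP dual, for the pairing of [spaceX] and [M(G; R)], of
     minimise [pairing f rho]  subject to  [C f] and [pairing f sigma = 1],
   which is  maximise [s]  subject to  [rho - s sigma] in the dual cone of [C]. *)
Definition lp_dual_feasible (C : set (G -> R)) rho sigma : set R :=
  multipliers (dual_cone C) rho sigma.

End Measures.

(* Main.v *)
(* The primal problem minimizes over the cone of p.d. functions that are [<= 0]
   off [Omega], so the point is that an even [mu] in the dual of that cone splits
   as [nu - kappa], with [nu] of positive type and [kappa >= 0] living off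
   [Omega]. Such a [kappa] is any linear form below the sublinear form
     [S g = inf {mu p | p p.d. in C_c, p <= - g_even off Omega}],
   which is finite because, for a p.d. bump [E >= 0] supported in [Omega], a
   multiple of a finite sum of functions [2 E - E (. - a) - E (. + a)] lies below
   any given [- |g|] off [Omega]. The Riesz theorem and the Jordan decomposition
   of functionals turn [kappa] and [nu = mu + kappa] into Radon measures.
   Conversely a measure [nu] of positive type is nonnegative on p.d. [f] in
   [C_c]: by Cholesky factorization of the matrices [f (x_i - x_j)],
   [sum_ij f (x_i - x_j) E (. - x_i + x_j)] is a sum of autocorrelations, and for
   suitable points [x_i] (a Folner argument) its normalization approximates [f].
   The same almost invariant p.d. bumps cut a p.d. [f] in [X] off to p.d.
   functions in [C_c].
   Strict positive definiteness of [sigma] makes every nonzero element of the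
   cone a positive multiple of a feasible one, whence [alpha] is itself a dual
   multiplier when it is finite. *)
From HB Require Import structures.
Require Import Defs.
From mathcomp Require Import all_boot all_order all_algebra.
From mathcomp Require Import complex ring lra.
From mathcomp Require Import all_classical all_reals all_analysis.
From mathcomp Require Import measurable_realfun.
Set Implicit Arguments.
Unset Strict Implicit.
Unset Printing Implicit Defensive.
Import Order.TTheory GRing.Theory Num.Theory numFieldNormedType.Exports.
Local Open Scope classical_set_scope.
Local Open Scope ring_scope.

(** * Compactly supported continuous functions on a locally compact group *)

(** The splitting of [mu] would usually come from a bipolar argument, whose hard point is that the
    sum of the two dual cones is weak-* closed. The Hahn-Banach minorant yields [kappa] directly,
    and no closure is taken. Symmetrizing [g] in [S] makes [kappa] vanish on odd functions. This is
    essential because positive type is tested on complex functions: for [u = a + i b] the imaginary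
    part of the pairing is the difference of the values at the correlations of [b, a] and of [a, b],
    and it must vanish. For [mu = rho - s sigma] the corresponding symmetry comes from the evenness
    of [rho] and the positive type of [sigma]. The form [kappa] must also be translation bounded.
    For [0 <= g <= E (. - x)] the p.d. function [E - (E (. - x) + E (. + x)) / 2] is admissible in
    [S g], and [mu] is bounded on such functions uniformly in [x]. All arguments use real functions
    and their correlations, without Fourier transform; the complex notions are translated once. The
    lattice makes [G] sigma-compact, so that cutoffs form a sequence and Fatou's lemma and dominated
    convergence apply. *)

Lemma compact_seq_cover (T : topologicalType) (K : set T) (U : T -> set T) :
  compact K -> (forall x, K x -> open_nbhs x (U x)) ->
  exists s : seq T, (forall x, x \in s -> K x) /\
    forall y, K y -> exists2 x, x \in s & U x y.
Proof.
move=> cK oU; have [K0|/set0P[x0 _]] := eqVneq K set0.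
  by exists [::]; split=> // y; rewrite K0.
(* [compact_cover] is stated for pointed spaces, hence the separate case of empty [K]. *)
pose T0 := isPointed.Build (Topological.sort T) x0.
pose PT : ptopologicalType := HB.pack (Topological.sort T) T0 (Topological.class T).
have cK' : compact (K : set PT) by exact: cK.
have [] := eq_ind _ (fun F => F K) cK' _ (compact_cover PT) T K U.
- by move=> x Kx; have [] := oU x Kx.
- by move=> x Kx; exists x => //; have [] := oU x Kx.
move=> D DK KD; exists (finmap.enum_fset D); split.
  by move=> x xD; have := DK x xD; rewrite inE.
by move=> y /KD[x xD Uxy]; exists x.
Qed.

(** * Translations, sums and reflections in a topological group *)

Section TopologicalGroup.
Context {G : topologicalZmodType}.

Lemma addr_continuous (a : G) : continuous (fun x : G => x + a).
Proof.
move=> x; apply: (@continuous_comp _ _ _ (fun x : G => (x, a)) (fun x => x.1 + x.2)).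
  by apply: cvg_pair => /=; [exact: cvg_id|exact: cvg_cst].
exact: add_continuous.
Qed.

Lemma addl_continuous (a : G) : continuous (fun x : G => a + x).
Proof. by under eq_fun do rewrite addrC; exact: addr_continuous. Qed.

Lemma nbhs0_sub (U : set G) : nbhs 0 U ->
  exists2 V : set G, open_nbhs 0 V & forall x y, V x -> V y -> U (x - y).
Proof.
move=> U0.
have : nbhs (0, 0) [set xy : G * G | U (xy.1 - xy.2)].
  by apply: sub_continuous; rewrite /= subr0.
move=> [[A B] /= [A0 B0] AB].
exists (A°`&` B°).
  split; first by apply: openI; exact: open_interior.
  by split.
move=> x y [/interior_subset Ax _] [_ /interior_subset By].
exact: (AB (x, y)).
Qed.

Lemma open_shift (U : set G) (a : G) : open U -> open [set x | U (x - a)].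
Proof.
by move=> oU; apply: (@open_comp _ _ (fun x : G => x - a)) => // x _; exact: addr_continuous.
Qed.

Lemma compact_add (A B : set G) : compact A -> compact B ->
  compact [set a + b | a in A & b in B].
Proof.
move=> cA cB.
have -> : [set a + b | a in A & b in B] = (fun x : G * G => x.1 + x.2) @` (A `*` B).
  rewrite predeqE => x; split=> [[a Aa [b Bb <-]]|[[a b] [/= Aa Bb] <-]].
    by exists (a, b).
  by exists a => //; exists b.
apply: continuous_compact; last exact: compact_setX.
exact/continuous_subspaceT/add_continuous.
Qed.

Lemma compact_opp (A : set G) : compact A -> compact [set - a | a in A].
Proof.
by move=> cA; apply: continuous_compact => //; exact/continuous_subspaceT/opp_continuous.
Qed.

Lemma compact_shift (A : set G) (a : G) : compact A -> compact [set x | A (x - a)].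
Proof.
move=> cA; have -> : [set x | A (x - a)] = (fun x : G => x + a) @` A.
  rewrite predeqE => x; split=> [Ax|[y Ay <-]]; last by rewrite /= addrK.
  by exists (x - a) => //; rewrite subrK.
by apply: continuous_compact => //; exact/continuous_subspaceT/addr_continuous.
Qed.

End TopologicalGroup.

(** * The space [C_c]: closure properties, uniform continuity, bumps *)

Section Cc_functions.
Context {R : realType} {G : topologicalZmodType}.
Hypothesis hG : lca_group G.
Implicit Types (f g : G -> R) (K : set G).

Let hausG : hausdorff_space G. Proof. by case: hG. Qed.

Lemma lca_compact_closed K : compact K -> closed K.
Proof. by apply: compact_closed; case: hG. Qed.

(** Vanishing off some compact set is easier to check than compactness of the closed support;
    compact sets being closed, the two agree. *)
Lemma CcP (F : numFieldType) (f : G -> F) : Cc f <->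
  continuous f /\ exists2 K : set G, compact K & forall x, ~ K x -> f x = 0.
Proof.
split=> [[cf ck]|[cf [K cK Kf]]]; split=> //.
  exists (fsupp f) => // x; apply: contra_notP => /eqP fx.
  exact: subset_closure.
apply: (subclosed_compact _ cK); first exact: closed_closure.
rewrite [X in _ `<=` X]((closure_id K).1 (lca_compact_closed cK)).
apply: closureS => x /= /eqP; apply: contra_notP; exact: Kf.
Qed.

Lemma Cc_supp (F : numFieldType) (f : G -> F) : Cc f ->
  exists2 K : set G, compact K & forall x, ~ K x -> f x = 0.
Proof. by move=> /CcP[]. Qed.

Lemma Cc_continuous (F : numFieldType) (f : G -> F) : Cc f -> continuous f.
Proof. by case. Qed.

Lemma Cc0 : Cc (fun _ : G => 0 : R).
Proof.
by apply/CcP; split; [move=> x; exact: cvg_cst|exists set0 => //; exact: compact0].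
Qed.

Lemma CcD f g : Cc f -> Cc g -> Cc (fun x => f x + g x).
Proof.
move=> /CcP[cf [K cK fK]] /CcP[cg [L cL gL]]; apply/CcP; split.
  by move=> x; apply: cvgD; [exact: cf|exact: cg].
exists (K `|` L); first exact: compactU.
by move=> x /not_orP[? ?]; rewrite fK// gL// addr0.
Qed.

Lemma CcMl (a f : G -> R) : continuous a -> Cc f -> Cc (fun x => a x * f x).
Proof.
move=> ca /CcP[cf [K cK fK]]; apply/CcP; split.
  by move=> x; apply: cvgM; [exact: ca|exact: cf].
by exists K => // x /fK ->; rewrite mulr0.
Qed.

Lemma CcZ a f : Cc f -> Cc (fun x => a * f x).
Proof. by apply: CcMl => x; exact: cvg_cst. Qed.

Lemma CcN f : Cc f -> Cc (fun x => - f x).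
Proof. by move=> /(CcZ (-1)); under eq_fun do rewrite mulN1r. Qed.

Lemma CcB f g : Cc f -> Cc g -> Cc (fun x => f x - g x).
Proof. by move=> cf /CcN; exact: CcD. Qed.

Lemma Cc_sum (I : Type) (s : seq I) (F : I -> G -> R) :
  (forall i, Cc (F i)) -> Cc (fun x => \sum_(i <- s) F i x).
Proof.
move=> cF; elim: s => [|i s ih].
  by under eq_fun do rewrite big_nil; exact: Cc0.
by under eq_fun do rewrite big_cons; exact: CcD.
Qed.

Lemma Cc_norm f : Cc f -> Cc (fun x => `|f x|).
Proof.
move=> /CcP[cf [K cK fK]]; apply/CcP; split; last first.
  by exists K => // x /fK ->; rewrite normr0.
by move=> x; apply: cvg_norm; exact: cf.
Qed.

Lemma Cc_max f g : Cc f -> Cc g -> Cc (fun x => Num.max (f x) (g x)).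
Proof.
move=> cf cg.
under eq_fun do rewrite maxr_absE mulrC.
by apply: CcZ; apply: CcD; [exact: CcD|apply/Cc_norm/CcB].
Qed.

Lemma Cc_min f g : Cc f -> Cc g -> Cc (fun x => Num.min (f x) (g x)).
Proof.
move=> cf cg.
under eq_fun do rewrite minr_absE mulrC.
by apply: CcZ; apply: CcB; [exact: CcD|apply/Cc_norm/CcB].
Qed.

Lemma Cc_shift f (a : G) : Cc f -> Cc (fun x => f (x - a)).
Proof.
move=> /CcP[cf [K cK fK]]; apply/CcP; split.
  move=> x; apply: (@continuous_comp _ _ _ (fun x : G => x - a) f); last exact: cf.
  exact: addr_continuous.
by exists [set x | K (x - a)]; [exact: compact_shift|move=> x /fK].
Qed.

Lemma Cc_opp f : Cc f -> Cc (fun x => f (- x)).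
Proof.
move=> /CcP[cf [K cK fK]]; apply/CcP; split.
  move=> x; apply: (@continuous_comp _ _ _ (fun x : G => - x) f); last exact: cf.
  exact: opp_continuous.
exists [set - x | x in K]; first exact: compact_opp.
by move=> x Kx; apply: fK => Kx'; apply: Kx; exists (- x) => //; rewrite opprK.
Qed.

Lemma Cc_bounded f : Cc f -> exists2 M : R, 0 <= M & forall x, `|f x| <= M.
Proof.
move=> /CcP[cf [K cK fK]].
have [M [_ HM]] : bounded_set (f @` K).
  apply: compact_bounded; apply: continuous_compact => //.
  exact: continuous_subspaceT.
have HM' := HM (`|M| + 1).
exists (`|M| + 1); first by rewrite addr_ge0.
move=> x; have [Kx|/fK ->] := pselect (K x); last by rewrite normr0 addr_ge0.
by apply: HM'; [rewrite (le_lt_trans (ler_norm _))// ltrDl|exists x].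
Qed.

Lemma Cc_unif_continuous f (e : R) : Cc f -> 0 < e ->
  exists2 V : set G, open_nbhs 0 V & forall x y, V (x - y) -> `|f x - f y| <= e.
Proof.
move=> /CcP[cf [K cK fK]] e0.
have /choice[W HW] (x : G) : exists W : set G, open_nbhs 0 W /\
    forall u v, W u -> W v -> `|f (x + (u - v)) - f x| <= e / 2.
  have : nbhs 0 [set u : G | `|f (x + u) - f x| <= e / 2].
    have := @addl_continuous G x 0; rewrite /continuous_at => cx.
    have := cf x; rewrite -{1}(addr0 x) => cfx.
    have /cvgrPdist_le/(_ (e / 2)) := cvg_comp _ _ cx cfx.
    rewrite addr0 => H; have := H (divr_gt0 e0 (ltr0Sn _ _)).
    by apply: filterS => u; rewrite /= distrC.
  by move=> /nbhs0_sub[W oW HW]; exists W; split.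
(* Symmetrized, so that [x - a] is the difference of [y - a] and [y - x], both in [W a]. *)
pose W' x := [set u | W x u /\ W x (- u)].
have oW' x : open_nbhs 0 (W' x).
  have [[oW W0] _] := HW x; split; last by rewrite /W' /= oppr0.
  apply: openI => //; apply: (@open_comp _ _ (fun x : G => - x)) => // y _.
  exact: opp_continuous.
have [|s [_ sK]] := @compact_seq_cover _ K (fun x => [set y | W' x (y - x)]) cK.
  move=> x _; split; first by apply: open_shift; have [] := oW' x.
  by rewrite /= subrr; have [] := oW' x.
have {}key : exists2 V : set G, open_nbhs 0 V & forall x, x \in s -> V `<=` W' x.
  elim: s {sK} => [|x s [V [oV V0] VW]].
    by exists setT => //; split=> //; exact: openT.
  have [oWx Wx0] := oW' x.
  exists (V `&` W' x); first by split=> //; exact: openI.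
  move=> y; rewrite inE => /orP[/eqP ->|/VW ? z []//]; last by auto.
  by move=> z [].
have [V [oV V0] VW] := key.
have main x y : K y -> V (x - y) -> `|f x - f y| <= e.
  move=> Ky Vxy; have [a as_ aW] := sK y Ky.
  have [_ Ha] := HW a.
  have [W1 W2] := VW _ as_ _ Vxy; have [W3 W4] := aW.
  rewrite (_ : f x - f y = (f x - f a) - (f y - f a)); last by ring.
  rewrite (le_trans (ler_normB _ _))// [leRHS]splitr lerD//.
    have := Ha _ _ W3 W2; congr (`|f _ - _| <= _).
    by rewrite opprK [y - a + _]addrC subrKA addrC subrK.
  have := Ha _ _ W3 (nbhs_singleton (open_nbhs_nbhs (HW a).1)).
  by rewrite subr0 [a + _]addrC subrK.
(* The symmetry allows [x] and [y] to be exchanged when only [x] lies in [K]. *)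
exists (V `&` [set x | V (- x)]).
  split; last by rewrite /= oppr0.
  apply: openI => //; apply: (@open_comp _ _ (fun x : G => - x)) => // y _.
  exact: opp_continuous.
move=> x y [Vxy]; rewrite /= opprB => Vyx.
have [Ky|nKy] := pselect (K y); first exact: main.
have [Kx|nKx] := pselect (K x); first by rewrite distrC; exact: main.
by rewrite !fK// subrr normr0 ltW.
Qed.

Lemma lca_nbhs_compact (x : G) (U : set G) : open_nbhs x U ->
  exists2 V : set G, open_nbhs x V & compact (closure V) /\ closure V `<=` U.
Proof.
move=> [oU Ux].
have [_ lc] := hG.
have [W Wx [cW clW]] : exists2 W : set G, nbhs x W & compact W /\ closed W.
  have [W Wx cW] := lc x I; exists W => //.
  have {}Wx : nbhs x [set y | [set: G] y -> W y] by exact: Wx.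
  by apply: filterS Wx => y; apply.
have UW : nbhs x (U `&` W) by apply: filterI => //; exact: open_nbhs_nbhs.
have := @compact_regular _ x W hausG cW Wx _ UW.
case=> V Vx clV; exists V°.
  by split; [exact: open_interior|exact: Vx].
have sub : closure V° `<=` U `&` W.
  by apply: subset_trans clV; apply: closureS; exact: interior_subset.
split; last by move=> y /sub[].
by apply: subclosed_compact cW _; [exact: closed_closure|move=> y /sub[]].
Qed.

(** Urysohn's lemma from complete regularity: finitely many bumps, each equal to 1 at one point of
    [K], sum to more than 1/2 on [K]; the sum is doubled and truncated at 1. *)
Lemma Cc_bump K (U : set G) : compact K -> open U -> K `<=` U ->
  exists f, [/\ Cc f, (forall x, 0 <= f x <= 1), (forall x, K x -> f x = 1) &
    exists L, [/\ compact L, L `<=` U & forall x, ~ L x -> f x = 0]].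
Proof.
move=> cK oU KU.
have /choice[g Hg] (x : G) : exists g : G -> R, K x ->
    [/\ Cc g, forall y, 0 <= g y, g x = 1 &
    exists L, [/\ compact L, L `<=` U & forall y, ~ L y -> g y = 0]].
  have [Kx|nKx] := pselect (K x); last by exists (fun=> 0).
  have [|V [oV Vx] [cV VU]] := @lca_nbhs_compact x U; first by split=> //; exact: KU.
  have [_ lc] := hG.
  have := @locally_compact_completely_regular G R lc hausG x (~` V) (open_closedC oV).
  move=> /(_ (fun h => h Vx)) /(uniform_separatorP (R:=R))[h [ch h01 h0 h1]].
  have hV y : ~ V y -> h y = 1 by move=> Vy; apply: h1; exists y.
  exists (fun y => 1 - h y) => _; split.
  - apply/CcP; split; first by move=> y; apply: cvgB; [exact: cvg_cst|exact: ch].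
    exists (closure V) => // y Vy; rewrite hV ?subrr// => /subset_closure; exact: Vy.
  - by move=> y; have := h01 (h y) (imageT h y); rewrite /= in_itv/= subr_ge0 => /andP[].
  - by rewrite (_ : h x = 0) ?subr0//; apply: h0; exists x.
  - exists (closure V); split=> // y Vy; rewrite hV ?subrr// => /subset_closure; exact: Vy.
have [|s [sK Ks]] := @compact_seq_cover _ K
    (fun x => g x @^-1` [set r | 1 / 2 < r]) cK.
  move=> x Kx; have [cg _ gx1 _] := Hg x Kx; split.
    apply: (@open_comp _ _ (g x)); last exact: open_gt.
    by move=> y _; exact: (Cc_continuous cg).
  by rewrite /= gx1; lra.
pose S y := \sum_(x <- s) g x y.
have [SC S0 [L [cL LU SL]]] : [/\ Cc S, forall y, 0 <= S y &
    exists L, [/\ compact L, L `<=` U & forall y, ~ L y -> S y = 0]].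
  rewrite /S; elim: s sK {Ks S} => [_|x s ih sK].
    under eq_fun do rewrite big_nil; split=> //; first exact: Cc0.
      by move=> y; rewrite big_nil.
    by exists set0; split=> //; [exact: compact0|move=> y _; rewrite big_nil].
  have [|cS S0 [L [cL LU SL]]] := ih.
    by move=> y ys; apply: sK; rewrite inE ys orbT.
  have [|cg g0 _ [L' [cL' L'U gL']]] := Hg x; first by apply: sK; rewrite mem_head.
  split.
  - by under eq_fun do rewrite big_cons; exact: CcD.
  - by move=> y; rewrite big_cons addr_ge0.
  - exists (L `|` L'); split; [exact: compactU|by rewrite subUset|].
    by move=> y /not_orP[? ?]; rewrite big_cons SL// gL'// addr0.
have S12 y : K y -> 1 / 2 < S y.
  move=> /Ks[x xs gx]; apply: (lt_le_trans gx).
  rewrite /S; elim: s sK xs {Ks SC S0 SL S} => // z s ih sK.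
  have sge y' : 0 <= \sum_(x <- s) g x y'.
    rewrite big_seq sumr_ge0// => w ws; have [|_ + _ _] := Hg w; last exact.
    by apply: sK; rewrite inE ws orbT.
  have [|_ gz _ _] := Hg z; first by apply: sK; rewrite mem_head.
  rewrite inE big_cons => /orP[/eqP ->|xs]; first by rewrite lerDl.
  by rewrite (le_trans (ih _ xs)) ?lerDr// => w ws; apply: sK; rewrite inE ws orbT.
exists (fun x => Num.min (1 : R) (2 * S x)); split.
- apply/CcP; split; last first.
    exists L => // x /SL ->; rewrite mulr0 minEle lt_geF//.
  under eq_fun do rewrite minr_absE.
  move=> x; have cS := Cc_continuous SC.
  have c2 : {for x, continuous (fun x => 2 * S x)}.
    by apply: cvgM; [exact: cvg_cst|exact: cS].
  apply: cvgM; last exact: cvg_cst.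
  apply: cvgB; first by apply: cvgD; [exact: cvg_cst|].
  by apply: cvg_norm; apply: cvgB; [exact: cvg_cst|].
- by move=> x; rewrite le_min ler01 mulr_ge0//= ge_min lexx.
- by move=> x /S12 Sx; apply/min_idPl; lra.
- by exists L; split=> // x /SL ->; rewrite mulr0 minEle lt_geF.
Qed.

End Cc_functions.

(** * Hahn-Banach theorem *)

Section HahnBanach.
Context {R : realType} {V : lmodType R}.
Variable D : set V.
Hypothesis DD : forall x y, D x -> D y -> D (x + y).
Hypothesis DZ : forall a x, D x -> D (a *: x).

(** Homogeneity is an inequality for [a > 0] only, which is what infima deliver; [sublinearZ] and
    [sublinear0] recover the rest. *)
Definition sublinear_on (q : V -> R) : Prop :=
  (forall x y, D x -> D y -> q (x + y) <= q x + q y) /\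
  (forall a x, 0 < a -> D x -> q (a *: x) <= a * q x).

Lemma sublinearZ q a x : sublinear_on q -> 0 < a -> D x -> q (a *: x) = a * q x.
Proof.
move=> [_ qZ] a0 Dx; apply/eqP; rewrite eq_le qZ//=.
have := qZ a^-1 (a *: x); rewrite invr_gt0 => /(_ a0 (DZ a Dx)).
by rewrite scalerA mulVf ?gt_eqF// scale1r ler_pdivlMl.
Qed.

Lemma sublinear0 q x : sublinear_on q -> D x -> q 0 = 0.
Proof.
move=> sq Dx; have D0 : D 0 by rewrite -(scale0r x); exact: DZ.
have := sublinearZ sq (ltr0Sn R 1) D0.
by rewrite scaler0; lra.
Qed.

Lemma sublinear_lower q x : sublinear_on q -> D x -> - q (- x) <= q x.
Proof.
move=> sq Dx; have := sq.1 x (- x) Dx; rewrite -scaleN1r => /(_ (DZ _ Dx)).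
by rewrite scaleN1r subrr (sublinear0 sq Dx); lra.
Qed.

(** The witness [k] lets one lemma serve two families: a chain of sublinear forms, where [k] is the
    smaller of the two, and the forms [F t] of [hahn_banach], where [k] is [t + s] or [a * t]. *)
Lemma inf_sublinear (I : Type) (A : set I) (F : I -> V -> R) (L : V -> R) :
  A !=set0 -> (forall i x, A i -> D x -> L x <= F i x) ->
  (forall i j x y, A i -> A j -> D x -> D y ->
     exists2 k, A k & F k (x + y) <= F i x + F j y) ->
  (forall i a x, A i -> 0 < a -> D x -> exists2 k, A k & F k (a *: x) <= a * F i x) ->
  sublinear_on (fun x => inf [set F i x | i in A]).
Proof.
move=> [i0 Ai0] FL FD FZ.
have hasinf x : D x -> has_inf [set F i x | i in A].
  move=> Dx; split; first by exists (F i0 x); exists i0.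
  by exists (L x) => _ [i Ai <-]; exact: FL.
have infle i x : A i -> D x -> inf [set F i x | i in A] <= F i x.
  by move=> Ai Dx; apply: ge_inf; [case: (hasinf x Dx)|exists i].
split=> [x y Dx Dy|a x a0 Dx].
  apply/ler_addgt0Pr => e e0.
  have [|_ [i Ai <-] hi] := @inf_adherent _ _ (e / 2) _ (hasinf x Dx); first by lra.
  have [|_ [j Aj <-] hj] := @inf_adherent _ _ (e / 2) _ (hasinf y Dy); first by lra.
  have [k Ak] := FD i j x y Ai Aj Dx Dy.
  by have := infle k _ Ak (DD Dx Dy); lra.
rewrite -ler_pdivrMl//; apply: lb_le_inf; first by case: (hasinf x Dx).
move=> _ [i Ai <-]; rewrite ler_pdivrMl//.
by have [k Ak] := FZ i a x Ai a0 Dx; exact/le_trans/infle/DZ.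
Qed.

(* A minimal sublinear minorant [q] is additive: for fixed [y], the sublinear
   form [x |-> inf_(t >= 0) (q (x + t y) - t q y)] lies below [q], hence equals
   [q], and [t = 1] gives [q x + q y <= q (x + y)]. *)
Lemma hahn_banach (p : V -> R) : D 0 -> sublinear_on p ->
  exists f : V -> R, (forall a x y, D x -> D y -> f (a *: x + y) = a * f x + f y) /\
    (forall x, D x -> f x <= p x).
Proof.
move=> D0 sp.
(* The value 0 off [D] is a normalization that makes the order on [T] antisymmetric. *)
pose good (q : V -> R) := [/\ sublinear_on q, forall x, D x -> q x <= p x &
  forall x, ~ D x -> q x = 0].
pose T := {q | good q}.
(* The order is reversed: a maximal element is a minimal minorant. *)
pose rT (q1 q2 : T) := `[< forall x, sval q2 x <= sval q1 x >].
pose cut (q : V -> R) x := if pselect (D x) then q x else 0.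
have cutE q x : D x -> cut q x = q x by rewrite /cut; case: pselect.
have cutN q x : ~ D x -> cut q x = 0 by rewrite /cut; case: pselect.
have cut_sub q : sublinear_on q -> sublinear_on (cut q).
  move=> sq; split=> [x y Dx Dy|a x a0 Dx].
    by rewrite !cutE//; [exact: sq.1|exact: DD].
  by rewrite !cutE//; [exact: sq.2|exact: DZ].
have [||q q' /asboolP qq' /asboolP q'q|A totA|[q [sq qp qN]] qmin] := @Zorn T rT.
- by move=> q; exact/asboolP.
- move=> q1 q2 q3 /asboolP q12 /asboolP q23; apply/asboolP => x.
  exact: le_trans (q23 x) (q12 x).
- case: q q' qq' q'q => [q gq] [q' gq'] /= qq' q'q.
  by apply: eq_exist; apply/funext => x; apply/eqP; rewrite eq_le qq' q'q.
- have [A0|/set0P A0] := eqVneq A set0.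
    have gp : good (cut p).
      by split; [exact: cut_sub|move=> x Dx; rewrite cutE|move=> x; exact: cutN].
    by exists (exist _ _ gp) => s; rewrite A0.
  (* This bound, common to all minorants of [p], keeps the infimum over a chain finite. *)
  have lower (i : T) x : A i -> D x -> - p (- x) <= sval i x.
    case: i => q [sq qp _] /= _ Dx; apply: le_trans (sublinear_lower sq Dx).
    by rewrite lerN2 qp// -scaleN1r; exact: DZ.
  have si : sublinear_on (fun x => inf [set sval i x | i in A]).
    apply: (inf_sublinear A0 lower).
      move=> i j x y Ai Aj Dx Dy.
      have [/asboolP ij|/asboolP ji] := totA i j Ai Aj.
        exists j => //; have [[+ _] _ _] := svalP j => /(_ x y Dx Dy).
        by have := ij x; lra.
      exists i => //; have [[+ _] _ _] := svalP i => /(_ x y Dx Dy).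
      by have := ji y; lra.
    by move=> i a x Ai a0 Dx; exists i => //; have [[_ +] _ _] := svalP i; apply.
  have infle (i : T) x : A i -> D x -> inf [set sval i x | i in A] <= sval i x.
    move=> Ai Dx; apply: ge_inf; last by exists i.
    by exists (- p (- x)) => _ [j Aj <-]; exact: lower.
  have gi : good (cut (fun x => inf [set sval i x | i in A])).
    split; [exact: cut_sub| |by move=> x; exact: cutN].
    move=> x Dx; rewrite cutE//; have [i Ai] := A0.
    by apply: (le_trans (infle i x Ai Dx)); have [_ + _] := svalP i; apply.
  exists (exist _ _ gi) => i Ai; apply/asboolP => x /=.
  have [Dx|nDx] := pselect (D x); first by rewrite cutE//; exact: infle.
  by rewrite cutN//; have [_ _ ->] := svalP i.
have qadd x y : D x -> D y -> q x + q y <= q (x + y).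
  move=> Dx Dy.
  pose F (t : R) (z : V) := q (z + t *: y) - t * q y.
  pose A := [set t : R | 0 <= t].
  have qZ t : A t -> q (t *: y) = t * q y.
    rewrite /A /= le_eqVlt => /orP[/eqP <-|t0]; last exact: sublinearZ.
    by rewrite scale0r mul0r (sublinear0 sq Dy).
  have FL t z : A t -> D z -> - q (- z) <= F t z.
    move=> At Dz; have [qD _] := sq.
    have DNz : D (- z) by rewrite -scaleN1r; exact: DZ.
    have := qD (z + t *: y) (- z) (DD Dz (DZ t Dy)) DNz.
    by rewrite [z + _ - z]addrC addKr qZ// /F; lra.
  have sF : sublinear_on (fun z => inf [set F t z | t in A]).
    apply: (inf_sublinear _ FL); first by exists 0; rewrite /A /=.
      move=> t s z w; rewrite /A /= => t0 s0 Dz Dw; exists (t + s); first exact: addr_ge0.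
      have := sq.1 (z + t *: y) (w + s *: y) (DD Dz (DZ _ Dy)) (DD Dw (DZ _ Dy)).
      by rewrite addrACA -scalerDl /F; lra.
    move=> t a z; rewrite /A /= => t0 a0 Dz; exists (a * t); first by rewrite mulr_ge0// ltW.
    rewrite /F -scalerA -scalerDr sublinearZ//; last exact/DD/DZ.
    by rewrite mulrBr mulrA.
  have Fle t z : A t -> D z -> inf [set F t z | t in A] <= F t z.
    move=> At Dz; apply: ge_inf; last by exists t.
    by exists (- q (- z)) => _ [s As <-]; exact: FL.
  have gF : good (cut (fun z => inf [set F t z | t in A])).
    split; [exact: cut_sub| |by move=> z; exact: cutN].
    move=> z Dz; rewrite cutE//; apply: (le_trans (Fle 0 z _ Dz)); first by rewrite /A /=.
    by rewrite /F scale0r mul0r addr0 subr0; exact: (qp z Dz).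
  have le_q : rT (exist _ q (And3 sq qp qN)) (exist _ _ gF).
    apply/asboolP => z /=; have [Dz|nDz] := pselect (D z); last by rewrite cutN// qN.
    rewrite cutE//; apply: (le_trans (Fle 0 z _ Dz)); first by rewrite /A /=.
    by rewrite /F scale0r mul0r addr0 subr0.
  have /(congr1 (fun s => sval s x))/= := qmin (exist _ _ gF) le_q.
  rewrite cutE// => <-.
  rewrite -lerBrDr; apply: (le_trans (Fle 1 x _ Dx)); first by rewrite /A /=.
  by rewrite /F scale1r mul1r.
have qD x y : D x -> D y -> q (x + y) = q x + q y.
  by move=> Dx Dy; apply/eqP; rewrite eq_le qadd// sq.1.
have qN' x : D x -> q (- x) = - q x.
  move=> Dx; have := qD x (- x) Dx; rewrite -scaleN1r => /(_ (DZ _ Dx)).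
  by rewrite scaleN1r subrr (sublinear0 sq Dx); lra.
exists q; split=> // a x y Dx Dy; rewrite qD//; last exact: DZ.
congr (_ + _); have [a0|a0|->] := ltgtP a 0; last 2 first.
- exact: sublinearZ.
- by rewrite scale0r mul0r (sublinear0 sq Dx).
- rewrite -[a]opprK scaleNr qN'; last exact: DZ.
  by rewrite sublinearZ ?oppr_gt0//; ring.
Qed.

End HahnBanach.

(** * Riesz representation theorem *)

Section BorelMeasures.
Context {R : realType} {G : topologicalZmodType}.
Hypothesis hG : lca_group G.
Implicit Types (f g : G -> R) (K : set G).

Lemma open_borel (U : set G) : open U -> measurable (U : set (borelType G)).
Proof. by move=> oU; exact: sub_sigma_algebra. Qed.

Lemma closed_borel (U : set G) : closed U -> measurable (U : set (borelType G)).
Proof.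
move=> cU; rewrite -(setCK U).
apply: (@measurableC _ (borelType G)); apply: open_borel; exact: closed_openC.
Qed.

Lemma compact_borel K : compact K -> measurable (K : set (borelType G)).
Proof. by move=> cK; apply: closed_borel; exact: lca_compact_closed. Qed.

Lemma continuous_borel f : continuous f ->
  measurable_fun [set: borelType G] (f : borelType G -> R).
Proof.
move=> cf; apply: (measurability _ (RGenOInfty.measurableE R)).
move=> _ [_ [x ->] <-]; rewrite setTI.
have oU : open (f @^-1` `]x, +oo[).
  by apply: (@open_comp _ _ f) => [y _|]; [exact: cf|exact: interval_open].
exact: (open_borel oU).
Qed.

Lemma Cc_integrable (m : borel_measure R G) f :
  (forall K, compact K -> (m K < +oo)%E) -> Cc f ->
  m.-integrable setT (EFin \o (f : borelType G -> R)).
Proof.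
move=> mfin cf; have [K cK fK] := Cc_supp hG cf.
have [M M0 fM] := Cc_bounded hG cf.
have mK := compact_borel cK.
have mf := continuous_borel (Cc_continuous cf).
apply/integrableP; split; first exact/measurable_EFinP.
apply: (@le_lt_trans _ _ (\int[m]_x (M%:E * (\1_K (x : borelType G))%:E))%E).
  apply: ge0_le_integral => //.
  - by apply: measurableT_comp => //; exact/measurable_EFinP.
  - by apply/measurable_EFinP/measurable_funM => //; exact: measurable_indic.
  move=> x _ /=; rewrite -EFinM lee_fin indicE.
  have [xK|/negP xK] := boolP (x \in K); first by rewrite mulr1.
  by rewrite fK ?normr0 ?mulr0// => /mem_set.
rewrite ge0_integralZl//; last by apply/measurable_EFinP; exact: measurable_indic.
by rewrite integral_indic// setIT lte_mul_pinfty// mfin.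
Qed.

End BorelMeasures.

(** * Construction of the Riesz measure of a positive form *)

Section RieszMeasure.
Context {R : realType} {G : topologicalZmodType}.
Hypothesis hG : lca_group G.
Implicit Types (f g : G -> R) (K V U : set G).

(** Linearity is asked on nonnegative functions only, because the positive part of a signed form is
    additive only there. *)
Definition positive_form (La : (G -> R) -> R) : Prop :=
  [/\ forall f g, Cc f -> Cc g -> (forall x, 0 <= f x) -> (forall x, 0 <= g x) ->
        La (fun x => f x + g x) = La f + La g,
      forall a f, 0 <= a -> Cc f -> (forall x, 0 <= f x) ->
        La (fun x => a * f x) = a * La f &
      forall f, Cc f -> (forall x, 0 <= f x) -> 0 <= La f].

Variable La : (G -> R) -> R.
Hypothesis posLa : positive_form La.

Lemma positive_form_le f g : Cc f -> Cc g -> (forall x, 0 <= f x) ->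
  (forall x, f x <= g x) -> La f <= La g.
Proof.
move=> cf cg f0 fg; have [LaD _ La0] := posLa.
rewrite (_ : g = fun x => f x + (g x - f x)); last by apply/funext => x; ring.
have gf0 x : 0 <= g x - f x by rewrite subr_ge0.
by rewrite LaD ?lerDl ?La0//; exact: CcB.
Qed.

Definition subordinate V f : Prop :=
  [/\ Cc f, forall x, 0 <= f x <= 1 &
      exists L, [/\ compact L, L `<=` V & forall x, ~ L x -> f x = 0]].

Lemma subordinate_sub U V f : U `<=` V -> subordinate U f -> subordinate V f.
Proof.
by move=> UV [cf f01 [L [cL LU Lf]]]; split=> //; exists L; split=> //; exact: subset_trans UV.
Qed.

Lemma subordinate0 V : subordinate V (fun=> 0).
Proof.
split; [exact: Cc0|by move=> x; rewrite lexx ler01|].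
by exists set0; split=> //; exact: compact0.
Qed.

Let muO V : \bar R := ereal_sup [set (La f)%:E | f in subordinate V].

Let muO_ub V f : subordinate V f -> ((La f)%:E <= muO V)%E.
Proof. by move=> Vf; apply: ereal_sup_ubound; exists f. Qed.

Let muO_ge0 V : (0 <= muO V)%E.
Proof.
have [_ _ La0] := posLa.
by apply: le_trans (muO_ub (subordinate0 V)); rewrite lee_fin La0//; exact: Cc0.
Qed.

Let muO_le U V : U `<=` V -> (muO U <= muO V)%E.
Proof. by move=> UV; apply: ge_ereal_sup => _ [f Uf <-]; exact/muO_ub/subordinate_sub/Uf. Qed.

Let La00 : La (fun=> 0) = 0.
Proof.
have [_ LaZ _] := posLa; have := LaZ 0 (fun=> 0) (lexx _) (Cc0 hG) (fun=> lexx _).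
by rewrite !mul0r.
Qed.

(** A partition of unity without division. Since [h = 1] on the part of [L] outside [V], the compact
    set [L] cut by [h <= 1/2] lies in [V]; where [h > 1/2], [min f (2 h f)] is already [f], so the
    remainder is supported in that set. *)
Lemma subordinate_split U V f : open U -> open V -> subordinate (U `|` V) f ->
  exists f1 f2, [/\ subordinate U f1, subordinate V f2 & f = fun x => f1 x + f2 x].
Proof.
move=> oU oV [cf f01 [L [cL LUV Lf]]].
have f0 x : 0 <= f x by case/andP: (f01 x).
have cLV : compact (L `&` ~` V).
  by apply: compact_closedI => //; exact: open_closedC.
have [|h [ch h01 h1 [M [cM MU Mh]]]] := @Cc_bump R G hG _ U cLV oU.
  by move=> x [/LUV[|//]].
have h0 x : 0 <= h x by case/andP: (h01 x).
pose f1 x := Num.min (f x) (2 * (h x * f x)).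
have f1f x : 0 <= f1 x <= f x.
  by rewrite /f1 ge_min lexx le_min f0/= mulr_ge0//= mulr_ge0.
have cf1 : Cc f1 by apply: Cc_min => //; apply/CcZ/CcMl => //; exact: Cc_continuous.
exists f1, (fun x => f x - f1 x); split; last by apply/funext => x; ring.
  split=> //.
    by move=> x; have /andP[-> /le_trans->//] := f1f x; case/andP: (f01 x).
  by exists M; split=> // x /Mh hx; rewrite /f1 hx mul0r mulr0 minElt ltNge f0.
split; first exact: CcB.
  by move=> x; have := f1f x; have := f01 x; lra.
exists (L `&` [set x | h x <= 1 / 2]); split.
- apply: compact_closedI => //.
  apply: (@closed_comp _ _ h (fun r => r <= 1 / 2)); last exact: closed_le.
  by move=> y _; exact: Cc_continuous.
- move=> x [Lx /= hx]; apply: contrapT => Vx.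
  by have := h1 x (conj Lx Vx); lra.
- move=> x /not_andP[/Lf fx|/negP]; rewrite /f1; first by rewrite fx !mulr0 minxx subrr.
  rewrite -ltNge => hx; suff /min_idPl -> : f x <= 2 * (h x * f x) by rewrite subrr.
  by have := f0 x; nra.
Qed.

Let muO_U2 U V : open U -> open V -> (muO (U `|` V) <= muO U + muO V)%E.
Proof.
move=> oU oV; apply: ge_ereal_sup => _ [f UVf <-].
have [f1 [f2 [Uf Vf ->]]] := subordinate_split oU oV UVf.
have [LaD _ _] := posLa.
have [cf1 f1p _] := Uf; have [cf2 f2p _] := Vf.
rewrite LaD//; last 2 first.
- by move=> x; case/andP: (f1p x).
- by move=> x; case/andP: (f2p x).
by rewrite EFinD leeD// muO_ub.
Qed.

Let muO_bigU (V : nat -> set G) : (forall i, open (V i)) ->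
  (muO (\bigcup_i V i) <= \sum_(i <oo) muO (V i))%E.
Proof.
move=> oV; apply: ge_ereal_sup => _ [f [cf f01 [L [cL LV Lf]]] <-].
have /choice[i Hi] (x : G) : exists i, L x -> V i x.
  have [/LV[i _ Vix]|?] := pselect (L x); first by exists i.
  by exists 0%N.
have [|s [sL Ls]] := @compact_seq_cover G L (fun x => V (i x)) cL.
  by move=> x Lx; split; [exact: oV|exact: Hi].
pose n := (\max_(x <- s) i x).+1.
have oB m : open (\big[setU/set0]_(i < m) V i).
  elim: m => [|m ih]; first by rewrite big_ord0; exact: open0.
  by rewrite big_ord_recr; exact: openU.
apply: (@le_trans _ _ (muO (\big[setU/set0]_(i < n) V i))).
  apply: muO_ub; split=> //; exists L; split=> // y /Ls[x xs Vy].
  rewrite -bigcup_mkord; exists (i x) => //=.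
  by rewrite /n ltnS; exact: leq_bigmax_seq.
apply: (@le_trans _ _ (\sum_(i < n) muO (V i))).
  elim: n => [|n ih]; last first.
    by rewrite !big_ord_recr/=; apply: (le_trans (muO_U2 (oB n) (oV n))); rewrite leeD.
  rewrite !big_ord0; apply: ge_ereal_sup => _ [g [cg g01 [M [_ M0 Mg]]] <-].
  by rewrite (_ : g = fun=> 0) ?La00//; apply/funext => x; rewrite Mg// => /M0.
by rewrite -(big_mkord xpredT (fun i => muO (V i))); apply: nneseries_lim_ge => ? _.
Qed.

Definition riesz_outer (A : set (pt G)) : \bar R :=
  ereal_inf [set muO V | V in [set V | open V /\ A `<=` V]].

Let outer_le A V : open V -> A `<=` V -> (riesz_outer A <= muO V)%E.
Proof. by move=> oV AV; apply: ereal_inf_lbound; exists V. Qed.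

Let outer_open V : open V -> riesz_outer V = muO V.
Proof.
move=> oV; apply/eqP; rewrite eq_le outer_le//=.
by apply: le_ereal_inf_tmp => _ [U [oU VU] <-]; exact: muO_le.
Qed.

Let outer_ge0 A : (0 <= riesz_outer A)%E.
Proof. by apply: le_ereal_inf_tmp => _ [U _ <-]. Qed.

Let outer0 : riesz_outer set0 = 0%E.
Proof.
apply/eqP; rewrite eq_le outer_ge0 andbT (outer_open open0).
apply: ge_ereal_sup => _ [g [cg g01 [M [_ M0 Mg]]] <-].
by rewrite (_ : g = fun=> 0) ?La00//; apply/funext => x; rewrite Mg// => /M0.
Qed.

Let outer_homo : {homo riesz_outer : A B / A `<=` B >-> (A <= B)%E}.
Proof.
move=> A B AB; apply: le_ereal_inf => _ [V [oV BV] <-]; exists V => //.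
by split=> //; exact: subset_trans BV.
Qed.

Let outer_sigma : sigma_subadditive riesz_outer.
Proof.
move=> A; have [[i ioo]|/forallNP Aoo] := pselect (exists i, riesz_outer (A i) = +oo%E).
  rewrite (eseries_pinfty _ _ ioo) ?leey// => n _.
  by rewrite -ltNye (lt_le_trans _ (outer_ge0 _)).
apply/lee_addgt0Pr => e e0.
apply: le_trans (epsilon_trick _ _ (ltW e0)) => //.
have Afin n : riesz_outer (A n) \is a fin_num.
  by rewrite ge0_fin_numE// ltey; apply/eqP/Aoo.
have /choice[V HV] n : exists V : set G, [/\ open V, A n `<=` V &
    (muO V <= riesz_outer (A n) + (e / (2 ^ n.+1)%:R)%:E)%E].
  have en : 0 < e / (2 ^ n.+1)%:R by rewrite divr_gt0// ltr0n expn_gt0.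
  by have [_ [V [oV AV] <-] /ltW HV] := lb_ereal_inf_adherent en (Afin n); exists V.
have oV n : open (V n) by case: (HV n).
apply: (@le_trans _ _ (muO (\bigcup_n V n))).
  apply: outer_le; first exact: bigcup_open.
  by move=> x [n _ Anx]; exists n => //; have [_ + _] := HV n; apply.
apply: (le_trans (muO_bigU oV)).
by apply: lee_nneseries => // n _; case: (HV n).
Qed.

Let om : {outer_measure set (pt G) -> \bar R} :=
  HB.pack riesz_outer
    (isOuterMeasure.Build R (pt G) riesz_outer outer0 outer_ge0 outer_homo outer_sigma).

(** If [f] is subordinate to the intersection of [U] and [V] with support in [L], and [g] to [U]
    minus [L], then [f + g] is subordinate to [U]. Taking suprema, first over [g] and then over [f],
    gives the superadditivity that Caratheodory's condition needs. *)
Let open_cara V : open V -> caratheodory_measurable om V.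
Proof.
move=> oV; apply: le_caratheodory_measurable => X.
apply: le_ereal_inf_tmp => _ [U [oU XU] <-].
have [->|Ufin] := eqVneq (muO U) +oo%E; first by rewrite leey.
have {}Ufin : muO U \is a fin_num by rewrite ge0_fin_numE// ltey.
have le_fin A : A `<=` U -> riesz_outer A \is a fin_num.
  move=> AU; rewrite ge0_fin_numE//; apply: (le_lt_trans (outer_le oU AU)).
  by rewrite ltey_eq Ufin.
have XVfin : riesz_outer (X `&` ~` V) \is a fin_num.
  by apply: le_fin => x [/XU].
rewrite -leeBrDr//; apply: (@le_trans _ _ (muO (U `&` V))).
  by apply: outer_le; [exact: openI|exact: setSI].
apply: ge_ereal_sup => _ [f [cf f01 [L [cL LUV Lf]]] <-].
rewrite leeBrDr// addeC -leeBrDr//.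
have oUL : open (U `&` ~` L).
  by apply: openI => //; apply: closed_openC; exact: lca_compact_closed.
apply: (@le_trans _ _ (muO (U `&` ~` L))).
  by apply: outer_le => // x [/XU Ux Vx]; split=> // /LUV[].
apply: ge_ereal_sup => _ [g [cg g01 [M [cM MUL Mg]]] <-].
have [LaD _ _] := posLa.
rewrite leeBrDr// -EFinD addrC -LaD//; last 2 first.
- by move=> x; case/andP: (f01 x).
- by move=> x; case/andP: (g01 x).
apply: muO_ub; split; first exact: CcD.
  move=> x; have [Lx|/Lf ->] := pselect (L x); last by rewrite add0r.
  by rewrite Mg ?addr0// => /MUL[].
exists (L `|` M); split; first exact: compactU.
  by rewrite subUset; split=> x; [move=> /LUV[]|move=> /MUL[]].
by move=> x /not_orP[? ?]; rewrite Lf// Mg// addr0.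
Qed.

Let borel_cara (A : set (borelType G)) : measurable A -> caratheodory_measurable om A.
Proof.
apply: smallest_sub => [|V oV]; last exact: open_cara.
exact: (@sigma_algebra_measurable _ (caratheodory_type om)).
Qed.

Let riesz_sigma_additive :
  semi_sigma_additive (riesz_outer : set (borelType G) -> \bar R).
Proof.
move=> F mF tF mUF; apply: (caratheodory_measure_sigma_additive (mu := om)) => //.
  by move=> i; exact: borel_cara.
exact: borel_cara.
Qed.

Definition riesz_measure : borel_measure R G :=
  HB.pack (riesz_outer : set (borelType G) -> \bar R)
    (isMeasure.Build _ (borelType G) R (riesz_outer : set (borelType G) -> \bar R)
       outer0 outer_ge0 riesz_sigma_additive).

Lemma riesz_measure_open V : open V ->
  riesz_measure V = ereal_sup [set (La f)%:E | f in subordinate V].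
Proof. exact: outer_open. Qed.

Lemma riesz_measure_le_form K g : compact K -> Cc g -> (forall x, 0 <= g x) ->
  (forall x, K x -> 1 <= g x) -> (riesz_measure K <= (La g)%:E)%E.
Proof.
move=> cK cg g0 gK; have [_ LaZ _] := posLa.
apply/lee_addgt0Pr => e e0.
have La_ge0 : 0 <= La g by have [_ _] := posLa; apply.
(* Every level [b] in (0, 1) with [a <= b] gives [La g / b <= La g + e]; the maximum with 1/2 keeps
   [b] positive when [La g = 0]. *)
pose a := (La g) / (La g + e).
have D0 : 0 < La g + e by lra.
have a1 : a < 1 by rewrite /a ltr_pdivrMr// mul1r; lra.
pose b := Num.max a (1 / 2).
have b1 : 0 < b < 1 by rewrite /b lt_max gt_max a1; lra.
have ob : open [set x | b < g x].
  apply: (@open_comp _ _ g (fun r => b < r)); last exact: open_gt.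
  by move=> y _; exact: Cc_continuous.
apply: (@le_trans _ _ (riesz_measure [set x | b < g x])).
  by apply: outer_homo => x /gK /=; lra.
rewrite riesz_measure_open//; apply: ge_ereal_sup => _ [f [cf f01 [L [cL LU Lf]]] <-].
rewrite -EFinD lee_fin.
have bg0 x : 0 <= b^-1 * g x by rewrite mulr_ge0// invr_ge0; lra.
apply: (@le_trans _ _ (La (fun x => b^-1 * g x))).
  apply: positive_form_le => //; [exact: CcZ|by move=> x; case/andP: (f01 x)|].
  move=> x; have [/LU/= gx|/Lf ->//] := pselect (L x).
  case/andP: (f01 x) => _ /le_trans; apply.
  by rewrite ler_pdivlMl; lra.
rewrite LaZ// ?invr_ge0; last by lra.
rewrite ler_pdivrMl; last by lra.
have : a <= b by rewrite /b le_max lexx.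
by rewrite /a ler_pdivrMr//; lra.
Qed.

Lemma form_le_riesz_measure K g : compact K -> Cc g -> (forall x, 0 <= g x <= 1) ->
  (forall x, ~ K x -> g x = 0) -> ((La g)%:E <= riesz_measure K)%E.
Proof.
move=> cK cg g01 gK; apply: le_ereal_inf_tmp => _ [V [oV KV] <-].
by apply: muO_ub; split=> //; exists K.
Qed.

Lemma riesz_measure_radon : radon riesz_measure.
Proof.
split.
- move=> K cK.
  have [f [cf f01 fK _]] := @Cc_bump R G hG K setT cK openT (@subsetT _ K).
  apply: le_lt_trans (ltry (La f)); apply: riesz_measure_le_form => //.
    by move=> x; case/andP: (f01 x).
  by move=> x /fK ->.
- move=> A mA; congr ereal_inf; apply/seteqP; split=> _ [V [oV AV] <-];
  exists V => //; [exact: outer_open|exact/esym/outer_open].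
- move=> U oU; apply/eqP; rewrite eq_le; apply/andP; split; last first.
    apply: ge_ereal_sup => _ [K [cK KU] <-]; exact: outer_homo.
  rewrite riesz_measure_open//.
  apply: ge_ereal_sup => _ [f [cf f01 [L [cL LU Lf]]] <-].
  apply: (le_trans (form_le_riesz_measure cL cf f01 Lf)).
  by apply: ereal_sup_ubound; exists L.
Qed.

End RieszMeasure.

(** * Positive forms are determined by a measure on compact sets *)

Section RieszRepresentation.
Context {R : realType} {G : topologicalZmodType}.
Hypothesis hG : lca_group G.
Implicit Types (f g : G -> R) (K V U : set G) (m : borel_measure R G).

Section Cc_integral.
Variable m : borel_measure R G.
Hypothesis rm : radon m.

Lemma radon_Cc_integrable f : Cc f ->
  m.-integrable setT (EFin \o (f : borelType G -> R)).
Proof. by apply: Cc_integrable => //; case: rm. Qed.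

Lemma Cc_RintegralD f g : Cc f -> Cc g ->
  \int[m]_x (f x + g x) = \int[m]_x f x + \int[m]_x g x.
Proof. by move=> cf cg; rewrite RintegralD//; exact: radon_Cc_integrable. Qed.

Lemma Cc_RintegralZ a f : Cc f -> \int[m]_x (a * f x) = a * \int[m]_x f x.
Proof. by move=> cf; rewrite RintegralZl//; exact: radon_Cc_integrable. Qed.

Lemma Cc_le_Rintegral f g : Cc f -> Cc g -> (forall x, f x <= g x) ->
  \int[m]_x f x <= \int[m]_x g x.
Proof. by move=> cf cg fg; apply: le_Rintegral => //; exact: radon_Cc_integrable. Qed.

Lemma EFin_Cc_Rintegral f : Cc f -> ((\int[m]_x f x)%:E = \int[m]_x (f x)%:E)%E.
Proof.
move=> cf; rewrite /Rintegral fineK//.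
by apply: integrable_fin_num => //; exact: radon_Cc_integrable.
Qed.

Lemma positive_form_Rintegral : positive_form (fun f => \int[m]_x f x).
Proof.
split=> [f g cf cg _ _|a f _ cf _|f cf f0].
- exact: Cc_RintegralD.
- exact: Cc_RintegralZ.
- by apply: Rintegral_ge0.
Qed.

Lemma Rintegral_ge_compact K g : compact K -> Cc g -> (forall x, 0 <= g x) ->
  (forall x, K x -> 1 <= g x) -> (m K <= (\int[m]_x g x)%:E)%E.
Proof.
move=> cK cg g0 gK; rewrite EFin_Cc_Rintegral//.
have mK := compact_borel hG cK.
rewrite -[X in m X](setIT (K : set (borelType G))) -integral_indic//.
apply: ge0_le_integral => //.
- by apply/measurable_EFinP; exact: measurable_indic.
- by apply/measurable_EFinP; exact: continuous_borel (Cc_continuous cg).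
move=> x _; rewrite lee_fin indicE.
by have [/set_mem/gK//|_] := boolP (x \in K); exact: g0.
Qed.

Lemma Rintegral_le_compact K g : compact K -> Cc g -> (forall x, 0 <= g x <= 1) ->
  (forall x, ~ K x -> g x = 0) -> ((\int[m]_x g x)%:E <= m K)%E.
Proof.
move=> cK cg g01 gK; rewrite EFin_Cc_Rintegral//.
have mK := compact_borel hG cK.
rewrite -[X in m X](setIT (K : set (borelType G))) -integral_indic//.
apply: ge0_le_integral => //.
- by move=> x _; rewrite lee_fin; case/andP: (g01 x).
- by apply/measurable_EFinP; exact: continuous_borel (Cc_continuous cg).
- by apply/measurable_EFinP; exact: measurable_indic.
move=> x _; rewrite lee_fin indicE.
have [_|/negP xK] := boolP (x \in K); first by case/andP: (g01 x).
by rewrite gK// => /mem_set.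
Qed.

End Cc_integral.

(** Two positive forms squeezed by the same Radon measure agree on nonnegative functions. This
    serves for the Riesz theorem and again for the translation invariance of the Haar integral. *)
Definition compact_squeeze m (La : (G -> R) -> R) : Prop :=
  (forall K g, compact K -> Cc g -> (forall x, 0 <= g x) ->
    (forall x, K x -> 1 <= g x) -> (m K <= (La g)%:E)%E) /\
  (forall K g, compact K -> Cc g -> (forall x, 0 <= g x <= 1) ->
    (forall x, ~ K x -> g x = 0) -> ((La g)%:E <= m K)%E).

(* Cutting [f] into the slices [f_k] of height [e] between the levels [k e]
   and [(k + 1) e], both forms send [f_k] between [e m(f >= (k + 1) e)] and
   [e m(f >= k e)]; the error telescopes. *)
Lemma compact_squeeze_le m (La Lb : (G -> R) -> R) : radon m ->
  positive_form La -> positive_form Lb ->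
  compact_squeeze m La -> compact_squeeze m Lb ->
  forall f, Cc f -> (forall x, 0 <= f x) -> La f <= Lb f.
Proof.
move=> [mfin _ _] pLa pLb [_ La2] [Lb1 _] f cf f0.
have [K cK fK] := Cc_supp hG cf.
have [M M0 fM] := Cc_bounded hG cf.
apply/ler_addgt0Pr => e' e'0.
(* The telescoped error is at most [e * m K], hence at most [e']; the [+ 1] covers [m K = 0]. *)
pose e := e' / (fine (m K) + 1).
have mK0 : 0 <= fine (m K) by rewrite fine_ge0.
have e0 : 0 < e by rewrite divr_gt0//; lra.
have emK : e * fine (m K) <= e'.
  rewrite /e mulrAC ler_pdivrMr; last by lra.
  by nra.
pose Kk k := K `&` [set x | k%:R * e <= f x].
have cKk k : compact (Kk k).
  apply: compact_closedI => //.
  apply: (@closed_comp _ _ f (fun r => k%:R * e <= r)); last exact: closed_ge.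
  by move=> y _; exact: Cc_continuous.
have mKk k : (m (Kk k) = (fine (m (Kk k)))%:E)%E.
  by rewrite fineK// ge0_fin_numE ?measure_ge0//; exact: mfin.
pose s k x := Num.min (f x) (k%:R * e).
have ke0 k : 0 <= k%:R * e by rewrite mulr_ge0// ltW.
have cs k : Cc (s k).
  apply/CcP => //; split; last first.
    by exists K => // x /fK; rewrite /s => ->; rewrite minEle ke0.
  rewrite /s; under eq_fun do rewrite minr_absE.
  move=> x; have cfx := Cc_continuous cf.
  apply: cvgM; last exact: cvg_cst.
  apply: cvgB; first by apply: cvgD; [exact: cfx|exact: cvg_cst].
  by apply: cvg_norm; apply: cvgB; [exact: cfx|exact: cvg_cst].
have s0 k x : 0 <= s k x by rewrite /s le_min f0 ke0.
pose d k x := e^-1 * (s k.+1 x - s k x).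
have sE k x : s k.+1 x = s k x + e * d k x.
  by rewrite /d mulrA mulfV ?gt_eqF// mul1r addrC subrK.
have cd k : Cc (d k) by apply: CcZ => //; exact: CcB.
have eS k : k.+1%:R * e = k%:R * e + e by rewrite -natr1; ring.
have d01 k x : 0 <= d k x <= 1.
  rewrite /d mulr_ge0 ?invr_ge0 ?(ltW e0)//=.
    rewrite ler_pdivrMl// /s !eS.
    by rewrite !minEle; do 2 case: ifP => ?; have := ke0 k; lra.
  by rewrite subr_ge0 /s eS !minEle; do 2 case: ifP => ?; have := ke0 k; lra.
have dN k x : ~ Kk k x -> d k x = 0.
  move=> nK; rewrite /d (_ : s k.+1 x = s k x) ?subrr ?mulr0//.
  rewrite /s; have [Kx|/fK ->] := pselect (K x); last first.
    by rewrite !minEle !ke0.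
  have : ~ (k%:R * e <= f x) by move=> h; apply: nK; split.
  by move=> /negP; rewrite -ltNge eS => h; rewrite !minEle; do 2 case: ifP => ?; lra.
have d1 k x : Kk k.+1 x -> 1 <= d k x.
  move=> [Kx] /=; rewrite eS => h.
  rewrite /d ler_pdivlMl// mulr1 /s eS !minEle; do 2 case: ifP => ?; lra.
have dge0 k x : 0 <= d k x by case/andP: (d01 k x).
have LaE (L : (G -> R) -> R) k : positive_form L -> L (s k.+1) = L (s k) + e * L (d k).
  move=> [LD LZ _]; rewrite -LZ ?ltW// -LD//.
  - by congr L; apply/funext => x; exact: sE.
  - exact: CcZ.
  - by move=> x; rewrite mulr_ge0// ltW.
have main k : La (s k) <= Lb (s k) + e * (fine (m (Kk 0%N)) - fine (m (Kk k))).
  elim: k => [|k ih].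
    have s00 : s 0%N = fun=> 0.
      by apply/funext => x; rewrite /s mul0r minElt ltNge f0.
    have L0 (L : (G -> R) -> R) : positive_form L -> L (fun=> 0) = 0.
      move=> [_ LZ _]; have := LZ 0 (fun=> 0) (lexx _) (Cc0 hG) (fun=> lexx _).
      by rewrite !mul0r.
    by rewrite s00 !L0// subrr mulr0 addr0.
  rewrite !LaE//.
  have := La2 _ _ (cKk k) (cd k) (d01 k) (dN k).
  have := Lb1 _ _ (cKk k.+1) (cd k) (dge0 k) (d1 k).
  rewrite (mKk k) (mKk k.+1) !lee_fin => h1 h2.
  by nra.
have [n Mn] : exists n : nat, M <= n%:R * e.
  exists (Num.bound (M / e)); rewrite -ler_pdivrMr//.
  by apply/ltW/archi_boundP; rewrite divr_ge0// ltW.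
have fE : f = s n.
  apply/funext => x; rewrite /s; apply/esym/min_idPl.
  by rewrite (le_trans _ Mn)// (le_trans (ler_norm _)).
rewrite {1 2}fE; apply: (le_trans (main n)); rewrite lerD2l.
apply: le_trans emK; rewrite ler_wpM2l ?(ltW e0)// lerBlDr.
apply: (@le_trans _ _ (fine (m K))); last by rewrite lerDl fine_ge0.
rewrite fine_le//.
- by rewrite ge0_fin_numE ?measure_ge0//; exact: mfin.
- by rewrite ge0_fin_numE ?measure_ge0//; exact: mfin.
apply: le_measure; rewrite ?inE; [exact: compact_borel|exact: compact_borel|].
by move=> x [].
Qed.

Theorem riesz_representation (La : (G -> R) -> R) : positive_form La ->
  exists2 m : borel_measure R G, radon m &
    forall f, Cc f -> (forall x, 0 <= f x) -> La f = \int[m]_x f x.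
Proof.
move=> pLa; pose m := riesz_measure hG pLa.
have rm : radon m := riesz_measure_radon hG pLa.
exists m => // f cf f0.
have h1 : compact_squeeze m La.
  by split=> K g; [exact: riesz_measure_le_form|exact: form_le_riesz_measure].
have h2 : compact_squeeze m (fun f => \int[m]_x f x).
  by split=> K g; [exact: Rintegral_ge_compact|exact: Rintegral_le_compact].
have pI := positive_form_Rintegral rm.
by apply/eqP; rewrite eq_le !(compact_squeeze_le (m := m)).
Qed.

End RieszRepresentation.

(** * Haar integral and correlations *)

Section Correlation.
Context {R : realType} {G : topologicalZmodType}.
Hypothesis hG : lca_group G.
Implicit Types (f g u w : G -> R) (K V U : set G).

Lemma Cc_pos_neg f : Cc f -> exists f1 f2,
  [/\ Cc f1, Cc f2, forall x, 0 <= f1 x, forall x, 0 <= f2 x & f = fun x => f1 x - f2 x].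
Proof.
move=> cf; exists (fun x => Num.max (f x) 0), (fun x => Num.max (- f x) 0); split.
- by apply: Cc_max => //; exact: Cc0.
- by apply: Cc_max => //; [exact: CcN|exact: Cc0].
- by move=> x; rewrite le_max lexx orbT.
- by move=> x; rewrite le_max lexx orbT.
- by apply/funext => x; rewrite !maxEle; do 2 case: ifP => ?; lra.
Qed.

(** Translates of the set where [E > E 0 / 2] cover the support of [g]. Through this a single bump
    controls all of [C_c]: it gives the positivity of the Haar integral, the local estimate for
    smears and the finiteness of [S]. *)
Lemma Cc_dominated (E g : G -> R) : Cc E -> (forall x, 0 <= E x) -> 0 < E 0 -> Cc g ->
  exists C : R, 0 <= C /\ exists s : seq G,
    forall x, `|g x| <= C * \sum_(a <- s) E (x - a).
Proof.
move=> cE E0 Epos cg.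
have [K cK gK] := Cc_supp hG cg.
have [M M0 gM] := Cc_bounded hG cg.
have [|s [_ Ks]] := @compact_seq_cover G K (fun a => [set x | E 0 / 2 < E (x - a)]) cK.
  move=> a _; split; last by rewrite /= subrr; lra.
  apply: (@open_shift G [set y | E 0 / 2 < E y]).
  apply: (@open_comp _ _ E (fun r => E 0 / 2 < r)); last exact: open_gt.
  by move=> y _; exact: Cc_continuous.
exists (2 * M / E 0); split; first by rewrite divr_ge0 ?mulr_ge0// ltW.
exists s => x.
have S0 (t : seq G) : 0 <= \sum_(a <- t) E (x - a) by apply: sumr_ge0.
have [Kx|/gK ->] := pselect (K x); last first.
  by rewrite normr0 mulr_ge0// divr_ge0 ?mulr_ge0// ltW.
have [a as_ Ea] := Ks x Kx.
apply: (le_trans (gM x)); rewrite mulrAC ler_pdivlMr// -mulrA mulrCA ler_wpM2l//.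
have : E (x - a) <= \sum_(a <- s) E (x - a).
  by rewrite (big_rem a)//= lerDl S0.
by move: Ea => /=; lra.
Qed.

Variable lambda : borel_measure R G.
Hypothesis hl : is_haar lambda.

Let rl : radon lambda. Proof. by case: hl. Qed.

(** The integral and its translate are both squeezed by [lambda], whose invariance is needed on
    compact sets only. *)
Lemma haar_shift f a : Cc f -> \int[lambda]_x f (x - a) = \int[lambda]_x f x.
Proof.
have [_ linv _] := hl.
pose L1 g := \int[lambda]_x g x; pose L2 g := \int[lambda]_x g (x - a).
have p1 : positive_form L1 := positive_form_Rintegral hG rl.
have p2 : positive_form L2.
  have [LD LZ L0] := p1; split=> [u w cu cw u0 w0|b u b0 cu u0|u cu u0].
  - by apply: (LD (fun x => u (x - a)) (fun x => w (x - a))) => //; exact: Cc_shift.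
  - by apply: (LZ b (fun x => u (x - a))) => //; exact: Cc_shift.
  - by apply: (L0 (fun x => u (x - a))) => //; exact: Cc_shift.
have s1 : compact_squeeze lambda L1.
  by split=> K g; [exact: Rintegral_ge_compact|exact: Rintegral_le_compact].
have lK K : compact K -> lambda K = lambda [set x | K (x - a)].
  move=> cK; rewrite -(linv a K); last exact: compact_borel.
  congr (lambda _); apply/seteqP; split=> x /=.
    by move=> [y Ky <-]; rewrite [a + y]addrC addrK.
  by move=> Kx; exists (x - a) => //; rewrite addrC subrK.
have s2 : compact_squeeze lambda L2.
  split=> K g cK cg g1 g2; rewrite (lK K cK).
    apply: (Rintegral_ge_compact hG rl (g := fun x => g (x - a))) => //.
    - exact: compact_shift.
    - exact: Cc_shift.
    - by move=> x; exact: g2.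
  apply: (Rintegral_le_compact hG rl (g := fun x => g (x - a))) => //.
  - exact: compact_shift.
  - exact: Cc_shift.
  - by move=> x; exact: g2.
have eqp g : Cc g -> (forall x, 0 <= g x) -> L1 g = L2 g.
  by move=> cg g0; apply/eqP; rewrite eq_le !(compact_squeeze_le hG rl).
move=> /Cc_pos_neg[f1 [f2 [c1 c2 f10 f20 ->]]].
rewrite !RintegralB//; try by apply: radon_Cc_integrable => //; exact: Cc_shift.
by congr (_ - _); apply/esym/eqp.
Qed.

(** If the integral vanished, so would that of every finite sum of translates of [f]. These dominate
    bumps, so [lambda] would vanish on compact sets and, by inner regularity, everywhere. *)
Lemma haar_pos f : Cc f -> (forall x, 0 <= f x) -> 0 < f 0 -> 0 < \int[lambda]_x f x.
Proof.
move=> cf f0 fpos; rewrite lt_neqAle Rintegral_ge0// andbT; apply/eqP => I0.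
have [_ _ /eqP] := hl; apply.
have [_ _ ->] := rl; last exact: openT.
apply/eqP; rewrite eq_le; apply/andP; split; last first.
  by apply: ereal_sup_ubound; exists set0; [split=> //; exact: compact0|exact: measure0].
apply: ge_ereal_sup => _ [K [cK _] <-].
have [g [cg g01 g1 _]] := @Cc_bump R G hG K setT cK openT (@subsetT _ K).
apply: (le_trans (Rintegral_ge_compact hG rl cK cg _ _)).
- by move=> x; case/andP: (g01 x).
- by move=> x /g1 ->.
have [C [C0 [s gs]]] := Cc_dominated cf f0 fpos cg.
have cS (t : seq G) : Cc (fun x => \sum_(a <- t) f (x - a)).
  by apply: Cc_sum => // a; exact: Cc_shift.
rewrite lee_fin; apply: (@le_trans _ _ (\int[lambda]_x (C * \sum_(a <- s) f (x - a)))).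
  apply: Cc_le_Rintegral => //; first exact: CcZ.
  by move=> x; exact: le_trans (ler_norm _) (gs x).
rewrite Cc_RintegralZ// (_ : \int[lambda]_x _ = 0) ?mulr0//.
elim: s {gs} => [|a s ih].
  under eq_Rintegral do rewrite big_nil.
  by have := Cc_RintegralZ hG rl 0 cf; under eq_Rintegral do rewrite mul0r; rewrite mul0r.
under eq_Rintegral do rewrite big_cons.
by rewrite Cc_RintegralD// ?ih ?haar_shift -?I0 ?addr0//; exact: Cc_shift.
Qed.

(** The convolution of [u] with the reflection of [w]; for [w = u] it is the real case of the
    convolution of [u] with [tilde u]. *)
Definition correlation u w (z : G) : R := \int[lambda]_y (u y * w (y - z)).

Let Cc_corr_int u w z : Cc u -> Cc w -> Cc (fun y => u y * w (y - z)).
Proof.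
move=> cu cw; apply: CcMl; [exact: hG|exact: Cc_continuous|exact: Cc_shift].
Qed.

Lemma corr_supp u w K L : (forall x, ~ K x -> u x = 0) -> (forall x, ~ L x -> w x = 0) ->
  forall z, ~ [set a - b | a in K & b in L] z -> correlation u w z = 0.
Proof.
move=> uK wL z nz; rewrite /correlation.
under eq_Rintegral.
  move=> y _; rewrite (_ : _ * _ = 0); last first.
    have [Ky|/uK ->] := pselect (K y); last by rewrite mul0r.
    have [Ly|/wL ->] := pselect (L (y - z)); last by rewrite mulr0.
    by exfalso; apply: nz; exists y => //; exists (y - z) => //; rewrite opprB addrC subrK.
  over.
by have := Cc_RintegralZ hG rl 0 (Cc0 hG); under eq_Rintegral do rewrite mul0r; rewrite mul0r.
Qed.

Lemma Cc_corr u w : Cc u -> Cc w -> Cc (correlation u w).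
Proof.
move=> cu cw; have [K cK uK] := Cc_supp hG cu; have [L cL wL] := Cc_supp hG cw.
apply/CcP => //; split; last first.
  exists [set a - b | a in K & b in L]; last exact: corr_supp.
  have -> : [set a - b | a in K & b in L] = [set a + b | a in K & b in [set - b | b in L]].
    apply/seteqP; split=> x.
      by move=> [a Ka [b Lb <-]]; exists a => //; exists (- b) => //; exists b.
    by move=> [a Ka [_ [b Lb <-]] <-]; exists a => //; exists b.
  by apply: compact_add => //; exact: compact_opp.
move=> z; apply/cvgrPdist_le => e e0.
pose I := \int[lambda]_x `|u x|.
have I0 : 0 <= I by apply: Rintegral_ge0.
have D0 : 0 < e / (I + 1) by rewrite divr_gt0//; lra.
have [V [oV V0] Vw] := Cc_unif_continuous hG cw D0.
have zV : nbhs z [set z' | V (z' - z)].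
  by apply: open_nbhs_nbhs; split; [exact: open_shift|rewrite /= subrr].
near=> z'.
have Vz : V (z' - z) by near: z'.
rewrite /correlation -RintegralB//; [|exact/radon_Cc_integrable/Cc_corr_int..].
have ci : Cc (fun y => u y * w (y - z) - u y * w (y - z')).
  by apply: CcB => //; exact: Cc_corr_int.
apply: le_trans (le_normr_Rintegral _ (radon_Cc_integrable hG rl ci)) _ => //.
apply: (@le_trans _ _ (\int[lambda]_y ((e / (I + 1)) * `|u y|))).
  apply: Cc_le_Rintegral => //; [exact: Cc_norm|exact/CcZ/Cc_norm|].
  move=> y; rewrite -mulrBr normrM mulrC ler_wpM2r//; apply: Vw.
  by rewrite opprB [y - z + _]addrC subrKA.
rewrite Cc_RintegralZ//; last exact: Cc_norm.
rewrite -/I mulrAC ler_pdivrMr; last by lra.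
by rewrite ler_pM2l//; lra.
Unshelve. all: by end_near. Qed.

Lemma corrDl u1 u2 w z : Cc u1 -> Cc u2 -> Cc w ->
  correlation (fun x => u1 x + u2 x) w z = correlation u1 w z + correlation u2 w z.
Proof.
move=> c1 c2 cw; rewrite /correlation -Cc_RintegralD//; [|exact: Cc_corr_int..].
by apply: eq_Rintegral => y _; rewrite mulrDl.
Qed.

Lemma corrZl a u w z : Cc u -> Cc w -> correlation (fun x => a * u x) w z = a * correlation u w z.
Proof.
move=> cu cw; rewrite /correlation -Cc_RintegralZ//; last exact: Cc_corr_int.
by apply: eq_Rintegral => y _; rewrite mulrA.
Qed.

Lemma corr_opp u w z : Cc u -> Cc w -> correlation u w (- z) = correlation w u z.
Proof.
move=> cu cw; rewrite /correlation -(@haar_shift _ z); last exact: Cc_corr_int.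
by apply: eq_Rintegral => y _; rewrite opprK subrK mulrC.
Qed.

Lemma corr_shift u w a b z : Cc u -> Cc w ->
  correlation (fun x => u (x - a)) (fun x => w (x - b)) z = correlation u w (z - a + b).
Proof.
move=> cu cw; rewrite /correlation -[RHS](@haar_shift _ a); last exact: Cc_corr_int.
apply: eq_Rintegral => y _; congr (_ * w _).
by rewrite opprD opprB addrA addrA subrK.
Qed.

Lemma corr_suml n (u : nat -> G -> R) (c : nat -> R) w z : (forall i, Cc (u i)) -> Cc w ->
  correlation (fun x => \sum_(i < n) c i * u i x) w z = \sum_(i < n) c i * correlation (u i) w z.
Proof.
move=> cu cw; elim: n => [|n ih].
  under eq_fun do rewrite big_ord0; rewrite big_ord0.
  have := corrZl 0 z (Cc0 hG) cw; under [X in correlation X]eq_fun do rewrite mul0r.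
  by rewrite mul0r.
under eq_fun do rewrite big_ord_recr/=.
rewrite corrDl//; last 2 first.
- by apply: Cc_sum => // i; exact: CcZ.
- exact: CcZ.
by rewrite ih corrZl// big_ord_recr.
Qed.

(** Read from left to right it shows that [correlation u u] is p.d.; read from right to left it
    recognizes weighted sums of translates as autocorrelations. *)
Lemma corr_gram n (c : nat -> R) (x : nat -> G) u z : Cc u ->
  correlation (fun y => \sum_(i < n) c i * u (y - x i)) (fun y => \sum_(i < n) c i * u (y - x i)) z =
  \sum_(i < n) \sum_(j < n) c i * c j * correlation u u (z - x i + x j).
Proof.
move=> cu.
have cS : Cc (fun y => \sum_(i < n) c i * u (y - x i)).
  by apply: Cc_sum => // i; exact/CcZ/Cc_shift.
rewrite (@corr_suml n (fun i y => u (y - x i)))//; last by move=> i; exact: Cc_shift.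
apply: eq_bigr => i _; rewrite -corr_opp//; last exact: Cc_shift.
rewrite (@corr_suml n (fun i y => u (y - x i))); [|by move=> j; exact: Cc_shift|exact: Cc_shift].
rewrite mulr_sumr; apply: eq_bigr => j _; rewrite corr_shift// mulrA; congr (_ * _).
by rewrite -corr_opp//; congr (correlation _ _ _); rewrite !opprD !opprK addrAC.
Qed.

Lemma corr_diag_ge0 u : 0 <= correlation u u 0.
Proof.
by rewrite /correlation; apply: Rintegral_ge0 => x _; rewrite subr0 -expr2 sqr_ge0.
Qed.

Lemma corr_ge0 u w z : (forall x, 0 <= u x) -> (forall x, 0 <= w x) -> 0 <= correlation u w z.
Proof. by move=> u0 w0; apply: Rintegral_ge0 => x _; rewrite mulr_ge0. Qed.

Lemma corr_pos u : Cc u -> (forall x, 0 <= u x) -> 0 < u 0 -> 0 < correlation u u 0.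
Proof.
move=> cu u0 upos; apply: haar_pos; first exact: Cc_corr_int.
  by move=> x; rewrite mulr_ge0.
by rewrite subr0 mulr_gt0.
Qed.

End Correlation.

(** * Positive definite functions *)

Section PositiveDefinite.
Context {R : realType}.

Lemma quad_recr n (c : nat -> R) (A : nat -> nat -> R) : (forall i j, A i j = A j i) ->
  \sum_(i < n.+1) \sum_(j < n.+1) c i * c j * A i j =
  \sum_(i < n) \sum_(j < n) c i * c j * A i j +
  2 * c n * (\sum_(i < n) c i * A i n) + c n ^+ 2 * A n n.
Proof.
move=> Asym; rewrite big_ord_recr/= [in X in _ + X = _]big_ord_recr/=.
under eq_bigr => i _ do rewrite big_ord_recr/=.
rewrite big_split/= (_ : \sum_(i < n) c i * c n * A i n = c n * \sum_(i < n) c i * A i n).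
  rewrite (_ : \sum_(i < n) c n * c i * A n i = c n * \sum_(i < n) c i * A i n).
    by ring.
  by rewrite mulr_sumr; apply: eq_bigr => i _; rewrite Asym mulrA.
by rewrite mulr_sumr; apply: eq_bigr => i _; ring.
Qed.

(* Cholesky factorization, peeling off the last row. When the pivot [A n n]
   vanishes so does the last column, and [x / 0 = 0] makes the formulas of the
   general case apply. *)
Lemma gram_factorization n (A : nat -> nat -> R) : (forall i j, A i j = A j i) ->
  (forall c : nat -> R, 0 <= \sum_(i < n) \sum_(j < n) c i * c j * A i j) ->
  exists W : nat -> nat -> R, forall i j, (i < n)%N -> (j < n)%N ->
    A i j = \sum_(k < n) W k i * W k j.
Proof.
elim: n A => [|n ih] A Asym Apos; first by exists (fun _ _ => 0).
have quadE c := quad_recr n c Asym.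
pose a := A n n.
have a0 : 0 <= a.
  pose c i : R := (i == n)%:R; have := Apos c; rewrite quadE /c eqxx big1 ?big1 => [|i _|i _].
  - by rewrite mulr0 addr0 add0r expr1n mul1r.
  - by rewrite ltn_eqF// mul0r.
  - by rewrite big1// => j _; rewrite ltn_eqF// !mul0r.
have An0 i : (i < n)%N -> a = 0 -> A i n = 0.
  move=> lin az; apply/eqP/negP => /negP Ain.
  (* With pivot 0 the form at [e_i + s e_n] is [A i i + 2 s A i n], which this [s] makes equal to
     -1. *)
  pose s := - (A i i + 1) / (2 * A i n).
  pose c k : R := if k == n then s else (k == i)%:R; have := Apos c.
  have S1 (F : nat -> R) : \sum_(k < n) (if nat_of_ord k == n then s else (nat_of_ord k == i)%:R) * F k = F i.
    rewrite (bigD1 (Ordinal lin))//= eqxx ltn_eqF// mul1r big1 ?addr0// => k ki.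
    have ki' : (nat_of_ord k == i) = false.
      by apply/negbTE; apply: contra ki => /eqP ki; apply/eqP/val_inj.
    by rewrite ltn_eqF// ki' mul0r.
  rewrite quadE /c eqxx -/a az mulr0 addr0 (S1 (fun k => A k n)).
  under eq_bigr => k _.
    under eq_bigr => j _ do rewrite -mulrA.
    rewrite -mulr_sumr (S1 (fun j => A k j)).
    over.
  rewrite (S1 (fun k => A k i)) /s.
  rewrite (_ : _ + _ = -1) ?ler0N1//.
  by field.
have aE i : (i < n)%N -> A i n * A n n / A n n = A i n.
  move=> lin; have [az|anz] := eqVneq a 0; last by rewrite mulfK.
  by rewrite An0// !mul0r.
pose A' i j := A i j - A i n * A n j / a.
have A'sym i j : A' i j = A' j i.
  by rewrite /A' (Asym i j) (Asym i n) (Asym n j); ring.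
have [|W HW] := ih A' A'sym.
  (* [t] minimizes the form in the last coordinate; the minimum is the form of the Schur complement
     [A']. *)
  move=> c; pose t := - (\sum_(i < n) c i * A i n) / a.
  pose c' i := if i == n then t else c i; have := Apos c'; rewrite quadE /c' eqxx.
  have E1 : \sum_(i < n) (if nat_of_ord i == n then t else c i) * A i n = \sum_(i < n) c i * A i n.
    by apply: eq_bigr => i _; rewrite ltn_eqF.
  have E2 : \sum_(i < n) \sum_(j < n) (if nat_of_ord i == n then t else c i) *
      (if nat_of_ord j == n then t else c j) * A i j =
      \sum_(i < n) \sum_(j < n) c i * c j * A i j.
    by apply: eq_bigr => i _; apply: eq_bigr => j _; rewrite !ltn_eqF.
  rewrite E1 E2 => /le_trans; apply.
  set S := \sum_(i < n) c i * A i n.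
  have -> : \sum_(i < n) \sum_(j < n) c i * c j * A' i j =
      \sum_(i < n) \sum_(j < n) c i * c j * A i j - S * S / a.
    transitivity (\sum_(i < n) (\sum_(j < n) c i * c j * A i j - c i * A i n * S / a)).
      apply: eq_bigr => i _.
      rewrite (eq_bigr (fun j : 'I_n => c i * c j * A i j - c i * A i n / a * (c j * A j n))).
        by rewrite sumrB -mulr_sumr -/S; ring.
      by move=> j _; rewrite /A' (Asym n j); ring.
    by rewrite sumrB -!mulr_suml.
  rewrite -addrA lerD2l /t -/a -/S le_eqVlt; apply/orP; left; apply/eqP.
  have [az|anz] := eqVneq a 0; last by field.
  by rewrite az invr0; ring.
(* The new row is the last column of [A] divided by the square root of the pivot; the earlier rows
   get the entry 0 in column [n]. *)
exists (fun k i => if k == n then A i n / Num.sqrt a else if (i < n)%N then W k i else 0).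
have sq x y : x / Num.sqrt a * (y / Num.sqrt a) = x * y / a.
  by rewrite mulrACA -invfM -expr2 sqr_sqrtr.
move=> i j; rewrite !ltnS big_ord_recr/= eqxx sq.
under eq_bigr => k _ do rewrite ltn_eqF//.
rewrite leq_eqVlt => /orP[/eqP ->|lin].
  rewrite ltnn big1 ?add0r => [|k _]; last by rewrite mul0r.
  rewrite leq_eqVlt => /orP[/eqP ->|ljn].
    have [az|anz] := eqVneq a 0; last by rewrite mulfK.
    by rewrite -/a az !mul0r.
  by rewrite [A n n * _]mulrC /a aE// Asym.
rewrite lin leq_eqVlt => /orP[/eqP ->|ljn].
  rewrite ltnn big1 ?add0r => [|k _]; last by rewrite mulr0.
  by rewrite /a aE.
by rewrite ljn -HW// /A' (Asym n j) subrK.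
Qed.

Context {G : topologicalZmodType}.
Implicit Types (f g E : G -> R).

(** Real coefficients see only the even part of [f], so evenness is required separately. Sequences
    on [nat] avoid dependent indices. *)
Definition real_pd f : Prop := (forall x, f (- x) = f x) /\
  forall n (c : nat -> R) (x : nat -> G),
    0 <= \sum_(i < n) \sum_(j < n) c i * c j * f (x i - x j).

Lemma real_pd_gram f n (x : nat -> G) : real_pd f ->
  exists W : nat -> nat -> R, forall i j, (i < n)%N -> (j < n)%N ->
    f (x i - x j) = \sum_(k < n) W k i * W k j.
Proof.
move=> [fe fp]; apply: (@gram_factorization n (fun i j => f (x i - x j))).
  by move=> i j; rewrite -fe opprB.
by move=> c; exact: fp.
Qed.

(** The Schur product theorem: a Gram factorization of the matrix of [f] writes the form of the
    product as a sum of forms of [g]. *)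
Lemma real_pd_mul f g : real_pd f -> real_pd g -> real_pd (fun x => f x * g x).
Proof.
move=> pf pg; split=> [x|n c x]; first by rewrite pf.1 pg.1.
have [W HW] := real_pd_gram n x pf.
rewrite (eq_bigr (fun i : 'I_n => \sum_(j < n) \sum_(k < n)
    (c i * W k i) * (c j * W k j) * g (x i - x j))); last first.
  move=> i _; apply: eq_bigr => j _.
  rewrite HW// mulr_suml mulr_sumr; apply: eq_bigr => k _; ring.
rewrite (eq_bigr (fun i : 'I_n => \sum_(k < n) \sum_(j < n)
    (c i * W k i) * (c j * W k j) * g (x i - x j))); last first.
  by move=> i _; rewrite exchange_big.
rewrite exchange_big; apply: sumr_ge0 => k _.
exact: (pg.2 n (fun i => c i * W k i)).
Qed.

Lemma real_pd_seq (T : Type) f (s : seq T) (c : T -> R) (g : T -> G) : real_pd f ->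
  0 <= \sum_(p <- s) \sum_(q <- s) c p * c q * f (g p - g q).
Proof.
case: s => [|t s] [_ fp]; first by rewrite big_nil.
have := fp (size (t :: s)) (fun i => c (nth t (t :: s) i)) (fun i => g (nth t (t :: s) i)).
congr (_ <= _); rewrite (big_nth t) big_mkord; apply: eq_bigr => i _.
by rewrite (big_nth t) big_mkord.
Qed.

Lemma real_pd_le f x : real_pd f -> f x <= f 0.
Proof.
move=> [fe fp].
have := fp 2%N (fun i => if i == 0%N then 1 else -1) (fun i => if i == 0%N then x else 0).
by rewrite !big_ord_recl !big_ord0 /= !subr0 sub0r subrr fe; lra.
Qed.

Lemma real_pdD f g : real_pd f -> real_pd g -> real_pd (fun x => f x + g x).
Proof.
move=> [fe fp] [ge gp]; split=> [x|n c x]; first by rewrite fe ge.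
under eq_bigr => i _.
  under eq_bigr => j _ do rewrite mulrDr.
  rewrite big_split/=; over.
by rewrite big_split addr_ge0.
Qed.

Lemma real_pdZ a f : 0 <= a -> real_pd f -> real_pd (fun x => a * f x).
Proof.
move=> a0 [fe fp]; split=> [x|n c x]; first by rewrite fe.
under eq_bigr => i _.
  under eq_bigr => j _ do rewrite mulrCA.
  rewrite -mulr_sumr; over.
by rewrite -mulr_sumr mulr_ge0.
Qed.

Lemma real_pd0 : real_pd (fun _ : G => 0).
Proof.
split=> // n c x.
by rewrite big1// => i _; rewrite big1// => j _; rewrite mulr0.
Qed.

Lemma real_pd_sum (I : Type) (s : seq I) (F : I -> G -> R) :
  (forall i, real_pd (F i)) -> real_pd (fun x => \sum_(i <- s) F i x).
Proof.
move=> pF; elim: s => [|i s ih].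
  by under eq_fun do rewrite big_nil; exact: real_pd0.
by under eq_fun do rewrite big_cons; exact: real_pdD.
Qed.

(* The autocorrelation of the point measure [delta_0 - delta_a], smoothed by [E]. *)
Lemma real_pd_diff E a : real_pd E ->
  real_pd (fun x => 2 * E x - E (x - a) - E (x + a)).
Proof.
move=> pE; have [Ee _] := pE; split=> [x|n c x].
  rewrite Ee -(Ee (- x - a)) -(Ee (- x + a)) !opprD !opprK; ring.
pose s := [seq (true, i) | i <- index_enum 'I_n] ++ [seq (false, i) | i <- index_enum 'I_n].
have := real_pd_seq s (fun p => (if p.1 then 1 else -1) * c p.2)
  (fun p => if p.1 then x p.2 else x p.2 + a) pE.
congr (_ <= _); rewrite /s big_cat/= !big_map/= -big_split; apply: eq_bigr => i _ /=.
rewrite !big_cat/= !big_map/= -!big_split; apply: eq_bigr => j _ /=.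
have -> : x i + a - (x j + a) = x i - x j by rewrite opprD addrACA subrr addr0.
have -> : x i - (x j + a) = x i - x j - a by rewrite opprD addrA.
have -> : x i + a - x j = x i - x j + a by rewrite addrAC.
by ring.
Qed.

End PositiveDefinite.

(** * Almost invariant positive definite bumps *)

Section Folner.
Context {R : realType} {G : topologicalZmodType}.
Hypothesis hG : lca_group G.
Variable E : G -> R.
Hypotheses (cE : Cc E) (E_ge0 : forall x, 0 <= E x) (pE : real_pd E) (E0 : 0 < E 0).

(** The convolution of [E] with the autocorrelation of the sum of the point masses at [xs],
    repetitions counted; hence p.d. along with [E]. *)
Definition smear (xs : seq G) (z : G) : R :=
  \sum_(x <- xs) \sum_(y <- xs) E (z - x + y).

Lemma smear_ge0 xs z : 0 <= smear xs z.
Proof. by apply: sumr_ge0 => x _; apply: sumr_ge0. Qed.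

Lemma Cc_smear xs : Cc (smear xs).
Proof.
apply: Cc_sum => // x; apply: Cc_sum => // y.
rewrite (_ : (fun z => _) = fun z => E (z - (x - y))); first exact: Cc_shift.
by apply/funext => z; rewrite opprB addrA addrAC.
Qed.

Lemma real_pd_smear xs : real_pd (smear xs).
Proof.
have [Ee _] := pE; split=> [z|n c x].
  rewrite /smear exchange_big; apply: eq_bigr => a _; apply: eq_bigr => b _.
  by rewrite -Ee; congr E; rewrite !opprD !opprK addrAC.
have := real_pd_seq [seq (i, a) | i <- index_enum 'I_n, a <- xs]
  (fun p => c p.1) (fun p => x p.1 - p.2) pE.
congr (_ <= _); rewrite big_allpairs; apply: eq_bigr => i _.
transitivity (\sum_(a <- xs) \sum_(j < n) \sum_(b <- xs) c i * c j * E (x i - a - (x j - b))).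
  by apply: eq_bigr => a _; rewrite big_allpairs.
rewrite exchange_big; apply: eq_bigr => j _ /=.
rewrite /smear mulr_sumr; apply: eq_bigr => a _; rewrite mulr_sumr.
apply: eq_bigr => b _; congr (_ * E _).
by rewrite !opprD !opprK !addrA [LHS](ACl (1*3*2*4)).
Qed.

Lemma smear_diag_pos x xs : 0 < smear (x :: xs) 0.
Proof.
rewrite /smear big_cons big_cons sub0r addNr -addrA ltr_wpDr//.
rewrite addr_ge0//; first by apply: sumr_ge0.
by apply: sumr_ge0 => a _; apply: sumr_ge0.
Qed.

(* Convolution with [|1_(0 <= n < M) (n a)|^2]. *)
Let fejer (M : nat) (a : G) (F : G -> R) (z : G) : R :=
  \sum_(n < M) \sum_(m < M) F (z - a *+ n + a *+ m).

(** Spreading along [a] stays among smears: each [x] in [xs] is replaced by the points [x + n a]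
    with [n < M]. *)
Let fejer_smear M a xs : exists ys, fejer M a (smear xs) = smear ys.
Proof.
exists [seq p.2 + a *+ p.1 | p <- [seq (n, x) | n <- iota 0 M, x <- xs]]; apply/funext => z.
have iotaE (H : nat -> R) : \sum_(n < M) H n = \sum_(n <- iota 0 M) H n.
  by rewrite -(big_mkord xpredT H) /index_iota subn0.
rewrite /fejer (iotaE (fun n => \sum_(m < M) smear xs (z - a *+ n + a *+ m))).
rewrite /smear big_map big_allpairs; apply: eq_bigr => n _.
rewrite (iotaE (fun m => smear xs (z - a *+ n + a *+ m))) /smear exchange_big.
apply: eq_bigr => x _; rewrite big_map big_allpairs; apply: eq_bigr => m _.
apply: eq_bigr => y _; congr E.
by rewrite opprD !addrA [RHS](ACl (1*3*5*2*4)).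
Qed.

Let fejerC M a b F : fejer M a (fejer M b F) = fejer M b (fejer M a F).
Proof.
apply/funext => z; rewrite /fejer.
rewrite [LHS]pair_bigA [RHS]pair_bigA /=.
under [LHS]eq_bigr do rewrite pair_bigA.
under [RHS]eq_bigr do rewrite pair_bigA.
rewrite exchange_big; apply: eq_bigr => p _; apply: eq_bigr => q _; congr F.
by rewrite /= [LHS](ACl (1*4*5*2*3)).
Qed.

Let fejers (M : nat) (s : seq G) : G -> R := foldr (fejer M) (smear [:: 0]) s.

Let fejers_smear M s : exists ys, fejers M s = smear ys.
Proof.
elim: s => [|a s [ys IH]]; first by exists [:: 0].
by rewrite /fejers /= -/(fejers M s) IH; exact: fejer_smear.
Qed.

(** The operators commute, so any direction in [s] may be taken as the one applied last. *)
Let fejers_factor M a s : a \in s -> exists ys, fejers M s = fejer M a (smear ys).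
Proof.
elim: s => // b s ih; rewrite inE /fejers /= -/(fejers M s) => /orP[/eqP <-|/ih[ys ->]].
  by have [ys ->] := fejers_smear M s; exists ys.
have [zs e] := fejer_smear M b ys.
by exists zs; rewrite fejerC e.
Qed.

(* Only the extreme terms survive: [fejer F 0 - fejer F a = F 0 - F (M a)]. *)
Let fejer_shift M a ys : let F := fejer M a (smear ys) in F 0 <= F a + smear ys 0.
Proof.
have [Fe _] := real_pd_smear ys.
pose H (k : nat) n := smear ys (a *+ k - a *+ n).
have F0 : fejer M a (smear ys) 0 = \sum_(n < M) \sum_(m < M) H m n.
  apply: eq_bigr => n _; apply: eq_bigr => m _.
  by rewrite /H sub0r addrC.
have Fa : fejer M a (smear ys) a = \sum_(n < M) \sum_(m < M) H m.+1 n.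
  apply: eq_bigr => n _; apply: eq_bigr => m _.
  by rewrite /H mulrS addrAC.
have tele (u : nat -> R) k : \sum_(i < k) (u i - u i.+1) = u 0%N - u k.
  elim: k => [|k ih]; first by rewrite big_ord0 subrr.
  by rewrite big_ord_recr/= ih; ring.
rewrite /= F0 Fa -lerBlDl -sumrB.
under eq_bigr => n _.
  rewrite -sumrB (tele (fun m => H m n)); over.
rewrite /= sumrB.
have HM n : (n <= M)%N -> H M n = H (M - n)%N 0%N.
  by move=> nM; rewrite /H mulr0n subr0 mulrnBr.
have H0 n : H 0%N n = H n 0%N.
  by rewrite /H mulr0n sub0r subr0 Fe.
have -> : \sum_(n < M) H M n = \sum_(n < M) H n.+1 0%N.
  rewrite [RHS](reindex_inj rev_ord_inj); apply: eq_bigr => n _ /=.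
  by rewrite HM 1?ltnW// subnSK.
under eq_bigr => n _ do rewrite H0.
rewrite -sumrB (tele (fun m => H m 0%N)).
by rewrite /H mulr0n subrr lerBlDr lerDl smear_ge0.
Qed.

(** Keeps the terms [n = m] only. Together with [fejer_shift], a translation by [a] costs at most
    the fraction 1/M of the value at 0. *)
Let fejer_diag M a ys : M%:R * smear ys 0 <= fejer M a (smear ys) 0.
Proof.
rewrite /fejer -[M in M%:R]card_ord -sum1_card natr_sum mulr_suml.
apply: ler_sum => n _; rewrite mul1r (bigD1 n)//= sub0r addNr lerDl.
by apply: sumr_ge0 => m _; exact: smear_ge0.
Qed.

(** The point is that [V] does not depend on [xs]. Uniform continuity bounds the loss of each
    relevant term by [e / C']. The constant 1 is dominated there by [C] times a sum of translates of
    [E], so the total loss is at most [e C / C'] times a sum of [size s] translated smears, each at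
    most [smear xs 0] since a p.d. function peaks at 0. *)
Let smear_local (e : R) : 0 < e -> exists2 V : set G, open_nbhs 0 V &
  forall xs z v, V v -> smear xs z - e * smear xs 0 <= smear xs (z + v).
Proof.
move=> e0.
have [K cK EK] := Cc_supp hG cE.
have [W oW [cW _]] := lca_nbhs_compact hG (conj openT I : open_nbhs (0 : G) setT).
have cKW : compact [set a + b | a in K & b in [set - b | b in closure W]].
  by apply: compact_add => //; exact: compact_opp.
have [h [ch h01 h1 _]] := @Cc_bump R G hG _ setT cKW openT (@subsetT _ _).
have [C [C0 [s hs]]] := Cc_dominated hG cE E_ge0 E0 ch.
pose C' := C * (size s)%:R + 1.
have C'0 : 0 < C' by rewrite /C' ltr_wpDl// mulr_ge0.
have [V oV EV] := Cc_unif_continuous hG cE (divr_gt0 e0 C'0).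
exists (V `&` W `&` [set x | V (- x)]).
  split; last by split; [split; [case: oV|case: oW]|rewrite /= oppr0; case: oV].
  apply: openI; first by apply: openI; [case: oV|case: oW].
  apply: (@open_comp _ _ (fun x : G => - x)); last by case: oV.
  by move=> y _; exact: opp_continuous.
move=> xs z v [[Vv Wv] /= VNv].
have loc y : E y - e / C' * (C * \sum_(a <- s) E (y - a)) <= E (y + v).
  have := hs y; have [Ky h_le|nKy _] :=
      pselect ([set a + b | a in K & b in [set - b | b in closure W]] y).
    move: h_le; rewrite h1// normr1 => h_le.
    have : `|E (y + v) - E y| <= e / C' by apply: EV; rewrite [y + v]addrC addrK.
    rewrite ler_norml => /andP[+ _].
    have : e / C' <= e / C' * (C * \sum_(a <- s) E (y - a)).
      by rewrite ler_peMr// divr_ge0// ltW.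
    lra.
  rewrite (EK y); last first.
    move=> Ky; apply: nKy; exists y => //; exists 0; last by rewrite addr0.
    by exists 0; [apply: subset_closure; case: oW|rewrite oppr0].
  rewrite sub0r; apply: (@le_trans _ _ 0) => //.
  rewrite oppr_le0 mulr_ge0 ?divr_ge0 ?(ltW e0) ?(ltW C'0)//.
  by rewrite mulr_ge0// sumr_ge0.
apply: (@le_trans _ _ (\sum_(x <- xs) \sum_(y <- xs)
    (E (z - x + y) - e / C' * (C * \sum_(a <- s) E (z - x + y - a))))); last first.
  apply: ler_sum => x _; apply: ler_sum => y _.
  apply: le_trans (loc _) _; rewrite le_eqVlt; apply/orP; left; apply/eqP.
  by congr E; rewrite [LHS](ACl (1*4*2*3)).
rewrite (eq_bigr (fun x => \sum_(y <- xs) E (z - x + y) -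
    \sum_(y <- xs) (e / C' * (C * \sum_(a <- s) E (z - x + y - a))))); last first.
  by move=> x _; rewrite sumrB.
rewrite sumrB lerD2l lerN2.
rewrite (_ : \sum_(x <- xs) _ = e / C' * (C * \sum_(a <- s) smear xs (z - a))); last first.
  under eq_bigr => x _ do rewrite -mulr_sumr -mulr_sumr exchange_big.
  rewrite -!mulr_sumr exchange_big; congr (_ * (_ * _)); apply: eq_bigr => a _ /=.
  apply: eq_bigr => x _; apply: eq_bigr => y _; congr E.
  by rewrite [LHS](ACl (1*4*2*3)).
have sum_le : \sum_(a <- s) smear xs (z - a) <= (size s)%:R * smear xs 0.
  rewrite -sum1_size natr_sum mulr_suml; apply: ler_sum => a _.
  by rewrite mul1r; exact: real_pd_le (real_pd_smear xs).
apply: (@le_trans _ _ (e / C' * (C * ((size s)%:R * smear xs 0)))).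
  by rewrite ler_wpM2l ?divr_ge0 ?(ltW e0) ?(ltW C'0)// ler_wpM2l.
set S := smear xs 0; set N : R := (size s)%:R.
have -> : e / C' * (C * (N * S)) = C * N / C' * (e * S) by ring.
rewrite ler_piMl//; first by rewrite mulr_ge0 ?smear_ge0// ltW.
by rewrite ler_pdivrMr// mul1r /C' lerDl.
Qed.

(* [E] spread over a large box spanned by a fine net of [K] is almost invariant
   under translation by [K]. *)
Theorem folner K (eta : R) : compact K -> 0 < eta ->
  exists2 xs : seq G, 0 < smear xs 0 &
    forall z, K z -> (1 - eta) * smear xs 0 <= smear xs z.
Proof.
move=> cK eta0.
have [V [oV V0] HV] := smear_local (divr_gt0 eta0 (ltr0Sn R 1)).
have [|s [_ Ks]] := @compact_seq_cover G K (fun a => [set x | V (x - a)]) cK.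
  by move=> a _; split; [exact: open_shift|rewrite /= subrr].
pose M := (Num.bound (2 / eta)).+1.
(* Half of [eta] pays for the translation by a net point, a loss of at most 1/M, the other half for
   the distance from [z] to that point. *)
have MR : 2 <= eta * M%:R.
  rewrite -ler_pdivrMl// mulrC (le_trans (ltW (archi_boundP _)))//.
    by rewrite divr_ge0// ltW.
  by rewrite ler_nat.
have [xs xsE] := fejers_smear M s.
have pos : 0 < smear xs 0.
  rewrite -xsE; elim: s {Ks xsE} => [|a s ih]; first exact: smear_diag_pos.
  rewrite /fejers /= -/(fejers M s); have [ys ysE] := fejers_smear M s.
  rewrite ysE; apply: lt_le_trans (fejer_diag M a ys).
  by rewrite mulr_gt0 ?ltr0n// -ysE.
exists xs => // z /Ks[a as_ Vza].
have [ys ysE] := fejers_factor M as_.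
have := fejer_shift M a ys; have := fejer_diag M a ys.
rewrite -ysE xsE => h1 /= h2.
have := HV xs a _ Vza; rewrite [a + _]addrC subrK.
have : smear ys 0 <= eta / 2 * smear xs 0.
  by have := smear_ge0 ys 0; nra.
lra.
Qed.

End Folner.

(** * Radon functionals of positive type *)

Section RadonFunctional.
Context {R : realType} {G : topologicalZmodType}.
Hypothesis hG : lca_group G.
Implicit Types (f g u w : G -> R) (K V U : set G).
Variable nu : (G -> R) -> R.
Hypothesis rnu : radon_functional nu.

Lemma radon_linear a f g : Cc f -> Cc g ->
  nu (fun x => a * f x + g x) = a * nu f + nu g.
Proof. by case: rnu => + _; exact. Qed.

Lemma radonD f g : Cc f -> Cc g -> nu (fun x => f x + g x) = nu f + nu g.
Proof.
move=> cf cg; have := radon_linear 1 cf cg; rewrite mul1r => <-.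
by congr nu; apply/funext => x; rewrite mul1r.
Qed.

Lemma radon0 : nu (fun=> 0) = 0.
Proof.
have := radonD (Cc0 hG) (Cc0 hG).
under [X in nu X]eq_fun do rewrite addr0; lra.
Qed.

Lemma radonZ a f : Cc f -> nu (fun x => a * f x) = a * nu f.
Proof.
move=> cf; have := radon_linear a cf (Cc0 hG); rewrite radon0 addr0 => <-.
by congr nu; apply/funext => x; rewrite addr0.
Qed.

Lemma radonB f g : Cc f -> Cc g -> nu (fun x => f x - g x) = nu f - nu g.
Proof.
move=> cf cg; rewrite (_ : (fun x => _) = fun x => f x + -1 * g x); last first.
  by apply/funext => x; rewrite mulN1r.
by rewrite radonD ?radonZ ?mulN1r//; exact: CcZ.
Qed.

Lemma radon_sum (I : Type) (s : seq I) (F : I -> G -> R) : (forall i, Cc (F i)) ->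
  nu (fun x => \sum_(i <- s) F i x) = \sum_(i <- s) nu (F i).
Proof.
move=> cF; elim: s => [|i s ih].
  by under eq_fun do rewrite big_nil; rewrite big_nil radon0.
by under eq_fun do rewrite big_cons; rewrite big_cons radonD ?ih//; exact: Cc_sum.
Qed.

Lemma radon_bound K : compact K -> exists2 C : R, 0 <= C &
  forall f M, Cc f -> (forall x, ~ K x -> f x = 0) -> (forall x, `|f x| <= M) ->
    `|nu f| <= C * M.
Proof.
move=> cK; have [_ /(_ K cK)[C HC]] := rnu.
exists `|C| => // f M cf fK fM.
have fsK : fsupp f `<=` K.
  rewrite [X in _ `<=` X]((closure_id K).1 (lca_compact_closed hG cK)).
  by apply: closureS => x /= /eqP; apply: contra_notP; exact: fK.
have M0 : 0 <= M := le_trans (normr_ge0 _) (fM 0).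
have sM : (sup_norm f <= M%:E)%E.
  by apply: ge_ereal_sup => _ [x _ <-]; rewrite lee_fin.
have s0 : (0 <= sup_norm f)%E.
  by apply: (@le_trans _ _ (`|f 0|%:E)); [rewrite lee_fin|apply: ereal_sup_ubound; exists 0].
rewrite -lee_fin; apply: (le_trans (HC f cf fsK)).
apply: (@le_trans _ _ (`|C|%:E * sup_norm f)%E).
  by rewrite lee_wpmul2r// lee_fin ler_norm.
by rewrite EFinM lee_wpmul2l.
Qed.

Lemma radon_approx_ge0 f K : Cc f -> compact K ->
  (forall e, 0 < e -> exists g, [/\ Cc g, forall x, ~ K x -> f x - g x = 0,
     forall x, `|f x - g x| <= e & 0 <= nu g]) -> 0 <= nu f.
Proof.
move=> cf cK H; have [C C0 HC] := radon_bound cK.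
rewrite -oppr_le0; apply/ler_addgt0Pr => e e0; rewrite add0r.
have C1 : 0 < C + 1 by lra.
have [g [cg fgK fge nug]] := H _ (divr_gt0 e0 C1).
have := HC _ _ (CcB hG cf cg) fgK fge; rewrite radonB// => /ler_normlP[+ _].
have : C * (e / (C + 1)) <= e by rewrite mulrA ler_pdivrMr// mulrC ler_pM2l//; lra.
by lra.
Qed.

Variable lambda : borel_measure R G.
Hypothesis hl : is_haar lambda.

Local Notation corr := (correlation lambda).

Lemma small_corr_bump V : open_nbhs 0 V -> exists e : G -> R,
  [/\ Cc e, forall x, 0 <= e x, 0 < e 0 & forall z, ~ V z -> corr e e z = 0].
Proof.
move=> [oV V0]; have [U [oU U0] UV] := nbhs0_sub (open_nbhs_nbhs (conj oV V0)).
have [|e [ce e01 e1 [L [cL LU Le]]]] := @Cc_bump R G hG [set 0] U (@compact_set1 G 0) oU.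
  by move=> _ ->.
exists e; split=> //; [by move=> x; case/andP: (e01 x)|by rewrite e1|].
move=> z nVz; apply: (corr_supp hG hl Le Le) => -[a /LU Ua [b /LU Ub abz]].
by apply: nVz; rewrite -abz; exact: UV.
Qed.

Lemma real_pd_corr u : Cc u -> real_pd (corr u u).
Proof.
move=> cu; split=> [x|n c x]; first exact: corr_opp.
have := corr_diag_ge0 lambda (fun y => \sum_(i < n) c i * u (y + x i)).
have := corr_gram hG hl n c (fun i => - x i) 0 cu.
under eq_fun do under eq_bigr do rewrite opprK.
move=> ->; congr (_ <= _); apply: eq_bigr => i _; apply: eq_bigr => j _.
by rewrite sub0r opprK.
Qed.

Lemma radon_pd_ge0 f : (forall u, Cc u -> 0 <= nu (corr u u)) ->
  Cc f -> real_pd f -> 0 <= nu f.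
Proof.
move=> nuc cf pf.
have [K cK fK] := Cc_supp hG cf.
have [M M0 fM] := Cc_bounded hG cf.
(* [W] fixes, before the precision is chosen, one compact set carrying all approximants. *)
have [W oW [cW _]] := lca_nbhs_compact hG (conj openT I : open_nbhs (0 : G) setT).
have cKW := compact_add cK cW.
have sub0 x : K x -> [set a + b | a in K & b in closure W] x.
  move=> Kx; exists x => //; exists 0; last by rewrite addr0.
  by apply: subset_closure; case: oW.
apply: (radon_approx_ge0 cf cKW) => e' e'0.
(* The error is at most [d] for replacing [f (a - b)] by [f z], plus [d M] for the missing weight
   [1 - q]. *)
have [d d0 dM] : exists2 d, 0 < d & d * (1 + M) <= e'.
  exists (e' / (1 + M)); first by rewrite divr_gt0//; lra.
  by rewrite mulfVK// gt_eqF//; lra.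
have [V [oV V0] Vf] := Cc_unif_continuous hG cf d0.
have [|e [ce e0 epos eV]] := @small_corr_bump (V `&` W).
  by split; [apply: openI => //; case: oW|split=> //; case: oW].
pose E := corr e e.
have cE : Cc E := Cc_corr hG hl ce ce.
have E_ge0 x : 0 <= E x by apply: corr_ge0.
have pE : real_pd E := real_pd_corr ce.
have E0 : 0 < E 0 := corr_pos hG hl ce e0 epos.
have [xs S0 HS] := folner hG cE E_ge0 pE E0 cK d0.
set S := smear E xs 0 in S0 HS.
pose n := size xs; pose x i := nth 0 xs i.
have smE (F : G -> G -> R) : \sum_(a <- xs) \sum_(b <- xs) F a b =
    \sum_(i < n) \sum_(j < n) F (x i) (x j).
  by rewrite (big_nth 0) big_mkord; apply: eq_bigr => i _; rewrite (big_nth 0) big_mkord.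
(* An average of the values [f (a - b)] whose weights vanish unless [z - (a - b)] lies in [V], where
   [f] varies by at most [d]. *)
pose g z := S^-1 * \sum_(a <- xs) \sum_(b <- xs) f (a - b) * E (z - a + b).
exists g; split.
- apply: CcZ => //; apply: Cc_sum => // a; apply: Cc_sum => // b; apply: CcZ => //.
  rewrite (_ : (fun z => _) = fun z => E (z - (a - b))); first exact: Cc_shift.
  by apply/funext => z; rewrite opprB addrA addrAC.
- move=> z nz; rewrite fK ?sub0r; last by move=> /sub0.
  rewrite /g big1 ?mulr0 ?oppr0// => a _; rewrite big1// => b _.
  have [Kab|/fK ->] := pselect (K (a - b)); last by rewrite mul0r.
  rewrite /E eV ?mulr0// => -[_ Wz]; apply: nz; exists (a - b) => //.
  exists (z - a + b); first exact: subset_closure.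
  have -> : z - a + b = z - (a - b) by rewrite opprB addrA addrAC.
  by rewrite addrC subrK.
- move=> z; apply: le_trans dM.
  (* The total weight at [z]: at most 1 because a p.d. function peaks at 0, at least [1 - d] on [K]
     by [folner]. *)
  pose q := smear E xs z / S.
  have q01 : 0 <= q <= 1.
    rewrite /q divr_ge0 ?smear_ge0 ?(ltW S0)//= ler_pdivrMr// mul1r.
    exact: real_pd_le (real_pd_smear pE xs).
  rewrite (_ : f z - g z = f z * (1 - q) - (g z - f z * q)); last by ring.
  apply: (le_trans (ler_normB _ _)); rewrite [d * _]mulrDr [d * 1]mulr1 addrC; apply: lerD.
    rewrite (_ : g z - f z * q = S^-1 * \sum_(a <- xs) \sum_(b <- xs)
        (f (a - b) - f z) * E (z - a + b)); last first.
      rewrite /g /q [_ / S]mulrC [f z * _]mulrCA -mulrBr; congr (_ * _).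
      rewrite /smear mulr_sumr -sumrB; apply: eq_bigr => a _.
      by rewrite mulr_sumr -sumrB; apply: eq_bigr => b _; rewrite mulrBl.
    rewrite normrM ger0_norm ?invr_ge0 ?(ltW S0)//.
    apply: (@le_trans _ _ (S^-1 * (d * smear E xs z))).
      rewrite ler_wpM2l ?invr_ge0 ?(ltW S0)//.
      rewrite /smear mulr_sumr; apply: (le_trans (ler_norm_sum _ _ _)); apply: ler_sum => a _.
      rewrite mulr_sumr; apply: (le_trans (ler_norm_sum _ _ _)); apply: ler_sum => b _.
      rewrite normrM (ger0_norm (E_ge0 _)).
      have [[Vz _]|nV] := pselect ((V `&` W) (z - a + b)); last by rewrite /E eV// !mulr0.
      rewrite ler_wpM2r// distrC; apply: Vf.
      by rewrite opprB addrA addrAC.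
    rewrite mulrCA [S^-1 * _]mulrC -/q.
    by case/andP: q01 => _ q1; rewrite -[leRHS]mulr1 ler_wpM2l// ltW.
  have [Kz|/fK ->] := pselect (K z); last by rewrite mul0r normr0 mulr_ge0// ltW.
  have : 1 - d <= q by rewrite /q ler_pdivlMr//; exact: HS.
  rewrite normrM [`|1 - q|]ger0_norm; last by lra.
  by have := fM z; have := normr_ge0 (f z); nra.
- have [Wm HW] := real_pd_gram n x pf.
  pose u k y := \sum_(i < n) Wm k i * e (y - x i).
  have cu k : Cc (u k) by apply: Cc_sum => // i; apply: CcZ => //; exact: Cc_shift.
  have -> : g = fun z => S^-1 * \sum_(k < n) corr (u k) (u k) z.
    apply/funext => z; rewrite /g smE; congr (_ * _).
    under [RHS]eq_bigr => k _ do rewrite corr_gram//.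
    rewrite [RHS]exchange_big; apply: eq_bigr => i _.
    rewrite [RHS]exchange_big; apply: eq_bigr => j _ /=.
    by rewrite HW// mulr_suml.
  rewrite radonZ; last by apply: Cc_sum => // k; exact: Cc_corr.
  rewrite (@radon_sum _ _ (fun k : 'I_n => corr (u k) (u k))); last by move=> k; exact: Cc_corr.
  by rewrite mulr_ge0 ?invr_ge0 ?(ltW S0)// sumr_ge0// => k _; exact: nuc.
Qed.

(* With [e] an approximate identity, [corr f e] approximates [f]. *)
Lemma radon_even : (forall u w, Cc u -> Cc w -> nu (corr u w) = nu (corr w u)) ->
  forall f, Cc f -> nu (fun x => f (- x)) = nu f.
Proof.
move=> nusym f cf.
(* Equality is split into two inequalities so that [radon_approx_ge0] applies; on the approximants,
   which are correlations, the combination is exactly 0. *)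
suff H (a b : R) : a = 1 /\ b = -1 \/ a = -1 /\ b = 1 -> 0 <= nu (fun x => a * f x + b * f (- x)).
  have cfo := Cc_opp hG cf.
  have := H 1 (-1) (or_introl (conj erefl erefl)).
  have := H (-1) 1 (or_intror (conj erefl erefl)).
  rewrite !radon_linear//; [|exact: CcZ..].
  by rewrite !radonZ//; lra.
move=> ab.
have cfo := Cc_opp hG cf.
have [K cK fK] := Cc_supp hG cf.
have [W oW [cW _]] := lca_nbhs_compact hG (conj openT I : open_nbhs (0 : G) setT).
pose D := [set a - b | a in K & b in closure W].
have cD : compact D.
  have -> : D = [set a + b | a in K & b in [set - b | b in closure W]].
    apply/seteqP; split=> x.
      by move=> [c Kc [w Ww <-]]; exists c => //; exists (- w) => //; exists w.
    by move=> [c Kc [_ [w Ww <-] <-]]; exists c => //; exists w.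
  by apply: compact_add => //; exact: compact_opp.
have KD x : K x -> D x.
  by move=> Kx; exists x => //; exists 0; [apply: subset_closure; case: oW|rewrite subr0].
apply: (@radon_approx_ge0 _ (D `|` [set - x | x in D])).
- by apply: CcD => //; exact: CcZ.
- by apply: compactU => //; exact: compact_opp.
move=> e' e'0.
have e20 : 0 < e' / 2 by lra.
have [V [oV V0] Vf] := Cc_unif_continuous hG cf e20.
have [||h [ch h01 h1 [L [cL LU Lh]]]] := @Cc_bump R G hG [set 0] (V `&` W) (@compact_set1 G 0).
- by apply: openI => //; case: oW.
- by move=> _ ->; split=> //; case: oW.
have h0 x : 0 <= h x by case/andP: (h01 x).
pose I := \int[lambda]_x h x.
have I0 : 0 < I by apply: haar_pos => //; rewrite h1.
have rl : radon lambda by case: hl.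
pose g z := I^-1 * corr f h z.
have cg : Cc g by apply: CcZ => //; exact: Cc_corr.
have gD z : ~ D z -> g z = 0.
  move=> nD; rewrite /g (corr_supp hG hl fK Lh) ?mulr0//.
  by move=> [c Kc [w /LU[_ Ww] cwz]]; apply: nD; exists c => //; exists w => //; exact: subset_closure.
have fg z : `|f z - g z| <= e' / 2.
  have c1 : Cc (fun y => f y * h (y - z)).
    by apply: CcMl => //; [exact: Cc_continuous|exact: Cc_shift].
  have c2 : Cc (fun y => f z * h (y - z)) by apply: CcZ => //; exact: Cc_shift.
  have -> : f z - g z = I^-1 * \int[lambda]_y (f z * h (y - z) - f y * h (y - z)).
    rewrite RintegralB//; [|exact: radon_Cc_integrable..].
    rewrite Cc_RintegralZ//; last exact: Cc_shift.
    rewrite haar_shift// -/I mulrBr mulrCA mulVf ?mulr1//.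
    by rewrite gt_eqF.
  rewrite normrM ger0_norm ?invr_ge0 ?(ltW I0)// ler_pdivrMl//.
  have c3 := CcB hG c2 c1.
  apply: le_trans (le_normr_Rintegral _ (radon_Cc_integrable hG rl c3)) _ => //.
  rewrite /I -(haar_shift hG hl z ch) mulrC -Cc_RintegralZ//; last exact: Cc_shift.
  apply: Cc_le_Rintegral => //; [exact: Cc_norm|by apply: CcZ => //; exact: Cc_shift|].
  move=> y; rewrite -mulrBl normrM (ger0_norm (h0 _)).
  have [Ly|/Lh ->] := pselect (L (y - z)); last by rewrite !mulr0.
  rewrite ler_wpM2r// distrC; apply: Vf.
  by have [] := LU _ Ly.
exists (fun x => a * g x + b * g (- x)); split.
- by apply: CcD => //; [exact: CcZ|apply: CcZ => //; exact: Cc_opp].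
- move=> x /not_orP[nD nD'].
  have nDx : ~ D (- x) by move=> Dx; apply: nD'; exists (- x) => //; rewrite opprK.
  rewrite !gD// !fK; last 2 first.
  + by move=> /KD.
  + by move=> /KD.
  by rewrite !mulr0 subrr.
- move=> x; have := fg x; have := fg (- x); rewrite !ler_norml.
  by case: ab => -[-> ->]; lra.
- have cgo := Cc_opp hG cg.
  rewrite radon_linear//; last exact: CcZ.
  rewrite radonZ// (_ : nu (fun x => g (- x)) = nu g); first by case: ab => -[-> ->]; lra.
  rewrite /g !radonZ//; [|exact: Cc_corr|].
  + congr (_ * _); rewrite (nusym _ _ cf ch); congr nu.
    by apply/funext => z; rewrite corr_opp.
  + have -> : (fun x => corr f h (- x)) = corr h f by apply/funext => z; rewrite corr_opp.
    exact: Cc_corr.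
Qed.

End RadonFunctional.

(** * Real reformulations of the complex positivity notions *)

Section ComplexBridge.
Context {R : realType} {G : topologicalZmodType}.
Hypothesis hG : lca_group G.
Implicit Types (f g a b : G -> R) (u : G -> R[i]).

Let ReB (z w : R[i]) : complex.Re (z - w) = complex.Re z - complex.Re w.
Proof. by case: z => a b; case: w. Qed.

Let ImB (z w : R[i]) : complex.Im (z - w) = complex.Im z - complex.Im w.
Proof. by case: z => a b; case: w. Qed.

Lemma Cc_complexP u : Cc (u : G -> (R[i] : numFieldType)) <->
  Cc (fun x => complex.Re (u x)) /\ Cc (fun x => complex.Im (u x)).
Proof.
split=> [cu|[cRe cIm]].
  have [K cK uK] := Cc_supp hG cu.
  have cu' := Cc_continuous cu.
  split; apply/CcP => //; split.
  - move=> x; apply/cvgrPdist_le => e e0.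
    have e0' : 0 < e%:C%C :> R[i] by rewrite ltcR.
    have /cvgrPdist_le/(_ _ e0') := cu' x.
    apply: filterS => y; rewrite -ReB -lecR; exact: le_trans (normc_ge_Re _).
  - by exists K => // x /uK ->.
  - move=> x; apply/cvgrPdist_le => e e0.
    have e0' : 0 < e%:C%C :> R[i] by rewrite ltcR.
    have /cvgrPdist_le/(_ _ e0') := cu' x.
    apply: filterS => y; rewrite -ImB -lecR; apply: le_trans.
    rewrite normc_def lecR -sqrtr_sqr ler_wsqrtr// lerDr; exact: sqr_ge0.
  - by exists K => // x /uK ->.
have [K cK uK] := Cc_supp hG cRe; have [L cL uL] := Cc_supp hG cIm.
apply/CcP => //; split; last first.
  exists (K `|` L); first exact: compactU.
  by move=> x /not_orP[/uK + /uL]; case: (u x) => a b /= -> ->.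
move=> x; apply/cvgrPdist_le => -[e e'] /[dup] e0; rewrite ltcE /= => /andP[/eqP e'0 epos].
subst e'.
have e20 : 0 < e / 2 by lra.
have /cvgrPdist_le/(_ _ e20) := Cc_continuous cRe (x := x).
have /cvgrPdist_le/(_ _ e20) := Cc_continuous cIm (x := x).
apply: filterS2 => y hI hR.
rewrite normc_def (_ : Complex e 0 = e%:C%C)// lecR ReB ImB.
apply: (@le_trans _ _ (`|complex.Re (u x) - complex.Re (u y)| +
  `|complex.Im (u x) - complex.Im (u y)|)); last by lra.
set s := complex.Re _ - _; set t := complex.Im _ - _.
have <- : Num.sqrt ((`|s| + `|t|) ^+ 2) = `|s| + `|t|.
  by rewrite sqrtr_sqr ger0_norm// addr_ge0.
rewrite ler_wsqrtr// [leRHS]sqrrD !real_normK ?num_real// addrAC lerDl.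
by rewrite mulrn_wge0// mulr_ge0.
Qed.

Let sumC (I : Type) (s : seq I) (F : I -> R[i]) :
  \sum_(i <- s) F i =
  Complex (\sum_(i <- s) complex.Re (F i)) (\sum_(i <- s) complex.Im (F i)).
Proof.
elim: s => [|i s ih]; first by rewrite !big_nil.
by rewrite !big_cons ih; case: (F i).
Qed.

Let conjE (z : R[i]) : z^* = Complex (complex.Re z) (- complex.Im z).
Proof. by case: z. Qed.

(** Coefficients 1 and i at the points [x] and 0 force evenness, through the imaginary part of the
    form. Conversely, for even [f] the form at [c] is the sum of the real forms at the real and
    imaginary parts of [c]. *)
Lemma rpositive_definiteP f : rpositive_definite f <-> real_pd f.
Proof.
split=> [pf|[fe fp] n c x].
  split=> [x|n c x].
    pose c (i : 'I_2) : R[i] := if i == ord0 then Complex 1 0 else Complex 0 1.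
    have := pf 2%N c (fun i => if i == ord0 then x else 0).
    rewrite /c !big_ord_recl !big_ord0 /= !conjE /= lecE => /andP[/eqP + _].
    by rewrite /= !subr0 !sub0r; lra.
  have := pf n (fun i => Complex (c i) 0) (fun i => x i).
  rewrite lecE sumC /= => /andP[_]; congr (_ <= _).
  apply: eq_bigr => i _; rewrite sumC /=; apply: eq_bigr => j _.
  by rewrite ?conjE /=; ring.
rewrite lecE sumC /=; apply/andP; split.
  pose F i j := complex.Im (c i) * complex.Re (c j) * f (x i - x j).
  rewrite (eq_bigr (fun i => \sum_(j < n) (F i j - F j i))); last first.
    move=> i _; rewrite sumC /=; apply: eq_bigr => j _.
    rewrite conjE /F -(fe (x j - x i)) opprB.
    by case: (c i) => ? ?; case: (c j) => ? ? /=; ring.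
  under eq_bigr do rewrite sumrB.
  by rewrite sumrB [X in _ - X]exchange_big subrr.
case: n c x => [|n] c x; first by rewrite big_ord0.
pose x' (k : nat) := x (inord k).
have x'E (i : 'I_n.+1) : x i = x' i by rewrite /x' inord_val.
have := fp n.+1 (fun k => complex.Re (c (inord k))) x'.
have := fp n.+1 (fun k => complex.Im (c (inord k))) x'.
move=> h1 h2; apply: le_trans (addr_ge0 h1 h2) _.
rewrite -big_split /= le_eqVlt; apply/orP; left; apply/eqP; apply: eq_bigr => i _.
rewrite sumC /= -big_split; apply: eq_bigr => j _ /=.
rewrite !x'E !inord_val conjE.
by case: (c i) => ? ?; case: (c j) => ? ? /=; ring.
Qed.

Lemma pairing_Cc f (psi : radonMeasure R G) : Cc f -> pairing f psi = psi f.
Proof. by move=> cf; have [[_ _ ->]] := rm_parts psi. Qed.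

Variable lambda : borel_measure R G.
Hypothesis hl : is_haar lambda.
Let rl : radon lambda. Proof. by case: hl. Qed.
Local Notation corr := (correlation lambda).

Let Cc_prod_shift f g z : Cc f -> Cc g -> Cc (fun y => f y * g (y - z)).
Proof.
by move=> cf cg; apply: CcMl => //; [exact: Cc_continuous|exact: Cc_shift].
Qed.

Lemma convolution_tilde u : Cc (u : G -> (R[i] : numFieldType)) ->
  let a x := complex.Re (u x) in let b x := complex.Im (u x) in
  convolution lambda u (tilde u) =
  fun z => Complex (corr a a z + corr b b z) (corr b a z - corr a b z).
Proof.
move=> /Cc_complexP[ca cb] /=; apply/funext => z.
have I1 f g : Cc f -> Cc g ->
    lambda.-integrable setT (EFin \o (fun y : borelType G => f y * g (y - z))).
  by move=> cf cg; exact: (radon_Cc_integrable hG rl (Cc_prod_shift z cf cg)).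
have iaa := I1 _ _ ca ca; have ibb := I1 _ _ cb cb.
have iab := I1 _ _ ca cb; have iba := I1 _ _ cb ca.
rewrite /convolution /cintegral /tilde /correlation.
congr Complex.
  rewrite -RintegralD//.
  apply: eq_Rintegral => y _; rewrite opprB conjE.
  by case: (u y) => ? ?; case: (u _) => ? ? /=; ring.
rewrite -RintegralB//.
apply: eq_Rintegral => y _; rewrite opprB conjE.
by case: (u y) => ? ?; case: (u _) => ? ? /=; ring.
Qed.

(** The order on complex numbers makes nonnegativity include a vanishing imaginary part, which is
    the symmetry clause. *)
Lemma positive_typeP (psi : radonMeasure R G) : positive_type lambda psi <->
  (forall a, Cc a -> 0 <= psi (corr a a)) /\
  (forall a b, Cc a -> Cc b -> psi (corr a b) = psi (corr b a)).
Proof.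
have rpsi := rm_radon psi.
have key u : Cc (u : G -> (R[i] : numFieldType)) ->
    let a x := complex.Re (u x) in let b x := complex.Im (u x) in
    cpairing (convolution lambda u (tilde u)) psi =
    Complex (psi (corr a a) + psi (corr b b)) (psi (corr b a) - psi (corr a b)).
  move=> cu /=; have /Cc_complexP[ca cb] := cu.
  rewrite /cpairing convolution_tilde//= !pairing_Cc.
  - by congr Complex; [rewrite radonD//; exact: Cc_corr|rewrite radonB//; exact: Cc_corr].
  - by apply: CcB => //; exact: Cc_corr.
  - by apply: CcD => //; exact: Cc_corr.
split=> [pt|[psi0 psis] u cu]; last first.
  have /Cc_complexP[ca cb] := cu.
  by rewrite key// lecE /= psis// subrr eqxx addr_ge0// psi0.
have Cc_mk a b : Cc a -> Cc b ->
    Cc ((fun x => Complex (a x) (b x)) : G -> (R[i] : numFieldType)).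
  by move=> ca cb; apply/Cc_complexP.
split=> [a ca|a b ca cb].
  have cu := Cc_mk _ _ ca (Cc0 hG).
  have := pt _ cu; rewrite key// lecE /= => /andP[_].
  rewrite (_ : corr (fun=> 0) (fun=> 0) = fun=> 0); first by rewrite radon0// addr0.
  apply/funext => z; have := corrZl hG hl 0 z (Cc0 hG) (Cc0 hG).
  by under [X in corr X]eq_fun do rewrite mul0r; rewrite mul0r.
have cu := Cc_mk _ _ ca cb.
have := pt _ cu; rewrite key// lecE /= => /andP[/eqP + _].
by move=> h; apply/eqP; rewrite -subr_eq0 -oppr_eq0 opprB h.
Qed.

End ComplexBridge.

(** * Jordan decomposition and translation boundedness *)

Section Jordan.
Context {R : realType} {G : topologicalZmodType}.
Hypothesis hG : lca_group G.
Implicit Types (f g : G -> R) (K V U : set G).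

Section PositivePart.
Variable nu : (G -> R) -> R.
Hypothesis rnu : radon_functional nu.

Definition between0 f g : Prop := Cc g /\ forall x, 0 <= g x <= f x.

(** The Riesz-Kantorovich formula. *)
Definition pos_part f : R := sup [set nu g | g in between0 f].

Let between00 f : (forall x, 0 <= f x) -> between0 f (fun=> 0).
Proof. by move=> f0; split=> [|x]; [exact: Cc0|rewrite lexx f0]. Qed.

Let has_sup_pos f : Cc f -> (forall x, 0 <= f x) -> has_sup [set nu g | g in between0 f].
Proof.
move=> cf f0; split; first by exists (nu (fun=> 0)); exists (fun=> 0) => //; exact: between00.
have [K cK fK] := Cc_supp hG cf; have [M M0 fM] := Cc_bounded hG cf.
have [C C0 HC] := radon_bound hG rnu cK.
exists (C * M) => _ [g [cg g0f] <-]; apply: le_trans (ler_norm _) _; apply: HC => // x.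
  by move=> /fK fx; have := g0f x; rewrite fx => /le_anti.
have /andP[g0 gf] := g0f x; rewrite ger0_norm//.
exact: le_trans gf (le_trans (ler_norm _) (fM x)).
Qed.

Lemma pos_part_ge f g : Cc f -> (forall x, 0 <= f x) -> between0 f g -> nu g <= pos_part f.
Proof.
by move=> cf f0 gf; apply: ub_le_sup; [case: (has_sup_pos cf f0)|exists g].
Qed.

Lemma pos_part_le f B : (forall x, 0 <= f x) -> (forall g, between0 f g -> nu g <= B) ->
  pos_part f <= B.
Proof.
move=> f0 HB; apply: ge_sup; first by exists (nu (fun=> 0)); exists (fun=> 0) => //; exact: between00.
by move=> _ [g gf <-]; exact: HB.
Qed.

Lemma pos_part_form : positive_form pos_part.
Proof.
split=> [f g cf cg f0 g0|a f|f cf f0]; last first.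
- by rewrite -(radon0 hG rnu); apply: pos_part_ge => //; exact: between00.
- rewrite le_eqVlt => /orP[/eqP <- cf f0|a0 cf f0].
    rewrite mul0r; apply/eqP; rewrite eq_le; apply/andP; split.
      apply: pos_part_le => [x|g [cg g0]]; first by rewrite mul0r.
      rewrite (_ : g = fun=> 0) ?(radon0 hG rnu)//; apply/funext => x.
      by have := g0 x; rewrite /= mul0r => /le_anti.
    rewrite -[X in X <= _](radon0 hG rnu); apply: pos_part_ge; first exact: CcZ.
      by move=> x; rewrite mul0r.
    by apply: between00 => x; rewrite mul0r.
  have le_ b h : 0 < b -> Cc h -> (forall x, 0 <= h x) ->
      pos_part (fun x => b * h x) <= b * pos_part h.
    move=> b0 ch h0; apply: pos_part_le => [x|g [cg g0]]; first by rewrite mulr_ge0// ltW.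
    rewrite -ler_pdivrMl// -(radonZ hG rnu)//; apply: pos_part_ge => //.
    split; first exact: CcZ.
    by move=> x; have /andP[g1 g2] := g0 x; rewrite mulr_ge0 ?invr_ge0 ?(ltW b0)//= ler_pdivrMl.
  apply/eqP; rewrite eq_le le_//=.
  have := le_ a^-1 (fun x => a * f x); rewrite invr_gt0 a0 ler_pdivlMl// => /(_ isT).
  rewrite (_ : (fun x => a^-1 * (a * f x)) = f); last first.
    by apply/funext => x; rewrite mulKf// gt_eqF.
  by apply; [exact: CcZ|move=> x; rewrite mulr_ge0// ltW].
- have fg0 x : 0 <= f x + g x by rewrite addr_ge0.
  apply/eqP; rewrite eq_le; apply/andP; split.
    apply: pos_part_le => // h [ch h0].
    (* Riesz decomposition: [0 <= h <= f + g] splits into [min h f], below [f], and a remainder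
       below [g]. *)
    pose h1 x := Num.min (h x) (f x).
    have ch1 : Cc h1 by exact: Cc_min.
    have -> : h = fun x => h1 x + (h x - h1 x) by apply/funext => x; ring.
    rewrite (radonD rnu)//; last exact: CcB.
    apply: lerD; apply: pos_part_ge => //.
      split=> // x; rewrite /h1 ge_min lexx orbT andbT le_min f0 andbT.
      by case/andP: (h0 x).
    split=> [|x]; first exact: CcB.
    by rewrite /h1 minEle; have := h0 x; have := f0 x; have := g0 x; case: ifP => ?; lra.
  rewrite -lerBrDr; apply: pos_part_le => // f1 [cf1 f1f].
  rewrite lerBrDr -lerBrDl; apply: pos_part_le => // g1 [cg1 g1g].
  rewrite lerBrDl -(radonD rnu)//; apply: pos_part_ge => //; first exact: CcD.
  split; first exact: CcD.
  by move=> x; have := f1f x; have := g1g x; lra.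
Qed.

End PositivePart.

(** The last clause records that [rm_pos psi] integrates [f] to the supremum of [nu] over
    [between0 f]; translation boundedness and the support of [kappa] are read off from it. *)
Theorem jordan_decomposition (nu : (G -> R) -> R) : radon_functional nu ->
  exists2 psi : radonMeasure R G, rm_fun psi = nu &
    forall f B, Cc f -> (forall x, 0 <= f x) ->
      (forall g, between0 f g -> nu g <= B) -> \int[rm_pos psi]_x f x <= B.
Proof.
move=> rnu; have pp := pos_part_form rnu.
have pn : positive_form (fun f => pos_part nu f - nu f).
  have [D Z P] := pp; split=> [f g cf cg f0 g0|a f a0 cf f0|f cf f0].
  - by rewrite D// (radonD rnu)//; ring.
  - by rewrite Z// (radonZ hG rnu)//; ring.
  - by rewrite subr_ge0; apply: pos_part_ge => //; split=> // x; rewrite lexx f0.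
have [p rp pE] := riesz_representation hG pp.
have [n rn nE] := riesz_representation hG pn.
have dec : decomposes nu p n.
  split=> // _ /(Cc_pos_neg hG)[f1 [f2 [c1 c2 f10 f20 ->]]].
  rewrite (radonB hG rnu)// !RintegralB//; try by exact: radon_Cc_integrable.
  by rewrite -!pE// -!nE//; ring.
have pos_le p' n' : decomposes nu p' n' -> forall f, Cc f -> (forall x, 0 <= f x) ->
    \int[p]_x f x <= \int[p']_x f x.
  move=> [rp' rn' E] f cf f0; rewrite -pE//; apply: pos_part_le => // g [cg g0f].
  rewrite E//; apply: (@le_trans _ _ (\int[p']_x g x)).
    by rewrite gerBl Rintegral_ge0// => x _; case/andP: (g0f x).
  by apply: Cc_le_Rintegral => // x; case/andP: (g0f x).
have mp : minimal_parts nu p n.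
  split=> // p' n' dec' f cf f0; have le_p := pos_le p' n' dec' f cf f0; split=> //.
  have [_ _ E] := dec; have [_ _ E'] := dec'.
  by have := E f cf; have := E' f cf; lra.
exists (RadonMeasure rnu mp) => //= f B cf f0 HB.
by rewrite -pE//; exact: pos_part_le.
Qed.

End Jordan.

(** * Translation boundedness in terms of compact sets and test functions *)

Section TranslationBounded.
Context {R : realType} {G : topologicalZmodType}.
Hypothesis hG : lca_group G.
Implicit Types (f g : G -> R) (K V U : set G).

Lemma shift_set K (x : G) : [set (y + x)%R | y in K] = [set y | K (y - x)].
Proof.
apply/seteqP; split=> y /=; first by move=> [z Kz <-]; rewrite addrK.
by move=> Ky; exists (y - x) => //; rewrite subrK.
Qed.

Lemma total_variation_ge0 (psi : radonMeasure R G) A : (0 <= Defs.total_variation psi A)%E.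
Proof. by rewrite /Defs.total_variation adde_ge0. Qed.

(** Finitely many translates of the neighbourhood in the definition cover [K]; the case of interest
    is the closure of the fundamental domain. *)
Lemma translation_bounded_compact (psi : radonMeasure R G) K :
  translation_bounded psi -> compact K ->
  exists C : R, forall x, (Defs.total_variation psi [set y | K (y - x)%R] <= C%:E)%E.
Proof.
move=> [K0 [cK0 K00 Kfin]] cK.
set S := ereal_sup _ in Kfin.
have S0 : (0 <= S)%E.
  by apply: le_trans (total_variation_ge0 _ _) _; last by apply: ereal_sup_ubound; exists 0.
have Sfin : S \is a fin_num by rewrite ge0_fin_numE.
have [|s [_ Ks]] := @compact_seq_cover G K (fun a => [set x | K0° (x - a)]) cK.
  move=> a _; split; last by rewrite /= subrr; exact: nbhs_singleton (nbhs_interior K00).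
  exact/open_shift/open_interior.
exists ((size s)%:R * fine S) => x.
have mS (a : G) : measurable ([set y | K0 (y - a)] : set (borelType G)).
  by apply: compact_borel => //; exact: compact_shift.
have bnd (t : seq G) : measurable (\big[setU/set0]_(a <- t) [set y | K0 (y - x - a)%R] : set (borelType G)) /\
    (Defs.total_variation psi (\big[setU/set0]_(a <- t) [set y | K0 (y - x - a)%R]) <=
     ((size t)%:R * fine S)%:E)%E.
  elim: t => [|a t [mt ih]].
    rewrite big_nil mul0r; split; first exact: measurable0.
    by rewrite /Defs.total_variation !measure0 adde0.
  have ma : measurable ([set y | K0 (y - x - a)] : set (borelType G)).
    rewrite (_ : [set y | _] = [set y | K0 (y - (x + a))]); first exact: mS.
    by apply/seteqP; split=> y /=; rewrite opprD addrA.
  rewrite big_cons; split; first exact: measurableU.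
  rewrite /= -natr1 mulrDl mul1r EFinD addeC.
  apply: (@le_trans _ _ (Defs.total_variation psi [set y | K0 (y - x - a)%R] +
     Defs.total_variation psi (\big[setU/set0]_(b <- t) [set y | K0 (y - x - b)%R]))%E).
    by rewrite /Defs.total_variation addeACA leeD// measureU2.
  rewrite leeD// fineK//; apply: ereal_sup_ubound; exists (x + a) => //.
  by rewrite shift_set; congr Defs.total_variation; apply/seteqP; split=> y /=; rewrite opprD addrA.
apply: le_trans _ (bnd s).2.
have sub : [set y | K (y - x)] `<=` \big[setU/set0]_(a <- s) [set y | K0 (y - x - a)%R].
  move=> y /Ks[a as_ /interior_subset Ka]; rewrite -bigcup_seq.
  by exists a.
have mK : measurable ([set y | K (y - x)] : set (borelType G)).
  by apply: compact_borel => //; exact: compact_shift.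
rewrite /Defs.total_variation leeD//; apply: le_measure; rewrite ?inE//; exact: (bnd s).1.
Qed.

Lemma translation_bounded_Cc (psi : radonMeasure R G) f :
  translation_bounded psi -> Cc f -> (forall x, 0 <= f x) ->
  exists C : R, forall x,
    \int[rm_pos psi]_y f (y - x) + \int[rm_neg psi]_y f (y - x) <= C.
Proof.
move=> tb cf f0; have [K cK fK] := Cc_supp hG cf; have [M M0 fM] := Cc_bounded hG cf.
have [C HC] := translation_bounded_compact tb cK.
have [[rp rn _] _] := rm_parts psi.
exists ((M + 1) * C) => x.
have M1 : 0 < M + 1 by lra.
have cKx := compact_shift (a := x) cK.
pose g y := (M + 1)^-1 * f (y - x).
have cg : Cc g by apply: CcZ => //; exact: Cc_shift.
have g01 y : 0 <= g y <= 1.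
  rewrite /g mulr_ge0 ?invr_ge0 ?(ltW M1)//= ler_pdivrMl// mulr1.
  by have := fM (y - x); have := ler_norm (f (y - x)); lra.
have gN y : ~ [set z | K (z - x)] y -> g y = 0 by move=> /fK fy; rewrite /g fy mulr0.
have fE m : radon m -> \int[m]_y f (y - x) = (M + 1) * \int[m]_y g y.
  move=> rm; rewrite Cc_RintegralZ//; last exact: Cc_shift.
  by rewrite mulrA mulfV ?mul1r// gt_eqF.
rewrite !fE// -mulrDr ler_pM2l// -lee_fin EFinD.
by apply: le_trans _ (HC x); rewrite leeD//; exact: Rintegral_le_compact.
Qed.

(** A converse of [translation_bounded_Cc] for a single bump: [2 / f 0] times [f] is at least 1 near
    0. *)
Lemma translation_boundedP (psi : radonMeasure R G) f :
  Cc f -> (forall x, 0 <= f x) -> 0 < f 0 ->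
  (exists C : R, forall x,
    \int[rm_pos psi]_y f (y - x) + \int[rm_neg psi]_y f (y - x) <= C) ->
  translation_bounded psi.
Proof.
move=> cf f0 fpos [C HC].
have [[rp rn _] _] := rm_parts psi.
have [|W [oW W0] [cW Wf]] := @lca_nbhs_compact G hG 0 [set x | f 0 / 2 < f x].
  split; last by rewrite /=; lra.
  apply: (@open_comp _ _ f (fun r => f 0 / 2 < r)); last exact: open_gt.
  by move=> y _; exact: Cc_continuous.
exists (closure W); split=> //.
  apply: filterS (@subset_closure _ W) _; exact: open_nbhs_nbhs.
apply: le_lt_trans (ltry (2 / f 0 * C)); apply: ge_ereal_sup => _ [x _ <-].
rewrite shift_set /Defs.total_variation.
pose g y := 2 / f 0 * f (y - x).
have c0 : 0 < 2 / f 0 by rewrite divr_gt0.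
have cg : Cc g by apply: CcZ => //; exact: Cc_shift.
have g0 y : 0 <= g y by rewrite mulr_ge0// ltW.
have g1 y : [set z | closure W (z - x)] y -> 1 <= g y.
  move=> /Wf /= fy; rewrite /g mulrAC ler_pdivlMr// mul1r; lra.
have cWx := compact_shift (a := x) cW.
apply: (@le_trans _ _ ((\int[rm_pos psi]_y g y)%:E + (\int[rm_neg psi]_y g y)%:E)%E).
  by rewrite leeD//; exact: Rintegral_ge_compact.
rewrite -EFinD lee_fin !Cc_RintegralZ//; try exact: Cc_shift.
by rewrite -mulrDr ler_pM2l.
Qed.

End TranslationBounded.

(** * The Wiener space *)

Section WienerSpace.
Context {R : realType} {G : topologicalZmodType}.
Hypothesis hG : lca_group G.
Variable lambda : borel_measure R G.
Hypothesis hl : is_haar lambda.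
Variables (d : nat) (L B : set G).
Hypotheses (hL : is_lattice d L) (hB : is_fundamental_domain lambda L B).
Implicit Types (f g : G -> R) (K : set G).

Let cB : compact (closure B).
Proof. by have [_ + _ _ _] := hB; rewrite precompactE. Qed.

Let cover x : exists l b, [/\ L l, B b & x = l + b].
Proof. by have [_ _ _ _ /(_ x)[[l b] [[Ll Bb ->] _]]] := hB; exists l, b. Qed.

Let B0 : B !=set0. Proof. by have [l [b [_ Bb _]]] := cover 0; exists b. Qed.

(** Distinct points of a discrete subgroup never differ by an element of a small neighbourhood of 0,
    so each set of a suitable finite cover contains at most one of them. *)
Lemma lattice_compact_finite K : compact K -> finite_set (L `&` K).
Proof.
move=> cK; have [[phi phi_inj phiL] Liso _] := hL.
have L0 : L 0 by rewrite -phiL; exists 0 => //; rewrite raddf0.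
have LB x y : L x -> L y -> L (x - y).
  by rewrite -phiL => -[v _ <-] [w _ <-]; exists (v - w) => //; rewrite raddfB.
have [_ [V V0 VL]] := Liso _ L0.
have [U oU UV] := nbhs0_sub V0.
have [|s [_ Ks]] := @compact_seq_cover G K (fun a => [set x | U (x - a)]) cK.
  by move=> a _; case: oU => oU U0; split; [exact: open_shift|rewrite /= subrr].
apply: (@sub_finite_set _ _ (\bigcup_(a in [set` s]) (L `&` [set x | U (x - a)]))).
  by move=> x [Lx /Ks[a as_ Ua]]; exists a.
apply: bigcup_finite; first exact: finite_seq.
move=> a _; have [->|/set0P[l [Ll /= Ul]]] := eqVneq (L `&` [set x | U (x - a)]) set0.
  exact: finite_set0.
apply: (@sub_finite_set _ _ [set l]); last exact: finite_set1.
move=> m [Lm /= Um]; suff : [set (0 : G)] (m - l) by move=> /subr0_eq.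
rewrite -VL; split; last exact: LB.
by have := UV _ _ Um Ul; rewrite opprB addrA subrK.
Qed.

(** A superset, finite for compact [K], of the lattice points [l] whose cell [B + l] meets [K]. *)
Let cells K : set G := L `&` [set x - b | x in K & b in closure B].

Let cells_finite K : compact K -> finite_set (cells K).
Proof.
move=> cK; apply: lattice_compact_finite.
have -> : [set x - b | x in K & b in closure B] =
    [set x + b | x in K & b in [set - b | b in closure B]].
  apply/seteqP; split=> x.
    by move=> [a Ka [b Lb <-]]; exists a => //; exists (- b) => //; exists b.
  by move=> [a Ka [_ [b Lb <-]] <-]; exists a => //; exists b.
by apply: compact_add => //; exact: compact_opp.
Qed.

Let cellP K l b : L l -> B b -> K (b + l) -> cells K l.
Proof.
move=> Ll Bb Kbl; split=> //; exists (b + l) => //; exists b; first exact: subset_closure.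
by rewrite addrC addKr.
Qed.

Let cellsup f (l : G) : \bar R := ereal_sup [set `|f (b + l)%R|%:E | b in B].

Let cellsup_ge0 f l : (0 <= cellsup f l)%E.
Proof.
have [b Bb] := B0; apply: (@le_trans _ _ `|f (b + l)|%:E); first by rewrite lee_fin.
by apply: ereal_sup_ubound; exists b.
Qed.

Let cells_le f K : compact K ->
  (\sum_(l <- finmap.enum_fset (fset_set (cells K))) cellsup f l <= normX L B f)%E.
Proof.
move=> cK; apply: esum_ge; exists (cells K).
  by split; [exact: cells_finite|move=> l []].
by rewrite fsbig_finite//; exact: cells_finite.
Qed.

Lemma Cc_spaceX f : Cc f -> spaceX L B f.
Proof.
move=> cf; split; first exact: Cc_continuous.
have [K cK fK] := Cc_supp hG cf; have [M M0 fM] := Cc_bounded hG cf.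
have out l : L l -> ~ cells K l -> cellsup f l = 0%E.
  move=> Ll nl; apply/eqP; rewrite eq_le cellsup_ge0 andbT.
  apply: ge_ereal_sup => _ [b Bb <-]; rewrite fK ?normr0// => Kbl.
  by apply: nl; exact: cellP Kbl.
rewrite /normX (eq_esum (b := fun l => if l \in cells K then cellsup f l else 0%E)); last first.
  move=> l Ll; have [//|/negP nl] := boolP (l \in cells K).
  by apply: out => // Kl; apply: nl; rewrite inE.
rewrite -esum_mkcondr esum_fset; last 2 first.
- by apply: (sub_finite_set (B := cells K)); [move=> ? []|exact: cells_finite].
- by move=> l _; exact: cellsup_ge0.
rewrite fsbig_finite/=; last first.
  by apply: (sub_finite_set (B := cells K)); [move=> ? []|exact: cells_finite].
rewrite big_seq; elim/big_ind : _ => // [x y x0 y0|l _]; first by rewrite lte_add_pinfty.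
by apply: le_lt_trans (ltry M); apply: ge_ereal_sup => _ [b _ <-]; rewrite lee_fin.
Qed.

(** [u] is below the finite sum, over the cells meeting its support, of [cellsup f l] times the
    indicator of the closed cell, and each closed cell has measure at most [C]. *)
Lemma Wiener_integral_le (m : borel_measure R G) (C : R) f u : radon m ->
  (forall l, (m [set y | closure B (y - l)%R] <= C%:E)%E) -> spaceX L B f ->
  Cc u -> (forall x, 0 <= u x <= `|f x|) ->
  (\int[m]_x (u x)%:E <= C%:E * normX L B f)%E.
Proof.
move=> rm mC [cf fX] cu uf; have [K cK uK] := Cc_supp hG cu.
have C0 : (0 <= C%:E)%E by apply: le_trans (mC 0); exact: measure_ge0.
set t := finmap.enum_fset (fset_set (cells K)).
have tP l : cells K l -> l \in t.
  by move=> Kl; rewrite /t in_fset_set; [rewrite inE|exact: cells_finite].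
have tL l : l \in t -> L l.
  by rewrite /t in_fset_set; [rewrite inE => -[]|exact: cells_finite].
have cs_fin l : L l -> cellsup f l \is a fin_num.
  move=> Ll; rewrite ge0_fin_numE ?cellsup_ge0//; apply: le_lt_trans fX.
  apply: esum_ge; exists [set l]; first by split; [exact: finite_set1|move=> _ ->].
  by rewrite fsbig_set1.
pose cl l : set (borelType G) := [set y | closure B (y - l)].
have mcl l : measurable (cl l).
  by apply: compact_borel => //; exact: compact_shift.
apply: (@le_trans _ _ (\int[m]_x \sum_(l <- t) ((fine (cellsup f l))%:E * (\1_(cl l) x)%:E))%E).
  apply: ge0_le_integral => //.
  - by move=> x _; rewrite lee_fin; case/andP: (uf x).
  - by apply/measurable_EFinP; exact: continuous_borel (Cc_continuous cu).
  - apply: emeasurable_sum => l; apply/measurable_EFinP/measurable_funM => //.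
  move=> x _; have s0 (s : seq G) : (0 <= \sum_(l <- s) (fine (cellsup f l))%:E * (\1_(cl l) x)%:E)%E.
    by apply: sume_ge0 => l _; rewrite -EFinM lee_fin mulr_ge0// fine_ge0 ?cellsup_ge0.
  have [Kx|/uK -> //] := pselect (K x).
  have [l [b [Ll Bb xE]]] := cover x.
  have lt : l \in t by apply: tP; apply: (cellP Ll Bb); rewrite addrC -xE.
  rewrite (big_rem l)//= -[leLHS]adde0 leeD// indicE mem_set; last first.
    by rewrite /cl /= xE addrC addKr; exact: subset_closure.
  rewrite mulr1n mule1 fineK ?cs_fin//.
  apply: (@le_trans _ _ `|f x|%:E); first by rewrite lee_fin; case/andP: (uf x).
  by apply: ereal_sup_ubound; exists b => //; rewrite xE addrC.
rewrite ge0_integral_sum//; last 2 first.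
- by move=> l; apply/measurable_EFinP/measurable_funM => //; exact: measurable_indic.
- by move=> l x _; rewrite -EFinM lee_fin mulr_ge0// fine_ge0 ?cellsup_ge0.
apply: (@le_trans _ _ (\sum_(l <- t) C%:E * cellsup f l)%E).
  rewrite big_seq [leRHS]big_seq; apply: lee_sum => l /tL Ll.
  rewrite ge0_integralZl//; last 2 first.
  - by apply/measurable_EFinP; exact: measurable_indic.
  - by rewrite lee_fin fine_ge0 ?cellsup_ge0.
  by rewrite integral_indic// setIT fineK ?cs_fin// muleC lee_wpmul2r ?cellsup_ge0//; exact: mC.
by rewrite -ge0_sume_distrr ?lee_wpmul2l ?cells_le// => l _; exact: cellsup_ge0.
Qed.

(** The lattice is countable; [K n] is the union of the closed cells of the integer vectors with
    code below [n]. *)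
Lemma sigma_compact : exists K : nat -> set G, (forall n, compact (K n)) /\
  forall x, exists N, forall n, (N <= n)%N -> K n x.
Proof.
have [[phi _ phiL] _ _] := hL.
pose s n : seq 'rV[int]_d := pmap unpickle (iota 0 n).
exists (fun n => \big[setU/set0]_(v <- s n) [set y | closure B (y - phi v)]); split.
  move=> n; elim: (s n) => [|v r ih]; first by rewrite big_nil; exact: compact0.
  by rewrite big_cons; apply: compactU => //; exact: compact_shift.
move=> x; have [l [b [+ Bb ->]]] := cover x; rewrite -phiL => -[v _ <-].
exists (pickle v).+1 => n vn; rewrite -bigcup_seq; exists v; last first.
  by rewrite /= addrC addKr; exact: subset_closure.
rewrite /= /s mem_pmap; apply/mapP; exists (pickle v); first by rewrite mem_iota.
by rewrite pickleK.
Qed.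

Lemma pd_cutoffs : exists chi : nat -> G -> R,
  (forall n, [/\ Cc (chi n), forall x, 0 <= chi n x <= 1 & real_pd (chi n)]) /\
  forall x, chi n x @[n --> \oo] --> (1 : R).
Proof.
have [e [ce e0 epos _]] := small_corr_bump hG hl (conj openT I : open_nbhs (0 : G) setT).
have cE := Cc_corr hG hl ce ce.
have E_ge0 x : 0 <= correlation lambda e e x by apply: corr_ge0.
have pE := real_pd_corr hG hl ce.
have E0 := corr_pos hG hl ce e0 epos.
have [K [cK KP]] := sigma_compact.
have /choice[chi Hchi] n : exists chi : G -> R,
    [/\ Cc chi, forall x, 0 <= chi x <= 1, real_pd chi &
        forall x, K n x -> 1 - n.+1%:R^-1 <= chi x].
  have [|xs S0 HS] := folner hG cE E_ge0 pE E0 (eta := n.+1%:R^-1) (cK n).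
    by rewrite invr_gt0.
  set S := smear _ xs 0 in S0 HS.
  exists (fun x => S^-1 * smear (correlation lambda e e) xs x); split.
  - by apply: CcZ => //; exact: Cc_smear.
  - move=> x; rewrite mulr_ge0 ?invr_ge0 ?(ltW S0) ?smear_ge0//= ler_pdivrMl// mulr1.
    exact: real_pd_le (real_pd_smear pE xs).
  - by apply: real_pdZ; [rewrite invr_ge0 ltW|exact: real_pd_smear].
  - by move=> x /HS; rewrite ler_pdivlMl// mulrC.
exists chi; split=> [n|x]; first by case: (Hchi n).
have [N HN] := KP x.
apply: (@squeeze_cvgr _ _ _ _ (fun n => 1 - n.+1%:R^-1) (fun=> 1)).
- near=> n; have [_ /(_ x)/andP[_ ->] _ ->//] := Hchi n.
  by apply: HN; near: n; exact: nbhs_infty_ge.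
- rewrite -[X in _ --> X]subr0; apply: cvgB; first exact: cvg_cst.
  exact: cvg_harmonic.
- exact: cvg_cst.
Unshelve. all: by end_near. Qed.

(** [Wiener_integral_le] bounds the integrals of the cut-off functions [chi n * |f|] uniformly in
    [n], and Fatou's lemma passes to [|f|]. *)
Lemma Wiener_integrable (psi : radonMeasure R G) f : translation_bounded psi -> spaceX L B f ->
  (rm_pos psi).-integrable setT (EFin \o (f : borelType G -> R)) /\
  (rm_neg psi).-integrable setT (EFin \o (f : borelType G -> R)).
Proof.
move=> tb fX; have [cf fN] := fX.
have [C HC] := translation_bounded_compact hG tb cB.
have [[rp rn _] _] := rm_parts psi.
have [chi [chiP chi1]] := pd_cutoffs.
have mf : measurable_fun setT (EFin \o (f : borelType G -> R)).
  by apply/measurable_EFinP; exact: continuous_borel.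
suff main m : radon m -> (forall l, (m [set y | closure B (y - l)%R] <= C%:E)%E) ->
    m.-integrable setT (EFin \o (f : borelType G -> R)).
  split; apply: main => // l; apply: le_trans (HC l); rewrite /Defs.total_variation.
    by rewrite leeDl.
  by rewrite leeDr.
move=> rm mC; apply/integrableP; split=> //.
have CN : (C%:E * normX L B f < +oo)%E.
  have C0 : (0 <= C%:E)%E by apply: le_trans (mC 0); exact: measure_ge0.
  by rewrite lte_mul_pinfty.
apply: le_lt_trans CN.
pose g n x : \bar R := (chi n x * `|f x|)%:E.
have cg n : Cc (fun x => chi n x * `|f x|).
  rewrite (_ : (fun x => _) = fun x => `|f x| * chi n x); last first.
    by apply/funext => x; rewrite mulrC.
  apply: CcMl => //; first by move=> x; apply: cvg_norm; exact: cf.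
  by case: (chiP n).
have mg n : measurable_fun setT (g n : borelType G -> \bar R).
  by apply/measurable_EFinP; exact: continuous_borel (Cc_continuous (cg n)).
have g0 n (x : borelType G) : setT x -> (0 <= g n x)%E.
  by move=> _; rewrite lee_fin mulr_ge0//; case: (chiP n) => _ /(_ x)/andP[].
have gcvg x : g n x @[n --> \oo] --> `|f x|%:E.
  apply: cvg_EFin; first by near=> n.
  rewrite -[X in _ --> X]mul1r; apply: cvgM; [exact: chi1|exact: cvg_cst].
apply: (@le_trans _ _ (\int[m]_x limn_einf (g^~ x))%E).
  rewrite le_eqVlt; apply/orP; left; apply/eqP; apply: eq_integral => x _ /=.
  have [-> _] := cvg_limn_einf_sup (gcvg x); by [].
apply: (le_trans (fatou m measurableT mg g0)).
rewrite limn_einf_lim; apply: lime_le; first exact: is_cvg_einfs.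
near=> n; apply: (@le_trans _ _ (\int[m]_x g n x)%E).
  by apply: ereal_inf_lbound; exists n => //=.
apply: (Wiener_integral_le rm mC fX (cg n)) => x.
have [_ /(_ x)/andP[c0 c1] _] := chiP n.
by rewrite mulr_ge0//= ler_piMl.
Unshelve. all: by end_near. Qed.

Lemma pairing_cutoff (chi : nat -> G -> R) (psi : radonMeasure R G) f :
  (forall n, [/\ Cc (chi n), forall x, 0 <= chi n x <= 1 & real_pd (chi n)]) ->
  (forall x, chi n x @[n --> \oo] --> (1 : R)) ->
  translation_bounded psi -> spaceX L B f ->
  pairing (fun x => f x * chi n x) psi @[n --> \oo] --> pairing f psi.
Proof.
move=> chiP chi1 tb fX; have [ip in_] := Wiener_integrable tb fX; have [cf _] := fX.
suff main (m : borel_measure R G) : m.-integrable setT (EFin \o (f : borelType G -> R)) ->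
    \int[m]_x (f x * chi n x) @[n --> \oo] --> \int[m]_x f x.
  by apply: cvgB; exact: main.
move=> im.
have mf : measurable_fun setT (EFin \o (f : borelType G -> R)) by case/integrableP: im.
have cg n : Cc (fun x => f x * chi n x) by apply: CcMl => //; case: (chiP n).
have mg n : measurable_fun setT (fun x : borelType G => (f x * chi n x)%:E).
  by apply/measurable_EFinP; exact: continuous_borel (Cc_continuous (cg n)).
have [|||_ _ cvgI] := @dominated_convergence _ _ _ m setT measurableT
    (fun n x => (f x * chi n x)%:E) (EFin \o f) (fun x => `|f x|%:E) mg mf.
- apply: aeW => x _; apply: cvg_EFin; first by near=> n.
  rewrite /= -[X in _ --> X]mulr1; apply: cvgM; [exact: cvg_cst|exact: chi1].
- exact: integrable_abse im.
- apply: aeW => x n _; rewrite /= lee_fin normrM ler_piMr//.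
  by have [_ /(_ x)/andP[c0 c1] _] := chiP n; rewrite ger0_norm.
apply: fine_cvg; rewrite fineK; last by apply: integrable_fin_num.
exact: cvgI.
Unshelve. all: by end_near. Qed.

End WienerSpace.

(** * Construction of translation bounded measures *)

Section RadonMeasureBuilders.
Context {R : realType} {G : topologicalZmodType}.
Hypothesis hG : lca_group G.
Implicit Types (f g : G -> R) (K V U : set G) (nu : (G -> R) -> R).

Lemma sup_norm_fin f : Cc f -> sup_norm f \is a fin_num /\
  forall x, `|f x| <= fine (sup_norm f).
Proof.
move=> cf; have [M M0 fM] := Cc_bounded hG cf.
have s0 : (0 <= sup_norm f)%E.
  by apply: (@le_trans _ _ (`|f 0|%:E)); [rewrite lee_fin|apply: ereal_sup_ubound; exists 0].
have sM : (sup_norm f <= M%:E)%E.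
  by apply: ge_ereal_sup => _ [x _ <-]; rewrite lee_fin.
have sfin : sup_norm f \is a fin_num.
  by rewrite ge0_fin_numE// (le_lt_trans sM)// ltry.
by split=> // x; rewrite -lee_fin fineK//; apply: ereal_sup_ubound; exists x.
Qed.

(** Positivity implies continuity: if [h = 1] on [K] and [s] is the sup norm of [f], then
    [|f| <= s h], whence [|nu f| <= s * nu h]. *)
Lemma positive_radon_functional nu :
  (forall a f g, Cc f -> Cc g -> nu (fun x => a * f x + g x) = a * nu f + nu g) ->
  (forall f, Cc f -> (forall x, 0 <= f x) -> 0 <= nu f) -> radon_functional nu.
Proof.
move=> lin pos; split=> // K cK.
have [h [ch h01 h1 _]] := @Cc_bump R G hG K setT cK openT (@subsetT _ K).
have h0 x : 0 <= h x by case/andP: (h01 x).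
exists (nu h) => f cf fK; have [sfin sf] := sup_norm_fin cf.
set s := fine (sup_norm f) in sf.
rewrite -[sup_norm f]fineK// -EFinM lee_fin -/s mulrC.
have fh x : `|f x| <= s * h x.
  have [Kx|nKx] := pselect (K x); first by rewrite h1// mulr1.
  have s0 : 0 <= s := le_trans (normr_ge0 _) (sf 0).
  rewrite (_ : f x = 0) ?normr0 ?mulr_ge0//; apply: contra_notP nKx => /eqP fx.
  by apply: fK; exact: subset_closure.
have z0 : nu (fun=> 0) = 0.
  have := lin (-1) _ _ (Cc0 hG) (Cc0 hG).
  by under [X in nu X = _]eq_fun do rewrite mulr0 addr0; lra.
have nZ b : nu (fun x => b * h x) = b * nu h.
  rewrite -[RHS]addr0 -z0 -lin//; last exact: Cc0.
  by congr nu; apply/funext => x; rewrite addr0.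
have bnd b : `|b| <= 1 -> b * nu f <= s * nu h.
  move=> b1; have := pos (fun x => - b * f x + s * h x).
  rewrite lin//; last exact: CcZ.
  rewrite nZ => H; rewrite -subr_ge0 addrC -mulNr; apply: H.
    by apply: CcD => //; exact: CcZ.
  move=> x; rewrite addrC mulNr subr_ge0; apply: le_trans (fh x).
  by rewrite (le_trans (ler_norm _))// normrM ler_piMl.
have := bnd 1; have := bnd (-1); rewrite normrN normr1 mul1r mulN1r lexx => /(_ isT) h2 /(_ isT) h3.
by rewrite ler_norml lerNl h2 h3.
Qed.

Lemma radon_functional_comb nu mu (c : R) : radon_functional nu -> radon_functional mu ->
  radon_functional (fun f => nu f + c * mu f).
Proof.
move=> rnu rmu; split=> [a f g cf cg|K cK].
  by rewrite (radon_linear rnu)// (radon_linear rmu)//; ring.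
have [C C0 HC] := radon_bound hG rnu cK; have [C' C'0 HC'] := radon_bound hG rmu cK.
exists (C + `|c| * C') => f cf fK; have [sfin sf] := sup_norm_fin cf.
rewrite -[sup_norm f]fineK// -EFinM lee_fin.
have fN x : ~ K x -> f x = 0.
  move=> nKx; apply: contra_notP nKx => /eqP fx; apply: fK; exact: subset_closure.
rewrite (le_trans (ler_normD _ _))// mulrDl lerD ?HC//.
by rewrite normrM -mulrA ler_wpM2l// HC'.
Qed.

Section Bounded.
Variable E : G -> R.
Hypotheses (cE : Cc E) (E_ge0 : forall x, 0 <= E x) (E0 : 0 < E 0).

(** Translation boundedness of a bare form, available before any measure represents it and stable
    under linear combinations. *)
Definition shift_bounded nu : Prop :=
  exists C : R, forall x g, between0 (fun y => E (y - x)) g -> `|nu g| <= C.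

Lemma translation_bounded_shift (psi : radonMeasure R G) :
  translation_bounded psi -> shift_bounded psi.
Proof.
move=> tb; have [C HC] := translation_bounded_Cc hG tb cE E_ge0.
have [[rp rn dec] _] := rm_parts psi.
exists C => x g [cg gE]; apply: le_trans (HC x); rewrite dec//.
have cEx := Cc_shift hG x cE.
have g0 y : 0 <= g y by case/andP: (gE y).
have gE' y : g y <= E (y - x) by case/andP: (gE y).
have := Cc_le_Rintegral hG rp cg cEx gE'; have := Cc_le_Rintegral hG rn cg cEx gE'.
have := @Rintegral_ge0 _ _ _ (rm_pos psi) setT g (fun x _ => g0 x).
have := @Rintegral_ge0 _ _ _ (rm_neg psi) setT g (fun x _ => g0 x).
by rewrite ler_norml; lra.
Qed.

Lemma shift_bounded_measure nu : radon_functional nu -> shift_bounded nu ->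
  exists2 psi : radonMeasure R G, rm_fun psi = nu /\ translation_bounded psi &
    forall f B, Cc f -> (forall x, 0 <= f x) ->
      (forall g, between0 f g -> nu g <= B) -> \int[rm_pos psi]_x f x <= B.
Proof.
move=> rnu [C HC]; have [psi psiE Hpsi] := jordan_decomposition hG rnu.
exists psi => //; split=> //.
(* [C] for the positive part and [2 * C] for the negative part, which is the positive part minus
   [nu]. *)
apply: (translation_boundedP hG cE E_ge0 E0); exists (3 * C) => x.
have cEx := Cc_shift hG x cE.
have [[_ _ dec] _] := rm_parts psi.
have hp : \int[rm_pos psi]_y E (y - x) <= C.
  apply: Hpsi => // g gE; exact: le_trans (ler_norm _) (HC x g gE).
have : `|nu (fun y => E (y - x))| <= C.
  by apply: (HC x); split=> // y; rewrite E_ge0 lexx.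
by rewrite ler_norml -psiE dec//; lra.
Qed.

Lemma shift_bounded_comb nu mu (c : R) :
  shift_bounded nu -> shift_bounded mu -> shift_bounded (fun f => nu f + c * mu f).
Proof.
move=> [C HC] [C' HC']; exists (C + `|c| * C') => x g gE.
rewrite (le_trans (ler_normD _ _))// lerD ?(HC x)//.
by rewrite normrM ler_wpM2l// (HC' x).
Qed.

Lemma translation_bounded_comb (psi phi : radonMeasure R G) (c : R) :
  translation_bounded psi -> translation_bounded phi ->
  exists2 mu : radonMeasure R G, translation_bounded mu &
    forall f, mu f = psi f + c * phi f.
Proof.
move=> /translation_bounded_shift t1 /translation_bounded_shift t2.
have [mu [muE tb] _] := shift_bounded_measure
  (radon_functional_comb c (rm_radon psi) (rm_radon phi)) (shift_bounded_comb c t1 t2).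
by exists mu => // f; rewrite muE.
Qed.

End Bounded.

(** By compactness and inner regularity the complement of [closure Theta] is null for both parts of
    [kappa]. The positive part [h] of [g] lives there, so [kappa g <= kappa h = 0]. *)
Lemma rm_support_le0 (kappa : radonMeasure R G) (Theta : set G) g : rm_nonneg kappa ->
  rm_support kappa `<=` closure Theta -> Cc g -> (forall x, Theta x -> g x <= 0) ->
  kappa g <= 0.
Proof.
move=> knn ksupp cg gT.
have [[rp rn dec] _] := rm_parts kappa.
pose U := ~` closure Theta.
have oU : open U by apply: closed_openC; exact: closed_closure.
have g0 x : ~ U x -> g x <= 0.
  rewrite /U /setC /= => /contrapT; apply: (_ : closure Theta `<=` [set x | g x <= 0]).
  have cl : closed [set x | g x <= 0].
    apply: (@closed_comp _ _ g (fun r => r <= 0)); last exact: closed_le.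
    by move=> y _; exact: Cc_continuous.
  by rewrite [X in _ `<=` X]((closure_id _).1 cl); exact: closureS.
pose h x := Num.max (g x) 0.
have ch : Cc h by apply: Cc_max => //; exact: Cc0.
have h0 x : 0 <= h x by rewrite le_max lexx orbT.
have hU x : ~ U x -> h x = 0 by move=> /g0 gx; apply/max_idPr.
have [M M0 hM] := Cc_bounded hG ch.
have nullU m : radon m -> (forall A, (m A <= Defs.total_variation kappa A)%E) -> m U = 0%E.
  move=> [_ _ inn] mle; rewrite inn//; apply/eqP; rewrite eq_le; apply/andP; split; last first.
    by apply: ereal_sup_ubound; exists set0; [split=> //; exact: compact0|exact: measure0].
  apply: ge_ereal_sup => _ [K [cK KU] <-].
  have /choice[V HV] x : exists V : set G, K x -> open_nbhs x V /\ Defs.total_variation kappa V = 0%E.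
    have [Kx|nKx] := pselect (K x); last by exists set0.
    have nx : ~ rm_support kappa x by move=> /ksupp; exact: KU.
    have /existsNP[V /not_implyP[oV /negP/negPn/eqP V0]] := nx.
    by exists V.
  have [|s [sK Ks]] := @compact_seq_cover G K V cK.
    by move=> x /HV[].
  have sub : K `<=` \big[setU/set0]_(x <- s) V x.
    by move=> y /Ks[x xs Vxy]; rewrite -bigcup_seq; exists x.
  have mV x : x \in s -> measurable (V x : set (borelType G)).
    by move=> /sK/HV[[oV _] _]; exact: open_borel.
  have [mB mB0] : measurable (\big[setU/set0]_(x <- s) V x : set (borelType G)) /\
      m (\big[setU/set0]_(x <- s) V x) = 0%E.
    elim: s sK {Ks sub} mV => [|x s ih] sK mV.
      by rewrite big_nil; split; [exact: measurable0|exact: measure0].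
    have [|y ys|mB mB0] := ih.
    - by move=> y ys; apply: sK; rewrite inE ys orbT.
    - by apply: mV; rewrite inE ys orbT.
    have mVx := mV x (mem_head _ _).
    rewrite big_cons; split; first exact: measurableU.
    apply/eqP; rewrite eq_le measure_ge0 andbT.
    apply: (@le_trans _ _ (m (V x) + m (\big[setU/set0]_(y <- s) V y))%E).
      exact: (measureU2 m mVx mB).
    rewrite mB0 adde0.
    by have [_ <-] := HV x (sK x (mem_head _ _)); exact: mle.
  apply: (@le_trans _ _ (m (\big[setU/set0]_(x <- s) V x))); last by rewrite mB0.
  by apply: le_measure; rewrite ?inE//; exact: compact_borel.
have int0 m : radon m -> m U = 0%E -> \int[m]_x h x = 0.
  move=> rm mU0; apply/eqP; rewrite eq_le Rintegral_ge0// andbT.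
  have mU := open_borel oU.
  rewrite -lee_fin EFin_Cc_Rintegral//.
  apply: (@le_trans _ _ (\int[m]_x (M%:E * (\1_U (x : borelType G))%:E))%E).
    apply: ge0_le_integral => //.
    - by move=> x _; rewrite lee_fin.
    - by apply/measurable_EFinP; exact: continuous_borel (Cc_continuous ch).
    - by apply/measurable_EFinP/measurable_funM => //; exact: measurable_indic.
    move=> x _; rewrite -EFinM lee_fin indicE.
    have [_|/negP nU] := boolP (x \in U); first by rewrite mulr1 (le_trans (ler_norm _)).
    by rewrite hU ?mulr0// => Ux; apply: nU; rewrite inE.
  rewrite ge0_integralZl//; last by apply/measurable_EFinP; exact: measurable_indic.
  by rewrite integral_indic// setIT mU0 mule0.
have kh : kappa h = 0.
  rewrite dec// !int0 ?subrr//; apply: nullU => // A; rewrite /Defs.total_variation.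
    by rewrite leeDr.
  by rewrite leeDl.
have : 0 <= kappa (fun x => h x - g x).
  apply: knn; first exact: CcB.
  by move=> x; rewrite subr_ge0 le_max lexx.
by rewrite (radonB hG (rm_radon kappa))// kh; lra.
Qed.

End RadonMeasureBuilders.

(** * Conic duality *)

Section Duality.
Context {R : realType} {G : topologicalZmodType}.
Hypothesis hG : lca_group G.
Variable lambda : borel_measure R G.
Hypothesis hl : is_haar lambda.
Variables (d : nat) (L B : set G).
Hypotheses (hL : is_lattice d L) (hB : is_fundamental_domain lambda L B).
Variable Omega : set G.
Hypotheses (hOmega : Omega = [set - x | x in Omega]) (hOmega0 : (Omega°) 0).
Implicit Types (f g p : G -> R) (psi mu nu kappa rho sigma : radonMeasure R G).

Local Notation cone := (primal_cone L B Omega).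

Let outN x : (~` Omega) x -> (~` Omega) (- x).
Proof. by move=> nx; rewrite hOmega => -[y Oy /oppr_inj yx]; apply: nx; rewrite -yx. Qed.

Lemma primal_bump : exists E : G -> R, [/\ Cc E, forall x, 0 <= E x, 0 < E 0,
  real_pd E & forall x, (~` Omega) x -> E x = 0].
Proof.
have [e [ce e0 epos eO]] := small_corr_bump hG hl (conj (open_interior Omega) hOmega0).
exists (correlation lambda e e); split.
- exact: Cc_corr.
- by move=> x; apply: corr_ge0.
- exact: corr_pos.
- exact: real_pd_corr.
- by move=> x nx; apply: eO => /interior_subset.
Qed.

Lemma Cc_primal_cone f : Cc f -> real_pd f -> (forall x, (~` Omega) x -> f x <= 0) -> cone f.
Proof.
by move=> cf pf fO; split=> //; [exact: (Cc_spaceX hG hL hB cf)|exact/rpositive_definiteP].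
Qed.

(** The cutoffs keep the sign off [Omega], since [chi n >= 0], and positive definiteness, by the
    Schur product, and lead into [C_c], where the splitting of [mu] is available. *)
Lemma MG_dual_cone mu : MG lambda (~` Omega) mu -> dual_cone cone mu.
Proof.
move=> [tb [nu [kappa [[tbn tbk] muE knn ksupp npos]]]]; split=> // f [fX pf fO].
have [chi [chiP chi1]] := pd_cutoffs hG hl hL hB.
have cvgp := pairing_cutoff hG hl hL hB chiP chi1 tb fX.
rewrite -(cvg_lim _ cvgp)//; apply: limr_ge; first by apply/cvg_ex; eexists; exact: cvgp.
near=> n; have [cchi chi01 pchi] := chiP n.
have cfc : Cc (fun x => f x * chi n x) by apply: CcMl => //; case: fX.
rewrite pairing_Cc// muE// subr_ge0; apply: (@le_trans _ _ 0).
  apply: (rm_support_le0 hG knn ksupp cfc) => x /fO fx.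
  by rewrite mulr_le0_ge0//; case/andP: (chi01 x).
have /positive_typeP[//|//|npos0 _] := npos.
apply: (radon_pd_ge0 hG (rm_radon nu) hl npos0 cfc).
by apply: real_pd_mul => //; exact/rpositive_definiteP.
Unshelve. all: by end_near. Qed.

Lemma pairingZ (a : R) f psi : translation_bounded psi -> spaceX L B f ->
  pairing (fun x => a * f x) psi = a * pairing f psi.
Proof.
move=> tb fX; have [ip in_] := Wiener_integrable hG hl hL hB tb fX.
by rewrite /pairing !RintegralZl// mulrBr.
Qed.

(** The relation is known on [C_c] only, and the parts of [mu] need not be combinations of those of
    [rho] and [sigma]; the cutoffs extend it to [spaceX]. *)
Lemma pairing_comb (a : R) f mu rho sigma : translation_bounded mu ->
  translation_bounded rho -> translation_bounded sigma -> spaceX L B f ->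
  (forall g, Cc g -> mu g = rho g - a * sigma g) ->
  pairing f mu = pairing f rho - a * pairing f sigma.
Proof.
move=> tm tr ts fX E.
have [chi [chiP chi1]] := pd_cutoffs hG hl hL hB.
have cm := pairing_cutoff hG hl hL hB chiP chi1 tm fX.
have cr := pairing_cutoff hG hl hL hB chiP chi1 tr fX.
have cs := pairing_cutoff hG hl hL hB chiP chi1 ts fX.
have cc : pairing (fun x => f x * chi n x) mu @[n --> \oo] -->
    pairing f rho - a * pairing f sigma.
  rewrite (_ : (fun n => _) = fun n => pairing (fun x => f x * chi n x) rho -
      a * pairing (fun x => f x * chi n x) sigma); last first.
    apply/funext => n; have [cchi _ _] := chiP n.
    have cfc : Cc (fun x => f x * chi n x) by apply: CcMl => //; case: fX.
    by rewrite !pairing_Cc// E.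
  by apply: cvgB => //; apply: cvgM => //; exact: cvg_cst.
exact: (cvg_unique _ cm cc).
Qed.

Lemma spaceXZ (a : R) f : spaceX L B f -> spaceX L B (fun x => a * f x).
Proof.
move=> [cf fN]; split; first by move=> x; apply: cvgM; [exact: cvg_cst|exact: cf].
have s0 h (l : G) : (0 <= ereal_sup [set `|h (b + l)%R|%:E | b in B] :> \bar R)%E.
  have [_ _ _ _ /(_ 0)[[l' b] [[_ Bb _] _]]] := hB.
  apply: (@le_trans _ _ `|h (b + l)|%:E); first by rewrite lee_fin.
  by apply: ereal_sup_ubound; exists b.
apply: (@le_lt_trans _ _ (`|a|%:E * normX L B f)%E); last by rewrite lte_mul_pinfty.
apply: ge_ereal_sup => _ [A [finA AL] <-].
apply: (@le_trans _ _ (\sum_(l \in A) (`|a|%:E * ereal_sup [set `|f (b + l)%R|%:E | b in B]))%E).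
  apply: lee_fsum => // l Al; apply: ge_ereal_sup => _ [b Bb <-].
  rewrite normrM EFinM lee_wpmul2l//.
  by apply: ereal_sup_ubound; exists b.
rewrite -ge0_mule_fsumr; last by move=> l; exact: s0.
by rewrite lee_wpmul2l//; apply: ereal_sup_ubound; exists A.
Qed.

(* [kappa] is obtained by Hahn-Banach below the sublinear form
   [S g = inf {mu p | p p.d. in C_c, p <= - g_even off Omega}]: [p = 0] shows
   that [kappa] is positive and lives off [Omega], while taking [g = - p] shows
   [mu p + kappa p >= 0]. *)
Lemma dual_cone_form mu : dual_cone cone mu ->
  exists kappa : (G -> R) -> R,
  [/\ forall a f g, Cc f -> Cc g -> kappa (fun x => a * f x + g x) = a * kappa f + kappa g,
      forall g, Cc g -> (forall x, (~` Omega) x -> g x + g (- x) <= 0) -> kappa g <= 0,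
      forall p, Cc p -> real_pd p -> 0 <= mu p + kappa p &
      forall g p, Cc g -> Cc p -> real_pd p ->
        (forall x, (~` Omega) x -> 2 * p x <= - (g x + g (- x))) -> kappa g <= mu p].
Proof.
move=> [tb mucone]; have rmu := rm_radon mu.
pose below g p := [/\ Cc p, real_pd p & forall x, (~` Omega) x -> 2 * p x <= - (g x + g (- x))].
pose S g := inf [set mu p | p in below g].
(* The bounds for [g] and [- g] cancel, so [p + q] is in the cone; this bounds [S g] from below by
   [- mu q]. *)
have below_cone g p q : below g p -> below (fun x => - g x) q -> 0 <= mu p + mu q.
  move=> [cp pp hp] [cq pq hq]; rewrite -(radonD rmu)//.
  have cpq := CcD hG cp cq.
  rewrite -(pairing_Cc mu cpq); apply: mucone; apply: Cc_primal_cone => //.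
    exact: real_pdD.
  by move=> x nx; have := hp x nx; have := hq x nx; lra.
have below_ex g : Cc g -> below g !=set0.
  move=> cg; have [E [cE E_ge0 E0 pE EO]] := primal_bump.
  have [C [C0 [s gs]]] := Cc_dominated hG cE E_ge0 E0 cg.
  pose p x := 2^-1 * (C * \sum_(a <- s) (2 * E x - E (x - a) - E (x + a))).
  exists p; split.
  - apply/CcZ/CcZ => //; apply: Cc_sum => // a.
    apply: CcB => //; first by apply: CcB => //; [exact: CcZ|exact: Cc_shift].
    by rewrite -[a]opprK; exact: Cc_shift.
  - apply: real_pdZ; first by rewrite invr_ge0.
    by apply: real_pdZ => //; apply: real_pd_sum => a; exact: real_pd_diff.
  move=> x nx; rewrite /p mulrA mulfV// mul1r EO// mulr0.
  have -> : \sum_(a <- s) (0 - E (x - a) - E (x + a)) =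
      - (\sum_(a <- s) E (x - a) + \sum_(a <- s) E (- x - a)).
    rewrite -big_split -sumrN; apply: eq_bigr => a _ /=.
    by have [Ee _] := pE; rewrite sub0r opprD -[E (- x - a)]Ee opprB opprK addrC [a + x]addrC addrC.
  have := gs x; have := gs (- x); rewrite !ler_norml => /andP[_ h1] /andP[_ h2].
  by rewrite mulrN lerN2 mulrDr lerD.
have S_le g p : Cc g -> below g p -> S g <= mu p.
  move=> cg gp; apply: ge_inf; last by exists p.
  have [q Hq] := below_ex _ (CcN hG cg).
  by exists (- mu q) => _ [p' Hp' <-]; have := below_cone _ _ _ Hp' Hq; lra.
have hasinf g : Cc g -> has_inf [set mu p | p in below g].
  move=> cg; split; first by have [p Hp] := below_ex g cg; exists (mu p), p.
  have [q Hq] := below_ex _ (CcN hG cg).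
  by exists (- mu q) => _ [p' Hp' <-]; have := below_cone _ _ _ Hp' Hq; lra.
pose V : lmodType R := (G -> R^o).
pose D : set V := [set g : V | Cc (g : G -> R)].
have DD (x y : V) : D x -> D y -> D (x + y) by exact: CcD.
have DZ (a : R) (x : V) : D x -> D (a *: x) by exact: CcZ.
have D0 : D 0 by exact: Cc0.
have subS : sublinear_on D (S : V -> R).
  split=> [x y Dx Dy|a x a0 Dx].
    apply/ler_addgt0Pr => e e0.
    have [|_ [p Hp <-] hp] := @inf_adherent _ _ (e / 2) _ (hasinf x Dx); first by lra.
    have [|_ [q Hq <-] hq] := @inf_adherent _ _ (e / 2) _ (hasinf y Dy); first by lra.
    have [cp pp Hp'] := Hp; have [cq pq Hq'] := Hq.
    have : S (x + y) <= mu (fun z => p z + q z).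
      apply: S_le; first exact: DD.
      split; [exact: CcD|exact: real_pdD|move=> z nz].
      have xyE w : (x + y : V) w = ((x : G -> R) w + (y : G -> R) w)%R :> R by [].
      by have := Hp' z nz; have := Hq' z nz; rewrite !xyE; lra.
    rewrite (radonD rmu)//; rewrite /S in hp hq *; lra.
  rewrite -ler_pdivrMl//; apply: lb_le_inf; first by case: (hasinf x Dx).
  move=> _ [p [cp pp Hp] <-]; rewrite ler_pdivrMl// -(radonZ hG rmu)//.
  apply: S_le; first exact: DZ.
  split; [exact: CcZ|exact: real_pdZ (ltW a0) pp|move=> z nz].
  have axE w : (a *: x : V) w = a * (x : G -> R) w :> R by [].
  by have := Hp z nz; rewrite !axE mulrCA -mulrDr -mulrN ler_pM2l.
have [kappa [klin kS]] := @hahn_banach R V D DD DZ (S : V -> R) D0 subS.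
have below0 g : (forall x, (~` Omega) x -> g x + g (- x) <= 0) -> below g (fun=> 0).
  move=> gO; split; [exact: Cc0|exact: real_pd0|].
  by move=> x nx; rewrite mulr0 oppr_ge0; exact: gO.
have kle g p : Cc g -> below g p -> kappa g <= mu p.
  by move=> cg gp; exact: le_trans (kS g cg) (S_le _ _ cg gp).
exists kappa; split.
- by move=> a f g cf cg; exact: (klin a f g cf cg).
- by move=> g cg /below0 gO; have := kle _ _ cg gO; rewrite (radon0 hG rmu).
- move=> p cp pp; have [pe _] := pp.
  have kN : kappa (fun x => - p x) = - kappa p.
    have := klin (-1) p (fun=> 0) cp (Cc0 hG).
    have -> : (-1 *: (p : V) + (fun=> 0) : V) = (fun x => - p x : R).
      by apply/funext => x; change (-1 * p x + 0 = - p x); rewrite addr0 mulN1r.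
    have : kappa (fun=> 0) = 0.
      have := klin (-1) (fun=> 0) (fun=> 0) (Cc0 hG) (Cc0 hG).
      have -> : (-1 *: ((fun=> 0) : V) + (fun=> 0) : V) = (fun=> 0 : R).
        by apply/funext => x; change (-1 * 0 + 0 = 0 :> R); rewrite addr0 mulr0.
      lra.
    by move=> ->; lra.
  have : kappa (fun x => - p x) <= mu p.
    apply: kle; first exact: CcN.
    split=> // x nx; rewrite pe; lra.
  by rewrite kN; lra.
- by move=> g p cg cp pp H; apply: kle.
Qed.

Lemma dual_cone_MG mu : dual_cone cone mu ->
  (forall f, Cc f -> mu (fun x => f (- x)) = mu f) -> MG lambda (~` Omega) mu.
Proof.
move=> hmu mueven; have [tb _] := hmu; have rmu := rm_radon mu.
have [k [klin kle0 kpd kle]] := dual_cone_form hmu.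
have k0 : k (fun=> 0) = 0.
  have := klin (-1) _ _ (Cc0 hG) (Cc0 hG).
  by under [X in k X = _]eq_fun do rewrite mulr0 addr0; lra.
have kN g : Cc g -> k (fun x => - g x) = - k g.
  move=> cg; have := klin (-1) _ _ cg (Cc0 hG); rewrite k0.
  by under [X in k X = _]eq_fun do rewrite mulN1r addr0; lra.
have kge0 g : Cc g -> (forall x, (~` Omega) x -> 0 <= g x + g (- x)) -> 0 <= k g.
  move=> cg gO; rewrite -oppr_le0 -kN//; apply: kle0; first exact: CcN.
  by move=> x /gO; lra.
have keq0 g : Cc g -> (forall x, (~` Omega) x -> g x + g (- x) = 0) -> k g = 0.
  by move=> cg gO; apply/eqP; rewrite eq_le kle0 ?kge0// => x /gO ->.
have kpos g : Cc g -> (forall x, 0 <= g x) -> 0 <= k g.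
  by move=> cg g0; apply: kge0 => // x _; rewrite addr_ge0.
have rk : radon_functional k := positive_radon_functional hG klin kpos.
have [E [cE E_ge0 E0 pE EO]] := primal_bump.
have sbmu : shift_bounded E mu := translation_bounded_shift hG cE E_ge0 tb.
have sbk : shift_bounded E k.
  have [C HC] := sbmu; exists (mu E + C) => x g [cg gE].
  (* The bound [mu E + C] is that of [mu p] for the [p] below: each of the two translates of [E]
     enters with weight 1/2 and contributes at most [C / 2]. *)
  have cEx := Cc_shift hG x cE.
  have cEmx : Cc (fun y => E (y + x)) by rewrite -[x]opprK; exact: Cc_shift.
  rewrite ger0_norm; last by apply: kpos => // y; case/andP: (gE y).
  pose p y := 2^-1 * (2 * E y - E (y - x) - E (y + x)).
  apply: (@le_trans _ _ (mu p)).
    apply: kle => //.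
    - by apply: CcZ => //; apply: CcB => //; apply: CcB => //; exact: CcZ.
    - by apply: real_pdZ; [rewrite invr_ge0|exact: real_pd_diff].
    move=> y ny; rewrite /p mulrA mulfV// mul1r EO// mulr0.
    have := gE y; have := gE (- y).
    have -> : E (- y - x) = E (y + x) by have [Ee _] := pE; rewrite -Ee opprD !opprK.
    lra.
  rewrite /p (radonZ hG rmu); last by apply: CcB => //; apply: CcB => //; exact: CcZ.
  rewrite !(radonB hG rmu)//; [|exact: CcZ|by apply: CcB => //; exact: CcZ].
  rewrite (radonZ hG rmu)//.
  have h1 : `|mu (fun y => E (y - x))| <= C.
    by apply: (HC x); split=> // y; rewrite E_ge0 lexx.
  have h2 : `|mu (fun y => E (y + x))| <= C.
    by apply: (HC (- x)); split=> // y; rewrite opprK E_ge0 lexx.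
  by move: h1 h2; rewrite !ler_norml; lra.
have [kappa [kE tbk] Hk] := shift_bounded_measure hG cE E_ge0 E0 rk sbk.
have rn : radon_functional (fun f => mu f + 1 * k f) := radon_functional_comb hG 1 rmu rk.
have [nu [nE tbn] _] := shift_bounded_measure hG cE E_ge0 E0 rn (shift_bounded_comb 1 sbmu sbk).
have nuE f : nu f = mu f + k f by rewrite nE mul1r.
split=> //; exists nu, kappa; split.
- by split.
- by move=> f _; rewrite nuE kE addrK.
- by move=> f cf f0; rewrite kE; exact: kpos.
- move=> x; apply: contraPP => nx.
  have [[rp rn' dec] _] := rm_parts kappa.
  pose U := ~` closure (~` Omega).
  have oU : open U by apply: closed_openC; exact: closed_closure.
  move=> /(_ U); apply/existsNP; exists (conj oU nx); apply/negP; rewrite negbK; apply/eqP.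
  (* By the symmetry of [Omega], [f] and its reflection both vanish off it, so [k f = 0]. The
     positive part is bounded through [k] on functions below [f], and the negative part differs from
     it by [k f]. *)
  have small f : Cc f -> (forall x, 0 <= f x) -> (forall x, (~` Omega) x -> f x = 0) ->
      \int[rm_pos kappa]_x f x <= 0 /\ \int[rm_neg kappa]_x f x <= 0.
    move=> cf f0 fO; have kf : k f = 0.
      by apply: keq0 => // y ny; rewrite (fO y ny) (fO _ (outN ny)) addr0.
    have hp : \int[rm_pos kappa]_x f x <= 0.
      apply: Hk => // g [cg gf]; apply: kle0 => // y ny.
      have := gf y; have := gf (- y); rewrite (fO y ny) (fO _ (outN ny)); lra.
    split=> //; have := dec f cf; rewrite kE kf.
    by have := @Rintegral_ge0 _ _ _ (rm_pos kappa) setT f (fun x _ => f0 x); lra.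
  have null (m : borel_measure R G) : radon m -> (forall f, Cc f -> (forall x, 0 <= f x) ->
      (forall x, (~` Omega) x -> f x = 0) -> \int[m]_x f x <= 0) -> m U = 0%E.
    move=> rm Hm; have [_ _ ->] := rm; last exact: oU.
    apply/eqP; rewrite eq_le; apply/andP; split; last first.
      by apply: ereal_sup_ubound; exists set0; [split=> //; exact: compact0|exact: measure0].
    apply: ge_ereal_sup => _ [K [cK KU] <-].
    have [h [ch h01 h1 [M [_ MU Mh]]]] := @Cc_bump R G hG K U cK oU KU.
    have h0 y : 0 <= h y by case/andP: (h01 y).
    apply: (le_trans (Rintegral_ge_compact hG rm cK ch h0 _)).
      by move=> y /h1 ->.
    rewrite lee_fin; apply: Hm => // y ny; apply: Mh => /MU; apply.
    exact: subset_closure.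
  rewrite /Defs.total_variation !null ?adde0// => f cf f0 fO; by case: (small f cf f0 fO).
- apply/(positive_typeP hG hl); split=> [a ca|a b ca cb].
    by rewrite nuE; apply: kpd; [exact: Cc_corr|exact: real_pd_corr].
  have c1 := Cc_corr hG hl ca cb; have c2 := Cc_corr hG hl cb ca.
  have symE u w : Cc u -> Cc w -> (fun x => correlation lambda u w (- x)) = correlation lambda w u.
    by move=> cu cw; apply/funext => x; rewrite corr_opp.
  rewrite !nuE -(mueven _ c1) symE//; congr (_ + _).
  (* The difference of the two correlations is odd, and [k] vanishes on odd functions. *)
  apply/eqP; rewrite -subr_eq0 -(radonB hG rk)//; apply/eqP; apply: keq0; first exact: CcB.
  by move=> x _; rewrite !(corr_opp hG hl)//; ring.
Qed.

End Duality.

(* The first conjunct says that the problem defining [omega] is the conic LP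
   dual of the one defining [alpha]: the two have the same feasible set. *)
Theorem theorem5p1 (R : realType) (G : topologicalZmodType)
    (hG : lca_group G) (hcg : compactly_generated G)
    (lambda : borel_measure R G) (hlambda : is_haar lambda)
    (d : nat) (L B : set G)
    (hL : is_lattice d L) (hB : is_fundamental_domain lambda L B)
    (Omega : set G)
    (hOmega : Omega = [set - x | x in Omega]) (hOmega0 : (Omega°) 0)
    (rho sigma : radonMeasure R G)
    (hrho : tb_measures rho) (hsigma : tb_measures sigma)
    (hspd : strictly_positive_definite lambda L B sigma)
    (heven : rm_even rho) :
  lp_dual_feasible (primal_cone L B Omega) rho sigma
    = multipliers (MG lambda (~` Omega)) rho sigma /\
  alpha L B rho sigma Omega = omega lambda rho sigma (~` Omega).

Proof.
have [sptype spos] := hspd.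
have rho_even f : Cc f -> rho (fun x => f (- x)) = rho f.
  by move=> cf; rewrite -!pairing_Cc//; [exact: heven|exact: Cc_opp].
have sigma_even f : Cc f -> sigma (fun x => f (- x)) = sigma f.
  move=> cf; have [_ ssym] := (positive_typeP hG hlambda sigma).1 sptype.
  exact: (radon_even hG (rm_radon sigma) hlambda ssym cf).
have feq : lp_dual_feasible (primal_cone L B Omega) rho sigma =
    multipliers (MG lambda (~` Omega)) rho sigma.
  apply/seteqP; split=> s [mu hmu muE]; exists mu => //; last first.
    exact: (MG_dual_cone hG hlambda hL hB hmu).
  apply: (dual_cone_MG hG hlambda hL hB hOmega hOmega0 hmu) => f cf.
  by rewrite !muE ?rho_even ?sigma_even//; exact: Cc_opp.
split=> //; rewrite /omega -feq.
have [E [cE E_ge0 E0 pE EO]] := primal_bump hG hlambda hOmega0.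
have Econe : primal_cone L B Omega E.
  by apply: (Cc_primal_cone hG hL hB cE pE) => x /EO ->.
apply/eqP; rewrite eq_le; apply/andP; split; last first.
  apply: ge_ereal_sup => _ [s [mu [tbmu hmu] muE] <-].
  apply: le_ereal_inf_tmp => _ [f [fC fs] <-]; have [fX _ _] := fC.
  have := hmu f fC.
  by rewrite (pairing_comb hG hlambda hL hB tbmu hrho hsigma fX muE) fs mulr1 subr_ge0 lee_fin.
have feasible f : primal_cone L B Omega f -> f <> (fun=> 0) ->
    primal_feasible L B sigma Omega (fun x => (pairing f sigma)^-1 * f x).
  move=> [fX pf fO] fn0; have t0 := spos f fX pf fn0.
  split; last by rewrite (pairingZ hG hlambda hL hB)// mulVf// gt_eqF.
  split; first exact: (spaceXZ hB).
    by apply/rpositive_definiteP; apply: real_pdZ; [rewrite invr_ge0 ltW|exact/rpositive_definiteP].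
  by move=> x /fO fx; rewrite mulr_ge0_le0// invr_ge0 ltW.
have En0 : E <> (fun=> 0) by move=> /(congr1 (@^~ 0)) /= E00; move: E0; rewrite E00 ltxx.
have alpha_le f : primal_cone L B Omega f -> f <> (fun=> 0) ->
    (alpha L B rho sigma Omega <= (pairing (fun x => (pairing f sigma)^-1 * f x) rho)%:E)%E.
  move=> fC fn0; apply: ereal_inf_lbound.
  by exists (fun x => (pairing f sigma)^-1 * f x) => //; exact: feasible.
(* The multiple of [E] is feasible and excludes the value [+oo]; for [-oo] nothing is left to
   prove. *)
move: alpha_le; case: (alpha L B rho sigma Omega) => [a|/(_ E Econe En0)|] alpha_le //; last first.
  exact: leNye.
apply: ereal_sup_ubound; exists a => //.
have [mu tbmu muE] := translation_bounded_comb hG cE E_ge0 E0 (- a) hrho hsigma.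
have muE' f : Cc f -> mu f = rho f - a * sigma f by move=> _; rewrite muE mulNr.
exists mu => //; split=> // f fC; have [fX pf _] := fC.
rewrite (pairing_comb hG hlambda hL hB tbmu hrho hsigma fX muE') subr_ge0.
have [f0|fn0] := pselect (f = fun=> 0).
  have pair0 (psi : radonMeasure R G) : pairing (fun=> 0) psi = 0.
    rewrite (pairing_Cc psi (Cc0 hG)).
    exact: (radon0 hG (rm_radon psi)).
  by rewrite f0 !pair0 mulr0.
have t0 := spos f fX pf fn0.
have := alpha_le f fC fn0; rewrite lee_fin (pairingZ hG hlambda hL hB)//.
by rewrite ler_pdivlMl// mulrC.
Qed.
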